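(* Let $\Phi$ be an asymptotically free finite set of pairwise similar local restriction functions, and let $r$ be the radius of convergence of the generating function of $\mathcal C_\Phi$. For a uniformly random composition of $n$ in $\mathcal C_\Phi$, let $X_0(n)$ be its number of parts and $X_k(n)$ its number of parts equal to $k$. Then for every recurrent part $k$ and every $\epsilon>0$, $$\Pr\left(\left|\frac{X_k(n)}{X_0(n)}-\frac{\mathsf E(X_k(n))}{\mathsf E(X_0(n))}\right|>\epsilon\right)\to 0 \quad (n\to\infty).$$ Furthermore the limit $u_k=\lim_{n\to\infty}\mathsf E(X_k(n))/\mathsf E(X_0(n))$ exists, and there is a constant $B>0$ such that $u_k\sim Br^k$ as $k\to\infty$.
   Context: A composition is a finite sequence $\mathbf c=c_1\cdots c_k$ of positive integers; ${\rm len}(\mathbf c)=k$, $\Sigma(\mathbf c)=\sum_i c_i$, and $\mathbf c$ is a composition of $n$ if $\Sigma(\mathbf c)=n$. A subcomposition is a nonempty block of consecutive parts; juxtaposition of compositions denotes concatenation. For $m,p\in\mathbb N$, a local restriction function of type $(m,p)$ (modulus $m$, span $p$) is a function $\phi:\{0,\dots,m-1\}\times\mathbb N_0^{p+1}\to\{0,1\}$ with $\phi(i;0,\dots,0)=1$ for all $i$. $\mathcal C_\phi$ is the set of compositions $\mathbf c$ with $\phi(i\bmod m;c_i,c_{i-1},\dots,c_{i-p})=1$ for all $i\in\mathbb Z$, where $c_j:=0$ if $j<1$ or $j>{\rm len}(\mathbf c)$; for a set $\Phi$, $\mathcal C_\Phi=\bigcup_{\phi\in\Phi}\mathcal C_\phi$.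 A subcomposition $\mathbf s$ is recurrent at $j$ modulo $m$ in $\mathcal C_\phi$ if for every $k$ and every $\mathbf a\mathbf x\mathbf z\in\mathcal C_\phi$ with ${\rm len}(\mathbf a)\ge p$, ${\rm len}(\mathbf z)\ge p$, there is a composition $\mathbf a\mathbf y\mathbf z\in\mathcal C_\phi$ containing at least $k$ copies of $\mathbf s$ starting at positions congruent to $j$ mod $m$; $\mathbf s$ is recurrent if it is recurrent at some $j$; a recurrent part is a recurrent subcomposition of length 1. $\phi$ is recurrent if every subcomposition $c_i\cdots c_j$ of every $\mathbf c\in\mathcal C_\phi$ with $i>p$ and $j+p\le{\rm len}(\mathbf c)$ is recurrent. Recurrent $\phi,\phi'$ of the same type $(m,p)$ are similar if there is $k$ such that for all $\mathbf s,j$, $\mathbf s$ is recurrent at $j$ mod $m$ in $\mathcal C_\phi$ iff it is recurrent at $j+k$ mod $m$ in $\mathcal C_{\phi'}$. $\phi$ of type $(m,p)$ is asymptotically free if $\phi$ is recurrent and: (a) whenever $j$ and positive integers $r_1,\dots,r_p,r_{p+2},\dots,r_{2p+1}$ are such that $\mathbf r(x)=r_1\cdots r_p\,x\,r_{p+2}\cdots r_{2p+1}$ is recurrent at $j$ mod $m$ for infinitely many $x$, there is $M$ such that whenever $\mathbf r(x)$ occurs at a position congruent to $j$ mod $m$ in a composition of $\mathcal C_\phi$, that $x$ may be replaced by any $x'\ge M$ and the result is still in $\mathcal C_\phi$; (b) at least one such $j$ and $r_i$ exist. A finite set $\Phi$ of pairwise similar local restriction functions is asymptotically free if some $\phi\in\Phi$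 is asymptotically free; recurrent parts of $\mathcal C_\Phi$ are those of its members. The generating function of $\mathcal C_\Phi$ is $\sum_n N(n)x^n$ with $N(n)$ the number of compositions of $n$ in $\mathcal C_\Phi$; it is known that $N(n)\sim Ar^{-n}$ with $A>0$, $0<r<1$. Random means uniform over compositions of $n$ in $\mathcal C_\Phi$. *)

(* Defs.v *)
(* MathComp / MathComp-Analysis *)
From HB Require Import structures.
From mathcomp Require Import all_boot all_order all_algebra finmap.
From mathcomp Require Import all_classical all_reals all_analysis zify.
Set Implicit Arguments.
Unset Strict Implicit.
Unset Printing Implicit Defensive.
Import Order.TTheory GRing.Theory Num.Theory.
Import numFieldNormedType.Exports.
Local Open Scope classical_set_scope.
Local Open Scope ring_scope.

Definition composition (c : seq nat) : bool := all (fun x => 0 < x)%N c.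

(* Parts are numbered from 1; part c i = 0 for i < 1 and for i > size c. *)
Definition part (c : seq nat) (i : int) : nat :=
  if i is Posz i'.+1 then nth 0%N c i' else 0%N.

Record restriction (m p : nat) := Restriction {
  restr_fun :> 'I_m -> p.+1.-tuple nat -> bool ;
  restr_fun0 : forall i, restr_fun i [tuple 0%N | _ < p.+1] }.

(* i0 is the residue of i modulo m, viewed in 'I_m *)
Definition compositions_of (m p : nat) (phi : restriction m p) : set (seq nat) :=
  [set c | composition c /\
    forall (i : int) (i0 : 'I_m), (i %% m%:Z)%Z = i0%:Z ->
      phi i0 [tuple part c (i - l%:Z) | l < p.+1]].

Definition union_compositions_of (m p : nat) (Phi : set (restriction m p)) :
  set (seq nat) := \bigcup_(phi in Phi) compositions_of phi.

(* s starts at position i (numbered from 1) in c *)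
Definition occurs_at (s c : seq nat) (i : nat) : bool :=
  (0 < i)%N && (take (size s) (drop i.-1 c) == s).

Definition copies (m j : nat) (s c : seq nat) : nat :=
  count (fun i => occurs_at s c i && (i == j %[mod m])%N) (iota 1 (size c)).

(* The first two clauses say that s is a subcomposition in C_phi, i.e. a
   nonempty block of consecutive parts of some member. Without the second one,
   every s would be recurrent when no member of C_phi has length at least 2p. *)
Definition recurrent_at (m p : nat) (phi : restriction m p) (j : nat)
    (s : seq nat) : Prop :=
  [/\ s != [::],
      exists u v, compositions_of phi (u ++ s ++ v) &
      forall (k : nat) (a x z : seq nat),
        compositions_of phi (a ++ x ++ z) ->
        (p <= size a)%N -> (p <= size z)%N ->
        exists2 y, compositions_of phi (a ++ y ++ z) &
                   (k <= copies m j s (a ++ y ++ z))%N].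

Definition recurrent_sub (m p : nat) (phi : restriction m p) (s : seq nat) :=
  exists j : nat, recurrent_at phi j s.

Definition recurrent (m p : nat) (phi : restriction m p) : Prop :=
  forall u s v : seq nat, compositions_of phi (u ++ s ++ v) ->
    s != [::] -> (p <= size u)%N -> (p <= size v)%N -> recurrent_sub phi s.

Definition similar (m p : nat) (phi phi' : restriction m p) : Prop :=
  [/\ recurrent phi, recurrent phi' &
      exists k : nat, forall (s : seq nat) (j : nat),
        recurrent_at phi j s <-> recurrent_at phi' (j + k)%N s].

Definition freely_recurrent (m p : nat) (phi : restriction m p) (j : nat)
    (r1 r2 : p.-tuple nat) : Prop :=
  [/\ composition r1, composition r2 &
      infinite_set [set x | recurrent_at phi j (r1 ++ x :: r2)]].

Definition asymptotically_free (m p : nat) (phi : restriction m p) : Prop :=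
  [/\ recurrent phi,
      forall (j : nat) (r1 r2 : p.-tuple nat), freely_recurrent phi j r1 r2 ->
        exists M : nat, forall (u v : seq nat) (x : nat),
          compositions_of phi (u ++ (r1 ++ x :: r2) ++ v) ->
          (size u).+1 = j %[mod m] ->
          forall x' : nat, (0 < x')%N -> (M <= x')%N ->
            compositions_of phi (u ++ (r1 ++ x' :: r2) ++ v) &
      exists (j : nat) (r1 r2 : p.-tuple nat), freely_recurrent phi j r1 r2].

Definition asymptotically_free_set (m p : nat) (Phi : set (restriction m p)) :=
  [/\ finite_set Phi,
      forall phi phi', Phi phi -> Phi phi' -> similar phi phi' &
      exists2 phi, Phi phi & asymptotically_free phi].

Definition recurrent_part (m p : nat) (Phi : set (restriction m p)) (k : nat) :=
  exists2 phi, Phi phi & recurrent_sub phi [:: k].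

Definition compositions_of_n (m p : nat) (Phi : set (restriction m p))
    (n : nat) : set (seq nat) :=
  [set c | union_compositions_of Phi c /\ sumn c = n].

(* hence fset_set (compositions_of_n Phi n) below really is this set *)
Lemma finite_compositions_of_n (m p : nat) (Phi : set (restriction m p)) n :
  finite_set (compositions_of_n Phi n).
Proof.
pose f (k : nat) := [seq map (@nat_of_ord _) (tval t) | t : k.-tuple 'I_n.+1].
apply: (@sub_finite_set _ _ [set` flatten [seq f k | k <- iota 0 n.+1]]);
  last exact: finite_seq.
move=> c [[phi _ [cpos _]] sc].
have szc : (size c <= n)%N.
  rewrite -sc; elim: c cpos {sc} => //= x c IH /andP[x0 /IH]; lia.
have cle : all (fun x => x <= n)%N c.
  apply/allP => x xc; rewrite -sc; elim: c xc {cpos sc szc} => //= y c IH.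
  by rewrite inE => /orP[/eqP->|/IH]; lia.
apply/(@flattenP (seq nat) [seq f k | k <- iota 0 n.+1]); exists (f (size c)).
  by apply: map_f; rewrite mem_iota add0n ltnS szc.
apply/mapP; exists (map_tuple (@inord n) (in_tuple c)); first by rewrite mem_enum.
rewrite /= -map_comp -[LHS]map_id; apply/eq_in_map => x xc /=.
by rewrite inordK // ltnS; exact: (allP cle).
Qed.

Definition Comp (m p : nat) (Phi : set (restriction m p)) (n : nat) :
  {fset seq nat} := fset_set (compositions_of_n Phi n).

(* probability and expectation for a uniformly random element of F *)
Definition unif_prob (R : realType) (T : choiceType) (F : {fset T})
    (P : pred T) : R :=
  (#|` [fset c in F | P c]%fset|%:R / #|` F|%:R).

Definition unif_mean (R : realType) (T : choiceType) (F : {fset T})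
    (X : T -> R) : R :=
  (\sum_(c <- F) X c) / #|` F|%:R.

Definition nparts (R : realType) (c : seq nat) : R := (size c)%:R.

Definition nparts_eq (R : realType) (k : nat) (c : seq nat) : R :=
  (count_mem k c)%:R.

Definition mean_ratio (R : realType) (m p : nat) (Phi : set (restriction m p))
    (k n : nat) : R :=
  unif_mean (Comp Phi n) (@nparts_eq R k) / unif_mean (Comp Phi n) (@nparts R).

Definition radius_of_convergence (R : realType) (a : nat -> R) : \bar R :=
  ereal_sup [set `|x|%:E | x in [set x : R | cvgn (pseries a x)]].

(* Main.v *)
(** The words occurring in the interior of compositions of a recurrent class,
  together with the residue of their position, form an irreducible system: an
  interior occurrence of a word is always recurrent at its own residue, and any
  two such words can be joined.  Fix one occurrence w of a freely recurrent
  pattern r1 x r2.  Cutting at the occurrences of w decomposes words into cycles,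
  a cycle y having weight r^(sum of y); the weights of the cycles sum to at most 1
  at r.

  The key point is that words avoiding w have a strictly larger radius of
  convergence than r.  Such a word either has few parts for its sum (and there
  are exponentially fewer words of this kind), or linearly many of its positions
  are preceded by p bounded parts.  At each of the latter a loop through w of
  bounded sum can be inserted, and the freedom in choosing the places gains an
  exponential factor.

  Hence cycle sums have exponential moments, and an exponentially tilted weight
  bounds the number of compositions in which an additive statistic deviates from
  its value per cycle by r'^(-n) for some r' > r.  By supermultiplicativity there
  are at least c x^(-n) compositions of n for every x > r.  This gives the
  concentration of X_k / X_0 around u_k, the ratio of the numbers of parts k and
  of all parts per cycle.  If k does not occur in w, a cycle with a distinguished
  part k is y1 k y2, of weight r^k times that of (y1, y2); for fixed (y1, y2)
  freeness makes it a cycle for all large k or for none, so dominated convergence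
  gives u_k ~ B r^k. *)
Require Import Defs.
From HB Require Import structures.
From mathcomp Require Import all_boot all_order all_algebra finmap.
From mathcomp Require Import all_classical all_reals all_analysis.
From mathcomp Require Import zify ring lra.
Set Implicit Arguments.
Unset Strict Implicit.
Unset Printing Implicit Defensive.
Import Order.TTheory GRing.Theory Num.Theory.
Import numFieldNormedType.Exports.
Local Open Scope classical_set_scope.
Local Open Scope ring_scope.

(** * Interior words of restricted compositions *)

(** The set of parts is infinite, so a transfer matrix would be infinite too; the scalar weight of
    the cycles takes its place. No exact asymptotics of the counts is used: the exceptional
    compositions are fewer by an exponential factor, which absorbs every imprecision. Concentration
    comes before the limit of the ratio of means, which is deduced from it: a bad composition of n
    has at most n parts, while most compositions have at least a fixed multiple of n parts. Besides
    dominated convergence, freeness yields returns of every large sum, so that no periodicity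
    arises; two different returns of equal sum, whence r < 1; and contexts that accept every large
    part, whence B > 0. The other members of the set are reached through similarity: deprived of p
    parts at each end, their compositions become interior words of the free member, with a shifted
    residue. *)

Lemma part_catl (a b : seq nat) (i : int) :
  i <= (size a)%:Z -> part (a ++ b) i = part a i.
Proof. by case: i => [[|i]|i] //= ia; rewrite nth_cat ifT //; lia. Qed.

Lemma part_catr (a b : seq nat) (i : int) :
  (size a)%:Z < i -> part (a ++ b) i = part b (i - (size a)%:Z).
Proof.
case: i => [[|i]|i] //= ia; rewrite nth_cat ifF; last by lia.
have -> : Posz i.+1 - (size a)%:Z = Posz (i - size a).+1 by lia.
by [].
Qed.

Section Restricted.
Variables (m p : nat) (phi : restriction m p).

(** A window of p + 1 parts ending in [a ++ o] sees nothing of what follows, and one ending later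
    starts inside [o] or after it, where the equal residues of |a| and |a'| make it a window of the
    second composition. *)
Lemma compositions_of_splice (a o b a' b' : seq nat) :
  (p <= size o)%N -> size a = size a' %[mod m] ->
  compositions_of phi (a ++ o ++ b) -> compositions_of phi (a' ++ o ++ b') ->
  compositions_of phi (a ++ o ++ b').
Proof.
move=> po aa' [cab Cab] [cab' Cab']; split.
  by move: cab cab'; rewrite /composition !all_cat => /and3P[-> -> _] /and3P[_ _ ->].
move=> i i0 ii0; have [iao|iao] := lerP i (size (a ++ o))%:Z.
  have := Cab i i0 ii0; congr (is_true (phi i0 _)); apply: eq_mktuple => l.
  have lp : (l <= p)%N by rewrite -ltnS.
  by rewrite (catA a o b) (catA a o b') !(@part_catl (a ++ o)) //; lia.
have {Cab'} := Cab' (i - (size a)%:Z + (size a')%:Z) i0.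
have -> : (i - (size a)%:Z + (size a')%:Z = i %[mod m])%Z.
  by rewrite -modzDmr modz_nat -aa' -modz_nat modzDmr subrK.
move=> /(_ ii0); congr (is_true (phi i0 _)); apply: eq_mktuple => l.
move: iao; rewrite size_cat => iao; have lp : (l <= p)%N by rewrite -ltnS.
by rewrite !(@part_catr _ (o ++ _)) //; [congr part|..]; lia.
Qed.


(* i is the residue of the 0-based position of s, whereas recurrent_at counts from 1 *)
Definition block (i : nat) (s : seq nat) : Prop := exists u v,
  [/\ compositions_of phi (u ++ s ++ v), (p <= size u)%N, (p <= size v)%N &
      size u = i %[mod m]].

Lemma block_mod i j s : i = j %[mod m] -> block i s -> block j s.
Proof. by move=> ij [u [v [? ? ? ui]]]; exists u, v; split; rewrite // ui. Qed.

Lemma block_composition i s : block i s -> composition s.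
Proof. by move=> [u [v [[+ _] _ _ _]]]; rewrite /composition !all_cat => /and3P[]. Qed.

Lemma block_factor i s1 s2 s3 :
  block i (s1 ++ s2 ++ s3) -> block (i + size s1) s2.
Proof.
move=> [u [v [Cc pu pv ui]]]; exists (u ++ s1), (s3 ++ v); split.
- by move: Cc; rewrite -!catA.
- by rewrite size_cat; lia.
- by rewrite size_cat; lia.
- by rewrite size_cat -modnDml ui modnDml.
Qed.

Lemma block_prefix i s1 s2 : block i (s1 ++ s2) -> block i s1.
Proof. by move=> /(@block_factor i [::] s1 s2); rewrite addn0. Qed.

Lemma block_suffix i s1 s2 : block i (s1 ++ s2) -> block (i + size s1) s2.
Proof. by rewrite -[s2]cats0 => /block_factor; rewrite cats0. Qed.

Lemma block_splice i s o t : (p <= size o)%N ->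
  block i (s ++ o) -> block (i + size s) (o ++ t) -> block i (s ++ o ++ t).
Proof.
move=> po [u [v [Cc pu pv ui]]] [u' [v' [Cc' pu' pv' ui']]].
exists u, v'; split => //.
have := @compositions_of_splice (u ++ s) o v u' (t ++ v') po.
rewrite -!catA in Cc Cc' *; apply => //.
by rewrite size_cat ui' -modnDml ui modnDml.
Qed.

Lemma copies_mod j j' s c : j = j' %[mod m] -> copies m j s c = copies m j' s c.
Proof. by move=> jj'; rewrite /copies; apply: eq_count => i; rewrite jj'. Qed.

Lemma recurrent_at_mod j j' s :
  j = j' %[mod m] -> recurrent_at phi j s -> recurrent_at phi j' s.
Proof.
move=> jj' [s0 ex rec]; split => // k a x z Cc pa pz.
by have [y Cy ky] := rec k a x z Cc pa pz; exists y; rewrite -?(copies_mod _ _ jj').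
Qed.


Lemma occurs_atP (s c : seq nat) i : s != [::] ->
  reflect (exists c1 c2, c = c1 ++ s ++ c2 /\ i = (size c1).+1) (occurs_at s c i).
Proof.
move=> s0; apply: (iffP idP) => [/andP[i0 /eqP ts]|[c1 [c2 [-> ->]]]]; last first.
  by rewrite /occurs_at /= drop_size_cat // take_size_cat // eqxx.
exists (take i.-1 c), (drop (size s) (drop i.-1 c)); split.
  by rewrite -[X in _ ++ X ++ _]ts !cat_take_drop.
rewrite size_takel; first by case: i i0 ts.
rewrite leqNgt; apply: contraNN s0 => ci.
by rewrite -ts drop_oversize // ltnW.
Qed.

Lemma copies_factor j (s1 s2 s3 c : seq nat) : s2 != [::] ->
  (copies m j (s1 ++ s2 ++ s3) c <= copies m (j + size s1) s2 c)%N.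
Proof.
move=> s20; have s0 : s1 ++ s2 ++ s3 != [::] by case: s1 s2 s20 => [|? ?] // [|? ?].
rewrite /copies -!size_filter -(size_map (addn (size s1))).
apply: uniq_leq_size; first by rewrite map_inj_uniq ?filter_uniq ?iota_uniq //; exact: addnI.
move=> i' /mapP[i]; rewrite mem_filter => /andP[/andP[/(occurs_atP _ _ s0) occ ij] _] ->.
case: occ ij => c1 [c2 [-> ->]] ij; rewrite mem_filter mem_iota; apply/andP; split.
  rewrite addnC eqn_modDr ij andbT; apply/(occurs_atP _ _ s20).
  by exists (c1 ++ s1), (s3 ++ c2); rewrite -!catA size_cat addSn.
by rewrite !size_cat; case: s2 s20 {s0 ij} => //= *; lia.
Qed.

Lemma recurrent_at_factor j (s1 s2 s3 : seq nat) : s2 != [::] ->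
  recurrent_at phi j (s1 ++ s2 ++ s3) -> recurrent_at phi (j + size s1) s2.
Proof.
move=> s20 [_ [u [v Cuv]] rec]; split => //.
  by exists (u ++ s1), (s3 ++ v); move: Cuv; rewrite -!catA.
move=> k a x z Cc pa pz; have [y Cy ky] := rec k a x z Cc pa pz.
exists y => //; apply: leq_trans ky _; exact: copies_factor.
Qed.

(** Copies that start in [a] or do not end within [a ++ y] start at one of |a| + |s| + |z|
    positions, the list [rest]; one copy more must lie in [y]. *)
Lemma copies_inside j (s a y z : seq nat) : s != [::] ->
  (size a + size s + size z < copies m j s (a ++ y ++ z))%N ->
  exists y1 y2, y = y1 ++ s ++ y2 /\ (size a + size y1).+1 = j %[mod m].
Proof.
move=> s0; set c := a ++ y ++ z => lt_copies.
pose inside i := (size a < i)%N && (i.-1 + size s <= size a + size y)%N.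
have : has (fun i => occurs_at s c i && (i == j %[mod m]) && inside i) (iota 1 (size c)).
  rewrite has_filter -size_eq0 -lt0n -(ltn_add2r (size a + size s + size z)) add0n.
  apply: (leq_trans lt_copies); rewrite /copies -!size_filter.
  set B := [seq _ <- _ | _ && _ && _].
  pose rest := iota 1 (size a) ++ iota (size a + size y - size s).+1 (size s + size z).
  have -> : (size a + size s + size z = size rest)%N.
    by rewrite size_cat !size_iota addnA.
  rewrite -size_cat.
  apply: uniq_leq_size => [|i]; first by rewrite filter_uniq ?iota_uniq.
  rewrite !mem_cat !mem_filter !mem_iota => /andP[-> ic]; rewrite ic andbT.
  move: ic; rewrite /inside /c !size_cat.
  lia.
case/hasP => i _ /andP[/andP[/(occurs_atP _ _ s0)[c1 [c2 [cE ->]]] /eqP ij]].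
rewrite /inside /= ltnS => /andP[ac1 c1y].
exists (drop (size a) c1), (take (size a + size y - size c1 - size s) c2); split.
  have: take (size y) (drop (size a) c) = y by rewrite /c drop_size_cat // take_size_cat.
  move=> yE; rewrite -[LHS]yE cE drop_cat; case: ltngtP ac1 => // [ac1|ac1] _.
    rewrite take_cat size_drop ifF; last by lia.
    rewrite take_cat ifF; last by lia.
    by congr (_ ++ _ ++ take _ _); lia.
  rewrite ac1 subnn drop0 drop_size /= take_cat ifF; last by lia.
  by congr (_ ++ take _ _); lia.
by rewrite size_drop subnKC.
Qed.


Lemma insert_copy j s u v : recurrent_at phi j s -> compositions_of phi (u ++ v) ->
  (p <= size u)%N -> (p <= size v)%N ->
  exists y1 y2, compositions_of phi (u ++ (y1 ++ s ++ y2) ++ v) /\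
                (size u + size y1).+1 = j %[mod m].
Proof.
move=> [s0 _ rec] Cuv pu pv.
have [y Cy ky] := rec (size u + size s + size v).+1 u [::] v Cuv pu pv.
by have [y1 [y2 [yE jE]]] := copies_inside s0 ky; exists y1, y2; rewrite -yE.
Qed.

Lemma insert_copies (js : seq nat) s u v :
  (forall j, j \in js -> recurrent_at phi j s) ->
  compositions_of phi (u ++ v) -> (p <= size u)%N -> (p <= size v)%N ->
  exists y, compositions_of phi (u ++ y ++ v) /\ forall j, j \in js ->
    exists y1 y2, y = y1 ++ s ++ y2 /\ (size u + size y1).+1 = j %[mod m].
Proof.
elim: js => [|j js IH] recs Cuv pu pv; first by exists [::].
have [|y [Cy yjs]] := IH _ Cuv pu pv.
  by move=> j' j'js; apply: recs; rewrite inE j'js orbT.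
have [||y1 [y2 [Cy' jE]]] := insert_copy (recs j (mem_head _ _)) (u := u ++ y) (v := v) _ _ pv.
- by rewrite -catA.
- by rewrite size_cat; lia.
exists (y ++ y1 ++ s ++ y2); split; first by move: Cy'; rewrite -!catA.
move=> j'; rewrite inE => /predU1P[->|/yjs[z1 [z2 [-> zE]]]].
  by exists (y ++ y1), y2; rewrite -!catA; split=> //; move: jE; rewrite !size_cat addnA.
by exists z1, (z2 ++ y1 ++ s ++ y2); rewrite -!catA.
Qed.

Hypothesis hm : (0 < m)%N.
Hypothesis phi_rec : recurrent phi.

(* The residues at which s recurs are closed under the shift by j' - (|u|+1),
   where j' is a residue at which a word starting with s and containing s at all
   these residues recurs; iterating this shift m times leads back to |u|+1. *)
Lemma recurrent_at_occurrence u s v : compositions_of phi (u ++ s ++ v) ->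
  s != [::] -> (p <= size u)%N -> (p <= size v)%N ->
  recurrent_at phi (size u).+1 s.
Proof.
move=> Cusv s0 pu pv.
pose js := [seq j <- iota 0 m | `[< recurrent_at phi j s >] ].
have [||||y [Cy yjs]] := @insert_copies js s (u ++ s) v.
- by move=> j; rewrite mem_filter => /andP[/asboolP].
- by rewrite -catA.
- by rewrite size_cat; lia.
- by [].
have [||//|//|j' recsy] := @phi_rec u (s ++ y) v.
- by move: Cy; rewrite -!catA.
- by case: s s0 {Cusv js Cy yjs}.
have recs : recurrent_at phi j' s.
  by have := @recurrent_at_factor j' [::] s y s0 recsy; rewrite addn0.
have step j : recurrent_at phi j s ->
    exists2 j1, recurrent_at phi j1 s & (j1 + (size u).+1 = j' + j %[mod m])%N.
  move=> recj; have /yjs[y1 [y2 [yE jE]]] : (j %% m)%N \in js.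
    rewrite mem_filter mem_iota ltn_mod hm leq0n !andbT; apply/asboolP.
    by apply: (recurrent_at_mod _ recj); rewrite modn_mod.
  exists (j' + size (s ++ y1))%N.
    by apply: (@recurrent_at_factor _ _ _ y2) => //; move: recsy; rewrite yE catA.
  rewrite modn_mod in jE; rewrite -addnA -[RHS]modnDmr -jE modnDmr !size_cat; congr modn; lia.
have iter t : exists2 j, recurrent_at phi j s & (j + t * (size u).+1 = t.+1 * j' %[mod m])%N.
  elim: t => [|t [j recj jE]]; first by exists j'; rewrite ?mul1n ?mul0n ?addn0.
  have [j1 recj1 j1E] := step j recj; exists j1 => //.
  rewrite mulSn addnA -modnDml j1E modnDml -addnA -modnDmr jE modnDmr; congr modn; lia.
(* For t = m - 1 the right side is a multiple of m, so j is -(m - 1)(|u| + 1), that is |u| + 1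
   modulo m. *)
have [j recj jE] := iter m.-1; apply: (recurrent_at_mod _ recj).
rewrite -[LHS](modnMDl (size u).+1).
have -> : ((size u).+1 * m + j = (j + m.-1 * (size u).+1) + (size u).+1)%N.
  by rewrite -{1}(prednK hm); lia.
by rewrite -modnDml jE prednK // modnMr add0n.
Qed.


Lemma block_recurrent_at i s : block i s -> s != [::] -> recurrent_at phi i.+1 s.
Proof.
move=> [u [v [Cusv pu pv ui]]] s0; apply: (recurrent_at_mod _ (recurrent_at_occurrence Cusv s0 pu pv)).
by rewrite -addn1 -modnDml ui modnDml addn1.
Qed.

(** Recurrence by itself gives no interior occurrence; [c] is long enough for [s] to be inserted
    with p parts on each side. *)
Lemma recurrent_at_block (c : seq nat) i s :
  compositions_of phi c -> (p + p <= size c)%N -> recurrent_at phi i.+1 s -> block i s.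
Proof.
move=> Cc pc rec; have [|||y1 [y2 [Cy iE]]] := insert_copy rec (u := take p c) (v := drop p c).
- by rewrite cat_take_drop.
- by rewrite size_takel; lia.
- by rewrite size_drop; lia.
exists (take p c ++ y1), (y2 ++ drop p c); split.
- by move: Cy; rewrite -!catA.
- by rewrite size_cat size_takel; lia.
- by rewrite size_cat size_drop; lia.
- by apply/eqP; rewrite -(eqn_modDr 1) !addn1 size_cat iE.
Qed.

(** Irreducibility: recurrence inserts [s'] at its own residue between [s] and the old right
    context. *)
Lemma block_connect i s i' s' : block i s -> block i' s' -> s' != [::] ->
  exists y, block i (s ++ y ++ s') /\ (i + size s + size y = i' %[mod m])%N.
Proof.
move=> [u [v [Cusv pu pv ui]]] bs' s'0.
have [||//|y1 [y2 [Cy iE]]] :=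
  insert_copy (block_recurrent_at bs' s'0) (u := u ++ s) (v := v).
- by rewrite -catA.
- by rewrite size_cat; lia.
exists y1; split.
  exists u, (y2 ++ v); split => //; first by move: Cy; rewrite -!catA.
  by rewrite size_cat; lia.
rewrite -addnA -modnDml -ui modnDml addnA -size_cat.
by apply/eqP; rewrite -(eqn_modDr 1) !addn1 iE.
Qed.

Hypothesis phi_free : asymptotically_free phi.

Lemma block_replace j (r1 r2 : p.-tuple nat) : freely_recurrent phi j r1 r2 ->
  exists M, forall i u1 u2 x x', block i (u1 ++ (r1 ++ x :: r2) ++ u2) ->
    (i + size u1).+1 = j %[mod m] -> (0 < x')%N -> (M <= x')%N ->
    block i (u1 ++ (r1 ++ x' :: r2) ++ u2).
Proof.
case: phi_free => _ free _ /free[M replM]; exists M.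
move=> i u1 u2 x x' [u [v [Cc pu pv ui]]] ij x'0 Mx'; exists u, v; split => //.
have catE y : u ++ (u1 ++ (r1 ++ y :: r2) ++ u2) ++ v =
    (u ++ u1) ++ (r1 ++ y :: r2) ++ (u2 ++ v) by rewrite -!catA.
move: Cc; rewrite !catE => Cc; apply: (replM _ _ _ Cc _ _ x'0 Mx').
by rewrite -ij size_cat -!addnS -modnDml ui modnDml.
Qed.

(** If infinitely many [k] fit, the p parts on either side of the gap form a freely recurrent
    pattern, so all large [k] fit; otherwise only finitely many do. *)
Lemma block_middle i u1 u2 : (p <= size u1)%N -> (p <= size u2)%N ->
  (exists K, forall k, (K <= k)%N -> block i (u1 ++ k :: u2)) \/
  (exists K, forall k, (K <= k)%N -> ~ block i (u1 ++ k :: u2)).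
Proof.
move=> pu1 pu2; pose S := [set k | block i (u1 ++ k :: u2)].
have [finS|infS] := pselect (finite_set S); [right|left].
  have /finite_fsetP[X SX] := finS.
  exists (\max_(k <- X) k).+1 => k; rewrite ltnNge => /negP Xk Sk; apply: Xk.
  have kX : [set` X] k by rewrite -SX.
  exact: (@leq_bigmax_seq nat (enum_fset X) xpredT id k kX isT).
have sz1 : size (drop (size u1 - p) u1) == p by rewrite size_drop; lia.
have sz2 : size (take p u2) == p by rewrite size_takel.
pose r1 := Tuple sz1; pose r2 := Tuple sz2.
have uE k : u1 ++ k :: u2 = take (size u1 - p) u1 ++ (r1 ++ k :: r2) ++ drop p u2.
  by rewrite /= -catA /= cat_take_drop catA cat_take_drop.
have [k0 Sk0] : S !=set0 by apply/set0P/eqP => S0; apply: infS; rewrite S0.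
have := block_composition Sk0; rewrite uE /composition !all_cat /=.
case/and3P => _ /and3P[r1pos _ r2pos] _.
have [|M replM] := @block_replace (i + (size u1 - p)).+1 r1 r2.
  split => //; apply: sub_infinite_set infS => k Sk.
  apply: block_recurrent_at; last by rewrite -size_eq0 size_cat addnS.
  rewrite /S /= uE in Sk; have := block_factor Sk.
  by rewrite size_takel ?leq_subr.
exists M.+1 => k Mk; rewrite uE; apply: (replM _ _ _ k0); rewrite -?uE //.
- by rewrite size_takel //; lia.
- lia.
- lia.
Qed.

End Restricted.

(** * Returns to a marked word *)

Lemma suffix_natP (s t : seq nat) : reflect (exists t0 : seq nat, t = t0 ++ s) (suffix s t).
Proof. exact: suffixP. Qed.

Section Marked.
Variables (m p : nat) (phi : restriction m p).
Hypothesis hm : (0 < m)%N.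
Hypothesis phi_rec : recurrent phi.
Local Notation block := (block phi).

Variables (w : seq nat) (i0 : nat).
Hypothesis pw : (p <= size w)%N.
Hypothesis w0 : w != [::].
Hypothesis bw : block i0 w.

(* y may be shorter than w: the two occurrences of w are allowed to overlap *)
Definition return_word (y : seq nat) : Prop :=
  [/\ block i0 (w ++ y), suffix w (w ++ y) & (m %| size y)%N].

Lemma return_word0 : return_word [::].
Proof. by split; rewrite ?cats0 ?suffix_refl ?dvdn0. Qed.

Lemma return_word_cat y y' : return_word y -> return_word y' -> return_word (y ++ y').
Proof.
move=> [by1 /suffix_natP[t1 e1] my1] [by2 /suffix_natP[t2 e2] my2]; split.
- rewrite catA e1 -catA; apply: block_splice => //; first by rewrite -e1.
  apply: (block_mod _ by2); have := congr1 size e1; rewrite !size_cat => te.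
  have -> : size t1 = size y by lia.
  by rewrite -modnDmr (eqP my1) addn0.
- by rewrite catA e1 -catA e2; apply/suffix_natP; exists (t1 ++ t2); rewrite catA.
- by rewrite size_cat dvdn_addr.
Qed.

Lemma return_word_drop y y' : return_word (y ++ y') -> return_word y -> return_word y'.
Proof.
move=> [by1 /suffix_natP[t1 e1] my1] [by2 /suffix_natP[t2 e2] my2].
have t2y : size t2 = size y by have := congr1 size e2; rewrite !size_cat; lia.
split.
- have := by1; rewrite catA e2 -catA => /block_suffix bt; apply: (block_mod _ bt).
  by rewrite t2y -modnDmr (eqP my2) addn0.
- have e3 : t2 ++ (w ++ y') = t1 ++ w by rewrite catA -e2 -catA.
  have := congr1 (drop (size t2)) e3; rewrite drop_size_cat // => ->.
  have t21 : (size t2 <= size t1)%N.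
    by have := congr1 size e3; rewrite !size_cat; lia.
  by rewrite drop_cat; case: ltngtP t21 => // [_|->] _; rewrite ?subnn ?drop0 ?suffix_suffix ?suffix_refl.
- by move: my1; rewrite size_cat dvdn_addr.
Qed.

(** Free generators of the monoid of returns: [return_word_split] factors every return into cycles,
    and [cycle_word_cat_inj] makes the factorization unique. *)
Definition cycle_word (y : seq nat) : Prop :=
  [/\ y != [::], return_word y &
      forall y1 y2, y = y1 ++ y2 -> return_word y1 -> y1 = [::] \/ y2 = [::]].

Lemma return_word_split y : return_word y -> y != [::] ->
  exists c y', [/\ y = c ++ y', cycle_word c & return_word y'].
Proof.
have [n] := ubnP (size y); elim: n => // n IH in y *; rewrite ltnS => yn ry y0.
have [cy|ncy] := pselect (cycle_word y).
  by exists y, [::]; rewrite cats0; split=> //; exact: return_word0.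
have [y1 [y2 [yE ry1 y10 y20]]] : exists y1 y2,
    [/\ y = y1 ++ y2, return_word y1, y1 != [::] & y2 != [::]].
  apply: contrapT => H; apply: ncy; split=> // y1 y2 yE ry1.
  case: (eqVneq y1 [::]) => [->|y10]; [by left|right].
  by apply/eqP; apply: contrapT => /negP y20; apply: H; exists y1, y2.
have szy : (size y1 < n)%N.
  by move: yn; rewrite yE size_cat; case: y2 y20 {yE} => //= *; lia.
have [c [y' [y1E cc ry']]] := IH y1 szy ry1 y10.
exists c, (y' ++ y2); split=> //; first by rewrite yE y1E catA.
apply: return_word_cat => //; apply: (@return_word_drop y1) => //.
by rewrite -yE.
Qed.

Lemma cycle_word_cat_inj c c' y y' : cycle_word c -> cycle_word c' ->
  c ++ y = c' ++ y' -> c = c' /\ y = y'.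
Proof.
wlog cc' : c c' y y' / (size c <= size c')%N => [H|] hc hc' e.
  case: (leqP (size c) (size c')) => [|/ltnW] cc'; first exact: H.
  by have [-> ->] := H _ _ _ _ cc' hc' hc (esym e).
have c'E : c' = c ++ drop (size c) c'.
  have := congr1 (take (size c)) e; rewrite take_size_cat // takel_cat // => {1}->.
  by rewrite cat_take_drop.
have [c0 rc _] := hc; have [_ _ minc'] := hc'.
have [cN|d0] := minc' _ _ c'E rc; first by rewrite cN in c0.
by move: e c'E; rewrite d0 cats0 => + c'E; rewrite c'E => /eqP; rewrite eqseq_cat // eqxx /= => /eqP.
Qed.

Definition avoid (i : nat) (z : seq nat) : Prop :=
  forall z1 z2, z = z1 ++ w ++ z2 -> (i + size z1 != i0 %[mod m])%N.

Lemma avoid0 i : avoid i [::].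
Proof. by move=> [|? ?] z2; case: w w0. Qed.

Lemma avoid_prefix i z z' : avoid i (z ++ z') -> avoid i z.
Proof. by move=> a z1 z2 e; apply: (a _ (z2 ++ z')); rewrite e -!catA. Qed.

Lemma avoid_mod i j z : i = j %[mod m] -> avoid i z -> avoid j z.
Proof. by move=> ij a z1 z2 /a; rewrite -modnDml ij modnDml. Qed.

Lemma avoid_rcons i z a : avoid i z -> avoid i (rcons z a) \/
  exists b, rcons z a = b ++ w /\ (i + size b = i0 %[mod m])%N.
Proof.
move=> az; have [|naz] := pselect (avoid i (rcons z a)); [by left|right].
have [b [z2 [e ib]]] : exists b z2, rcons z a = b ++ w ++ z2 /\ (i + size b = i0 %[mod m])%N.
  apply: contrapT => H; apply: naz => z1 z2 e; apply/eqP => ib; apply: H.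
  by exists z1, z2.
case: (lastP z2) e => [|z2' a'] e; first by exists b; rewrite e cats0.
move: e; rewrite -!rcons_cat => /rcons_inj[zE _].
by have := az _ _ zE; rewrite ib eqxx.
Qed.

(** Scanning from the left, [b] stops one part before the first occurrence of [w] is complete;
    afterwards [e] is absorbed into [y] each time it contains a complete occurrence. Occurrences
    straddling [y] and [e] are left alone: the decomposition only serves upper bounds on weights. *)
Lemma block_decomposition i u : block i u -> avoid i u \/
  exists b y e, [/\ u = rcons b (last 0%N w) ++ y ++ e,
    block i b, avoid i b, return_word y &
    block (i0 + size w) e /\ avoid (i0 + size w) e].
Proof.
(* The induction keeps the occurrence of [w] that ends the first piece, since the return [y] must be
   read after a full [w]. *)
move=> bu; suff : avoid i u \/ exists b b' y e, [/\ u = rcons b' (last 0%N w) ++ y ++ e,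
    rcons b' (last 0%N w) = b ++ w /\ (i + size b = i0 %[mod m])%N, avoid i b',
    return_word y & avoid (i0 + size w) e].
  case=> [|[b [b' [y [e [uE [bE ib] ab ry ae]]]]]]; [by left|right].
  exists b', y, e; split => //.
    by move: bu; rewrite uE -cats1 -catA => /block_prefix.
  split=> //; move: bu; rewrite uE bE -!catA => /block_suffix/block_suffix/block_suffix be.
  apply: (block_mod _ be); rewrite -(modnDmr _ (size y)); have [_ _ /eqP->] := ry.
  by rewrite addn0 -modnDml ib modnDml.
elim/last_ind: u bu => [_|u a IH bu]; first by left; exact: avoid0.
have bu' : block i u by move: bu; rewrite -cats1 => /block_prefix.
case: (IH bu') => [au|[b [b' [y [e [uE [bE ib] ab ry ae]]]]]].
  have [?|[b [bE ib]]] := avoid_rcons a au; [by left|right].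
  have aE : a = last 0%N w by have := congr1 (last 0%N) bE; rewrite last_rcons last_cat; case: w w0.
  exists b, u, [::], [::]; rewrite -aE; split=> //.
  - by rewrite !cats0.
  - exact: return_word0.
  - exact: avoid0.
right; have [ae'|[e' [eE ie]]] := avoid_rcons a ae.
  by exists b, b', y, (rcons e a); split=> //; rewrite uE -!rcons_cat.
exists b, b', (y ++ rcons e a), [::]; split => //; last exact: avoid0.
  by rewrite uE cats0 -!rcons_cat.
have m_ie : (m %| size (rcons e a))%N.
  rewrite eE size_cat /dvdn; apply/eqP.
  rewrite -(mod0n m); apply/eqP; rewrite -(eqn_modDl i0) addn0; apply/eqP.
  by rewrite -ie; congr modn; lia.
have [bry _ mry] := ry.
split; last by rewrite size_cat dvdn_addr.
- move: bu; rewrite uE !rcons_cat bE -catA => /block_suffix be.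
  exact: (block_mod _ be).
- by rewrite eE !catA suffix_suffix.
Qed.

(** A complete occurrence of [w] at residue [i0] before the last part would end a shorter nonempty
    return, against minimality. *)
Lemma cycle_word_rcons y : cycle_word y -> exists y', [/\ y = rcons y' (last 0%N w),
  block (i0 + size w) y' & avoid (i0 + size w) y'].
Proof.
move=> [y0 [by1 sy my] miny]; case/lastP: y => // y' a in y0 by1 sy my miny *.
have aE : a = last 0%N w.
  by case/suffix_natP: sy => t /(congr1 (last 0%N)); rewrite -rcons_cat last_rcons last_cat; case: w w0.
exists y'; rewrite -aE; split=> //.
  by move: by1; rewrite -cats1 => /block_suffix/block_prefix.
move=> z1 z2 yE; apply/negP => /eqP ie.
have yE' : rcons y' a = (z1 ++ w) ++ rcons z2 a by rewrite yE !rcons_cat -catA.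
have [] := miny _ _ yE'.
- split.
  + by move: by1; rewrite yE' catA => /block_prefix.
  + by rewrite catA suffix_suffix.
  + rewrite size_cat /dvdn -(mod0n m) -(eqn_modDl i0) addn0; apply/eqP.
    by rewrite -ie; congr modn; lia.
- by case: z1 {yE yE' ie} => //; case: w w0.
- by case: z2 {yE yE'}.
Qed.

Lemma block_loop i s : block i s -> s != [::] ->
  exists y, [/\ block i (s ++ y), suffix s (s ++ y), (m %| size y)%N &
                ~ avoid (i + size s) y].
Proof.
move=> bs s0; have [y1 [by1 iy1]] := block_connect hm phi_rec bs bw w0.
have [y2 [by2 iy2]] := block_connect hm phi_rec by1 bs s0.
exists ((y1 ++ w) ++ y2 ++ s); split.
- by move: by2; rewrite -!catA.
- by rewrite !catA suffix_suffix.
- rewrite /dvdn -(mod0n m) -(eqn_modDl (i + size s)) addn0; apply/eqP.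
  move: iy2; rewrite !size_cat => iy2; rewrite -[RHS]modnDml -iy2 modnDml; congr modn; lia.
- by move=> /(_ y1 (y2 ++ s)); rewrite -catA iy1 eqxx => /(_ erefl).
Qed.

End Marked.

(** * Total weights of sets of words *)

Section EsumTools.
Variable R : realType.
Local Open Scope ereal_scope.

Lemma esum_subset (T : choiceType) (A B : set T) (a : T -> \bar R) :
  A `<=` B -> \esum_(x in A) a x <= \esum_(x in B) a x.
Proof.
move=> AB; apply: ge_ereal_sup => _ [X [finX XA] <-]; apply: esum_ge.
by exists X => //; split => // x /XA /AB.
Qed.

Lemma esum_le_inj (T T' : choiceType) (A : set T) (B : set T') (g : T -> T')
    (a : T -> \bar R) (b : T' -> \bar R) :
  set_inj A g -> (forall x, A x -> B (g x)) -> (forall x, A x -> a x <= b (g x)) ->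
  \esum_(x in A) a x <= \esum_(y in B) b y.
Proof.
move=> gA AB ab; apply: (le_trans (le_esum ab)).
rewrite -(esum_image _ _ _ gA); apply: esum_subset => _ [x Ax <-]; exact: AB.
Qed.

Lemma esum_setU_le (T : choiceType) (A B : set T) (a : T -> \bar R) :
  (forall x, 0 <= a x) ->
  \esum_(x in A `|` B) a x <= (\esum_(x in A) a x) + \esum_(x in B) a x.
Proof.
move=> a0; rewrite (esumID A) //; apply: leeD; apply: esum_subset => x [].
  by [].
by case.
Qed.

Lemma esumZ (T : choiceType) (A : set T) (a : T -> \bar R) (c : R) :
  (0 <= c)%R -> (forall x, 0 <= a x) ->
  \esum_(x in A) (c%:E * a x) = c%:E * \esum_(x in A) a x.
Proof.
move=> c0 a0; rewrite /esum -ereal_supZl //; last first.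
  by apply/set0P; exists (\sum_(x \in set0) a x); exists set0 => //; exact: fsets_set0.
congr ereal_sup; apply/seteqP; split => [_ [X AX <-]|_ [_ [X AX <-] <-]] /=.
  by exists (\sum_(x \in X) a x); rewrite ?ge0_mule_fsumr //; exists X.
by exists X => //; rewrite ge0_mule_fsumr.
Qed.

Lemma esumM (T T' : choiceType) (A : set T) (B : set T') (a : T -> R) (b : T' -> R) :
  (forall x, 0 <= a x)%R -> (forall y, 0 <= b y)%R -> \esum_(y in B) (b y)%:E < +oo ->
  \esum_(z in A `*` B) (a z.1 * b z.2)%:E =
  (\esum_(x in A) (a x)%:E) * \esum_(y in B) (b y)%:E.
Proof.
move=> a0 b0 Bfin.
have B0 : 0 <= \esum_(y in B) (b y)%:E by apply: esum_ge0 => *; rewrite lee_fin.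
have /fineK Bfine : \esum_(y in B) (b y)%:E \is a fin_num by rewrite ge0_fin_numE.
have ab0 (x : T) (y : T') : A x -> B y -> 0 <= (a x * b y)%:E.
  by move=> _ _; rewrite lee_fin mulr_ge0.
rewrite -(esum_esum (J := fun=> B) ab0).
rewrite (eq_esum (b := fun x => (fine (\esum_(y in B) (b y)%:E))%:E * (a x)%:E)); last first.
  by move=> x _; rewrite Bfine muleC -esumZ //.
rewrite esumZ ?fine_ge0 //.
by rewrite Bfine muleC.
Qed.

Lemma esum_fset_le (T : choiceType) (A : set T) (a : T -> R) (C : R) :
  (forall X : {fset T}, [set` X] `<=` A -> \sum_(x <- X) a x <= C)%R ->
  \esum_(x in A) (a x)%:E <= C%:E.
Proof.
move=> H; apply: ge_ereal_sup => _ [X [finX XA] <-].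
rewrite fsbig_finite // sumEFin lee_fin; apply: H => x /=.
by rewrite in_fset_set // inE => /XA.
Qed.

Lemma esum_fset_ge (T : choiceType) (A : set T) (a : T -> R) (X : {fset T}) :
  [set` X] `<=` A -> (\sum_(x <- X) a x)%:E <= \esum_(x in A) (a x)%:E.
Proof.
move=> XA; apply: esum_ge; exists [set` X]; first by split.
by rewrite fsbig_finite // set_fsetK sumEFin.
Qed.

Lemma esum_seq_ge (T : choiceType) (A : set T) (a : T -> R) (s : seq T) :
  uniq s -> (forall x, x \in s -> A x) ->
  (\sum_(x <- s) a x)%:E <= \esum_(x in A) (a x)%:E.
Proof.
move=> us sA; rewrite -(@perm_big _ _ _ _ [fset x in s]%fset) //=.
  by apply: esum_fset_ge => x /=; rewrite inE => /sA.
by apply: uniq_perm => // x; rewrite inE.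
Qed.

(** Finite sets have bounded word length, so bounds may be proved by induction on the length before
    convergence is known. *)
Lemma esum_size_le (A : set (seq nat)) (a : seq nat -> \bar R) (C : \bar R) :
  (forall N, \esum_(s in [set s | A s /\ (size s <= N)%N]) a s <= C) ->
  \esum_(s in A) a s <= C.
Proof.
move=> H; apply: ge_ereal_sup => _ [X [finX XA] <-].
apply: (le_trans _ (H (\max_(s <- fset_set X) size s)%N)); apply: esum_ge.
exists X => //; split=> // s Xs; split; first exact: XA.
have sX : s \in fset_set X by rewrite in_fset_set // inE.
exact: (@leq_bigmax_seq _ (enum_fset (fset_set X)) xpredT size s sX isT).
Qed.

Lemma esum_geometric_lty (x : R) : (0 <= x < 1)%R ->
  \esum_(n in [set: nat]) (x ^+ n)%:E < +oo.
Proof.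
move=> /andP[x0 x1]; apply: (@le_lt_trans _ _ ((1 - x)^-1)%:E); last by rewrite ltry.
have xn0 n : 0 <= (x ^+ n)%:E by rewrite lee_fin exprn_ge0.
rewrite -nneseries_esumT //; apply: lime_le; first exact: is_cvg_nneseries.
apply: nearW => n; rewrite sumEFin lee_fin.
rewrite -[leRHS]mul1r ler_pdivlMr ?subr_gt0 //.
have -> : ((\sum_(0 <= i < n) x ^+ i) * (1 - x) = 1 - x ^+ n)%R.
  elim: n => [|n IH]; first by rewrite big_nil mul0r expr0 subrr.
  by rewrite big_nat_recr //= mulrDl IH exprSr; ring.
by rewrite gerBl exprn_ge0.
Qed.

End EsumTools.

Section Weights.
Variable R : realType.
Implicit Types (om : nat -> R) (A B C : set (seq nat)).

Definition wt om (s : seq nat) : R := \prod_(a <- s) om a.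

Lemma wt_cat om s t : wt om (s ++ t) = wt om s * wt om t.
Proof. exact: big_cat. Qed.

Lemma wt_nil om : wt om [::] = 1.
Proof. exact: big_nil. Qed.

Lemma wt_seq1 om a : wt om [:: a] = om a.
Proof. exact: big_seq1. Qed.

Lemma wt_ge0 om s : (forall a, 0 <= om a) -> 0 <= wt om s.
Proof. by move=> om0; apply: prodr_ge0. Qed.

Lemma le_wt om om' s : (forall a, 0 <= om a <= om' a) -> wt om s <= wt om' s.
Proof. by move=> h; apply: ler_prod. Qed.

Lemma wt_expr x s : wt (fun a => x ^+ a) s = x ^+ sumn s.
Proof.
by rewrite /wt; elim: s => [|a s IH]; rewrite ?big_nil ?big_cons ?expr0 //= IH exprD.
Qed.

(** With [om a = x ^+ a] this is the generating function of [A] by sum, evaluated at [x]; extended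
    real values let finiteness be a conclusion. *)
Definition Z om A : \bar R := (\esum_(s in A) (wt om s)%:E)%E.

Local Open Scope ereal_scope.

Section Nonneg.
Variable om : nat -> R.
Hypothesis om0 : forall a, (0 <= om a)%R.

Let wt0 s : 0 <= (wt om s)%:E. Proof. by rewrite lee_fin wt_ge0. Qed.

Lemma Z_ge0 A : 0 <= Z om A.
Proof. exact: esum_ge0. Qed.

Lemma Z_subset A B : A `<=` B -> Z om A <= Z om B.
Proof. exact: esum_subset. Qed.

Lemma Z_setU A B : Z om (A `|` B) <= Z om A + Z om B.
Proof. exact: esum_setU_le. Qed.

Lemma Z_set1 s : Z om [set s] = (wt om s)%:E.
Proof. exact: esum_set1. Qed.

Lemma Z_cat_le A B C : (forall s, A s -> exists t u, [/\ s = t ++ u, B t & C u]) ->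
  Z om C < +oo -> Z om A <= Z om B * Z om C.
Proof.
move=> ABC Cfin; rewrite -esumM //; try by move=> ?; exact: wt_ge0.
have /choice[g gP] : forall s, exists tu : seq nat * seq nat,
    A s -> [/\ s = tu.1 ++ tu.2, B tu.1 & C tu.2].
  move=> s; have [As|nAs] := pselect (A s); last by exists ([::], [::]).
  by have [t [u tu]] := ABC s As; exists (t, u).
apply: (@esum_le_inj _ _ _ _ _ g).
- move=> s t; rewrite !inE => /gP[e _ _] /gP[e' _ _] gst; by rewrite e e' gst.
- by move=> s /gP[_ ? ?].
- by move=> s /gP[e _ _]; rewrite /= -wt_cat -e.
Qed.

Lemma Z_cat_ge A B C : (forall t u, B t -> C u -> A (t ++ u)) ->
  (forall t u t' u', B t -> B t' -> t ++ u = t' ++ u' -> t = t' /\ u = u') ->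
  Z om C < +oo -> Z om B * Z om C <= Z om A.
Proof.
move=> BCA inj Cfin; rewrite -esumM //; try by move=> ?; exact: wt_ge0.
apply: (@esum_le_inj _ _ _ _ _ (fun z => z.1 ++ z.2)).
- move=> [t u] [t' u']; rewrite !inE /= => -[/= Bt _] [/= Bt' _] /inj[] // -> ->; by [].
- by move=> [t u] [/= Bt Cu]; exact: BCA.
- by move=> [t u] _; rewrite wt_cat.
Qed.

(** The weight of the words of length at most N + 1 is at most 1 plus Z B times the weight for
    length at most N, and this recursion preserves the bound 1 / (1 - Z B). *)
Lemma Z_star A B : (forall s, A s -> s != [::] ->
    exists t u, [/\ s = t ++ u, B t, A u & t != [::]]) ->
  Z om B < 1 -> Z om A < +oo.
Proof.
move=> AB B1; have /fineK Bfine : Z om B \is a fin_num.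
  by rewrite ge0_fin_numE ?Z_ge0 // (lt_trans B1) ?ltry.
set b := fine (Z om B) in Bfine; rewrite -Bfine lte_fin in B1.
apply: (@le_lt_trans _ _ ((1 - b)^-1)%:E); last by rewrite ltry.
have b0 : (0 <= b)%R by rewrite fine_ge0 ?Z_ge0.
have c0 : (0 <= (1 - b)^-1)%R by rewrite invr_ge0 subr_ge0 ltW.
apply: esum_size_le; elim=> [|N IH].
  apply: (@le_trans _ _ (Z om [set [::]])).
    by apply: Z_subset => s [_]; rewrite leqn0 => /nilP.
  by rewrite Z_set1 wt_nil lee_fin invf_ge1 ?subr_gt0 // gerBl.
apply: (@le_trans _ _ (Z om [set [::]] + Z om [set s | [/\ A s, s != [::] & (size s <= N.+1)%N]])).
  apply: (le_trans _ (Z_setU _ _)); apply: Z_subset => s [As sN].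
  by case: (eqVneq s [::]) => [->|s0]; [left|right].
rewrite Z_set1 wt_nil.
have -> : ((1 - b)^-1 = 1 + b * (1 - b)^-1)%R.
  by field; rewrite subr_eq0 gt_eqF.
rewrite EFinD leeD2l // EFinM Bfine.
apply: (le_trans _ (lee_wpmul2l (Z_ge0 B) IH)).
apply: Z_cat_le; last by apply: le_lt_trans IH _; rewrite ltry.
move=> s [As s0 sN]; have [t [u [sE Bt Au t0]]] := AB _ As s0.
exists t, u; split=> //; split=> //.
by move: sN; rewrite sE size_cat; case: t t0 {sE Bt} => //= *; lia.
Qed.

End Nonneg.

Lemma le_Z om om' A : (forall a, 0 <= om a <= om' a)%R -> Z om A <= Z om' A.
Proof. by move=> h; apply: le_esum => s _; rewrite lee_fin le_wt. Qed.

End Weights.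

(** * Words avoiding the marked word *)

Lemma size_le_sumn (s : seq nat) : composition s -> (size s <= sumn s)%N.
Proof. by elim: s => //= a s IH /andP[a0 /IH]; lia. Qed.

Section SmallWindows.
Variables p K : nat.

(* the length of the longest suffix of v with parts at most K *)
Definition run (v : seq nat) : nat := foldl (fun n a => if (a <= K)%N then n.+1 else 0%N) 0%N v.

Lemma run_rcons v a : run (rcons v a) = if (a <= K)%N then (run v).+1 else 0%N.
Proof. by rewrite /run -cats1 foldl_cat. Qed.

Lemma run_suffix v : (run v <= size v)%N && all (fun a => a <= K)%N (drop (size v - run v) v).
Proof.
elim/last_ind: v => // v a /andP[rv av]; rewrite run_rcons size_rcons.
case: ifP => aK; last by rewrite subn0 drop_oversize // size_rcons.
by rewrite ltnS rv subSS drop_rcons ?leq_subr // all_rcons aK av.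
Qed.

Definition small (v : seq nat) : bool := (p <= run v)%N.

Lemma small_suffix v : small v ->
  (p <= size v)%N && all (fun a => a <= K)%N (drop (size v - p) v).
Proof.
move=> pv; have /andP[rv av] := run_suffix v; rewrite (leq_trans pv rv) /=.
have -> : (size v - p = (run v - p) + (size v - run v))%N by rewrite /small in pv; lia.
rewrite -drop_drop; apply/allP => a /mem_drop; exact: (allP av).
Qed.

(** [v] is the context already read; the places counted are those in [z] preceded by p parts at most
    [K], where a loop may be inserted. *)
Fixpoint smalls (v z : seq nat) : nat :=
  if z is a :: z' then (small (rcons v a) + smalls (rcons v a) z')%N else 0%N.

(** Each part above [K] spoils at most p + 1 places, and the beginning at most p - run v. *)
Lemma size_le_smalls v z :
  (size z <= smalls v z + p.+1 * count (fun a => K < a)%N z + (p - run v))%N.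
Proof.
elim: z v => [v|a z IH v /=]; first exact: leq0n.
have := IH (rcons v a); rewrite /small run_rcons.
by case: (leqP a K) => aK; nia.
Qed.

Lemma count_big_le z : (K.+1 * count (fun a => K < a) z <= sumn z)%N.
Proof. by elim: z => [|a z IH /=]; [rewrite muln0 | case: (ltnP K a) => aK /=; nia]. Qed.

(** The power is expanded as a product over the small places, its terms grouped by the first place
    at which [eta] is chosen. *)
Lemma smalls_expand (R : realType) (eta : R) v z :
  (1 + eta) ^+ smalls v z = 1 + eta * \sum_(0 <= q < size z | small (v ++ take q.+1 z))
    (1 + eta) ^+ smalls (v ++ take q.+1 z) (drop q.+1 z).
Proof.
elim: z v => [|a z IH] v /=; first by rewrite expr0 big_geq // mulr0 addr0.
rewrite big_mkcond big_nat_recl //= take0 drop0 cats1 -big_mkcond /= exprD IH.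
under [in RHS]eq_bigl do rewrite -cat_rcons.
under [in RHS]eq_bigr do rewrite -cat_rcons.
by case: (small _); rewrite ?expr1 ?expr0; ring.
Qed.

End SmallWindows.

(** * Words with few parts for their sum *)

Section FewParts.
Variable R : realType.
Local Open Scope ereal_scope.

Definition letters : set (seq nat) := [set s | exists2 a, (0 < a)%N & s = [:: a]].

Lemma Z_letters_le (om : nat -> R) : (forall a, 0 <= om a)%R ->
  Z om letters <= \esum_(a in [set: nat]) (om a)%:E.
Proof.
move=> om0; apply: (@esum_le_inj _ _ _ _ _ (head 0%N)) => //.
  by move=> s t; rewrite !inE => -[a _ ->] [b _ ->] /= ->.
by move=> s [a _ ->]; rewrite wt_seq1.
Qed.

Lemma composition_split s : composition s -> s != [::] ->
  exists t u, [/\ s = t ++ u, letters t, composition u & t != [::]].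
Proof.
by case: s => // a s /= /andP[a0 cs] _; exists [:: a], s; split=> //; exists a.
Qed.

Lemma Z_letters_lty (x : R) : (0 <= x < 1)%R -> Z (fun a => x ^+ a)%R letters < +oo.
Proof.
move=> x01; have /andP[x0 _] := x01.
apply: le_lt_trans (esum_geometric_lty x01); apply: Z_letters_le => a; exact: exprn_ge0.
Qed.

Lemma exists_expr_lt (t e : R) : (0 <= t < 1)%R -> (0 < e)%R -> exists n, (t ^+ n.+1 < e)%R.
Proof.
move=> /andP[t0 t1] e0; have /cvgrPdist_lt /(_ e e0)[N _ HN] : ((fun n => t ^+ n)%R @ \oo --> (0 : R)%R)%classic.
  by apply: cvg_expr; rewrite ger0_norm.
exists N; have := HN N.+1 (leqnSn N); rewrite sub0r normrN ger0_norm //.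
exact: exprn_ge0.
Qed.

(* Weigh such a word by t^(q |s| - sum s - c) >= 1: the sum becomes a geometric
   series over all words, with ratio t^q * sum_a (x/t)^a. *)
Lemma few_parts (x : R) : (0 < x < 1)%R -> exists2 q, (0 < q)%N & forall c : nat,
  Z (fun a => x ^+ a)%R [set s | composition s /\ (q * size s <= sumn s + c)%N] < +oo.
Proof.
move=> /andP[x0 x1].
have [t [xt t1]] : exists t, (x < t)%R /\ (t < 1)%R by exists ((x + 1) / 2)%R; lra.
have t0 : (0 < t)%R by lra.
pose Y := (x / t)%R; have Y0 : (0 < Y)%R by rewrite divr_gt0.
have Y1 : (Y < 1)%R by rewrite ltr_pdivrMr // mul1r.
have Yn0 n : 0 <= (Y ^+ n)%:E by rewrite lee_fin exprn_ge0 // ltW.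
have Gfin : \esum_(n in [set: nat]) (Y ^+ n)%:E < +oo.
  by apply: esum_geometric_lty; rewrite (ltW Y0).
have G0 : 0 <= \esum_(n in [set: nat]) (Y ^+ n)%:E by apply: esum_ge0.
have /fineK Gfine : \esum_(n in [set: nat]) (Y ^+ n)%:E \is a fin_num by rewrite ge0_fin_numE.
set G := fine _ in Gfine; have G0' : (0 <= G)%R by apply: fine_ge0.
have [n tn] : exists n, (t ^+ n.+1 < (G + 1)^-1)%R.
  by apply: exists_expr_lt; rewrite ?(ltW t0) // invr_gt0; lra.
exists n.+1 => // c; pose om a := (t ^+ n.+1 * Y ^+ a)%R.
have om0 a : (0 <= om a)%R by rewrite mulr_ge0 // exprn_ge0 // ltW.
have omfin : Z om composition < +oo.
  apply: (@Z_star _ om om0 _ letters); first exact: composition_split.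
  apply: (le_lt_trans (Z_letters_le om0)); rewrite /om.
  under eq_esum do rewrite EFinM.
  rewrite esumZ //; last by rewrite exprn_ge0 // ltW.
  rewrite -Gfine -EFinM lte_fin.
  have : (t ^+ n.+1 * (G + 1) < 1)%R by rewrite -ltr_pdivlMr ?mul1r //; lra.
  by have := exprn_gt0 n.+1 t0; nra.
have wtom s : wt om s = (t ^+ (n.+1 * size s) * Y ^+ sumn s)%R.
  rewrite /wt; elim: s => [|a s IH]; first by rewrite big_nil muln0 !expr0 mulr1.
  by rewrite big_cons IH /om /= mulnS !exprD; ring.
apply: (@le_lt_trans _ _ ((t ^- c)%:E * Z om composition)).
  rewrite -esumZ; last 2 first.
  - by rewrite invr_ge0 exprn_ge0 // ltW.
  - by move=> s; rewrite lee_fin wt_ge0.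
  apply: (@le_trans _ _ (\esum_(s in [set s | composition s /\ (n.+1 * size s <= sumn s + c)%N])
    ((t ^- c)%:E * (wt om s)%:E))); last by apply: esum_subset => s [].
  apply: le_esum => s [_ sc]; rewrite -EFinM lee_fin wt_expr wtom.
  have -> : (x ^+ sumn s = t ^- c * (t ^+ (sumn s + c) * Y ^+ sumn s))%R.
    rewrite exprD /Y expr_div_n; field.
    by rewrite !expf_neq0 // gt_eqF.
  apply: ler_wpM2l; first by rewrite invr_ge0 exprn_ge0 // ltW.
  apply: ler_wpM2r; first by rewrite exprn_ge0 // ltW.
  by apply: ler_wiXn2l => //; rewrite ltW.
by rewrite lte_mul_pinfty // lee_fin invr_ge0 exprn_ge0 // ltW.
Qed.

End FewParts.

(** * Inserting loops at marked small windows *)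

Section Gap.
Variables (R : realType) (m p : nat) (phi : restriction m p).
Hypotheses (hm : (0 < m)%N) (hp : (0 < p)%N).
Hypothesis phi_rec : recurrent phi.
Variables (w : seq nat) (i0 : nat).
Hypothesis pw : (p <= size w)%N.
Hypothesis w0 : w != [::].
Hypothesis bw : block phi i0 w.
Local Notation block := (block phi).
Local Notation avoid := (avoid m w i0).

Lemma avoid_suffix i z z' : avoid i (z ++ z') -> avoid (i + size z) z'.
Proof.
move=> a z1 z2 e; rewrite -addnA -size_cat.
by apply: (a _ z2); rewrite e -catA.
Qed.

(** As [s ++ y] ends in [s], the word can go on with [z] after that last copy, and m dividing |y|
    keeps the residues of [z]. *)
Lemma insert_loop i s t y z : (p <= size s)%N ->
  block i (t ++ s ++ z) -> block (i + size t) (s ++ y) -> suffix s (s ++ y) ->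
  (m %| size y)%N -> block i ((t ++ s) ++ y ++ z).
Proof.
move=> ps btsz bsy /suffix_natP[t' sy] my.
have szt' : size t' = size y by have := congr1 size sy; rewrite !size_cat; lia.
have -> : (t ++ s) ++ y ++ z = (t ++ t') ++ s ++ z.
  by rewrite -!catA; congr (_ ++ _); rewrite catA sy catA.
apply: block_splice => //.
  rewrite -catA -sy; apply: block_splice => //.
  by move: btsz; rewrite catA => /block_prefix.
apply: (block_mod _ (block_suffix btsz)).
by rewrite size_cat szt' addnA -[RHS]modnDmr (eqP my) addn0.
Qed.

(** There are only m (K + 1)^p pairs of a residue and a window, so the sums of their loops have a
    maximum; this is why bounded windows are considered. *)
Lemma loops_bounded (K : nat) : exists (loop : nat -> seq nat -> seq nat) (D : nat),
  forall i s, size s = p -> all (fun a => a <= K)%N s -> block i s ->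
  [/\ block i (s ++ loop (i %% m)%N s), suffix s (s ++ loop (i %% m)%N s),
      (m %| size (loop (i %% m)%N s))%N, ~ avoid (i + size s) (loop (i %% m)%N s) &
      (sumn (loop (i %% m)%N s) <= D)%N].
Proof.
have /choice[f fP] : forall js : nat * seq nat, exists y, block js.1 js.2 -> js.2 != [::] ->
  [/\ block js.1 (js.2 ++ y), suffix js.2 (js.2 ++ y), (m %| size y)%N & ~ avoid (js.1 + size js.2) y].
  move=> [i s] /=; have [bs|nbs] := pselect (block i s); last by exists [::].
  have [s0|s0] := eqVneq s [::]; first by exists [::].
  have [y yP] := block_loop hm phi_rec pw w0 bw bs s0; by exists y.
exists (fun i s => f (i, s)).
exists (\max_(jt : 'I_m * p.-tuple 'I_K.+1) sumn (f (val jt.1, map val jt.2)))%N.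
move=> i s sp sK bs; have s0 : s != [::] by rewrite -size_eq0 sp -lt0n.
have im : (i %% m = i %[mod m])%N by rewrite modn_mod.
have [|//|b1 b2 b3 b4] := fP ((i %% m)%N, s).
  exact: (block_mod (esym im) bs).
split => //; first exact: (block_mod im b1).
  move=> a; apply: b4; apply: (avoid_mod _ a) => /=.
  by rewrite modnDml.
have sz : size (map (fun a => inord a : 'I_K.+1) s) == p by rewrite size_map sp.
have -> : s = map val (Tuple sz).
  rewrite /= -map_comp -[LHS]map_id; apply/eq_in_map => a /(allP sK) aK /=.
  by rewrite inordK.
exact: (leq_bigmax (Ordinal (ltn_pmod i hm), Tuple sz)).
Qed.

Variables (K D : nat) (loop : nat -> seq nat -> seq nat).
Hypothesis loopP : forall i s, size s = p -> all (fun a => a <= K)%N s -> block i s ->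
  [/\ block i (s ++ loop (i %% m)%N s), suffix s (s ++ loop (i %% m)%N s),
      (m %| size (loop (i %% m)%N s))%N, ~ avoid (i + size s) (loop (i %% m)%N s) &
      (sumn (loop (i %% m)%N s) <= D)%N].

Let window (v : seq nat) := drop (size v - p) v.
Let loop_at i v := loop ((i + (size v - p)) %% m)%N (window v).

Lemma loop_atP i v z : small p K v -> block i (v ++ z) ->
  [/\ block i (v ++ loop_at i v ++ z), ~ avoid (i + size v) (loop_at i v) &
      (sumn (loop_at i v) <= D)%N].
Proof.
move=> sv bvz; have /andP[pv vK] := small_suffix sv.
have szw : size (window v) = p by rewrite size_drop; lia.
have vE : v = take (size v - p) v ++ window v by rewrite cat_take_drop.
have szt : size (take (size v - p) v) = (size v - p)%N by rewrite size_takel ?leq_subr.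
have bw' : block (i + (size v - p)) (window v).
  by have := block_prefix bvz; rewrite {1}vE => /block_suffix; rewrite szt.
have [b1 b2 b3 b4 b5] := loopP szw vK bw'; split => //.
- rewrite {1}vE; apply: insert_loop; rewrite ?szw ?szt //.
  by rewrite catA -vE.
- by move: b4; rewrite szw -addnA subnK.
Qed.

Section Marked.
Variables (x eta : R).
Hypotheses (x01 : 0 < x < 1) (eta0 : 0 <= eta) (D0 : (0 < D)%N).
Hypothesis etaD : eta * D%:R <= x ^+ D.
Local Open Scope ereal_scope.

Let x0 : (0 < x)%R. Proof. by case/andP: x01. Qed.
Let xs0 (s : seq nat) : (0 <= x ^+ sumn s)%R. Proof. by rewrite exprn_ge0 // ltW. Qed.

Let continuations i v := [set z | block i (v ++ z)].
Let avoiding i v := [set z | block i (v ++ z) /\ avoid (i + size v) z].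
Let hitting i v := [set z | block i (v ++ z) /\ ~ avoid (i + size v) z].

(* The word z1 ++ loop ++ z2 determines z1 up to the D values of first_hit - |z1|,
   hence the loop and z2. *)
Let first_hit i u := find (fun q => ~~ `[< avoid i (take q u) >]) (iota 0 (size u).+1).

Lemma first_hitP i z1 y z2 : avoid i z1 -> ~ avoid i (z1 ++ y) ->
  (size z1 < first_hit i (z1 ++ y ++ z2) <= size z1 + size y)%N.
Proof.
move=> az1 nay; set u := z1 ++ y ++ z2; set P := fun q => ~~ `[< avoid i (take q u) >].
have Pzy : P (size z1 + size y)%N.
  by apply/asboolPn; rewrite /u catA -size_cat take_size_cat.
have zyu : (size z1 + size y < (size u).+1)%N by rewrite /u !size_cat; lia.
have le_zy : (first_hit i u <= size z1 + size y)%N.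
  rewrite leqNgt; apply/negP => lt; have := before_find 0%N lt.
  by rewrite nth_iota // add0n -/(P _) Pzy.
rewrite le_zy andbT ltnNge; apply/negP => le_z.
have hitu : (first_hit i u < (size u).+1)%N by rewrite (leq_ltn_trans le_zy).
have : has P (iota 0 (size u).+1) by rewrite has_find size_iota.
move=> /(nth_find 0%N); rewrite -/(first_hit i u) nth_iota // add0n => /asboolPn; apply.
have -> : take (first_hit i u) u = take (first_hit i u) z1 by rewrite takel_cat.
by apply: (@avoid_prefix _ _ _ _ _ (drop (first_hit i u) z1)); rewrite cat_take_drop.
Qed.

(** Inserting the loop after [z1] multiplies the weight by at least x^D, and at most [D] choices of
    [z1] lead to the same word; the hypothesis eta D <= x^D pays for both. *)
Lemma hits_from_small i v :
  \esum_(z in [set z | [/\ small p K (v ++ z.1), avoid (i + size v) z.1 & block i (v ++ z.1 ++ z.2)]])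
     (eta * x ^+ sumn z.1 * x ^+ sumn z.2)%:E
  <= Z (fun a => x ^+ a)%R (hitting i v).
Proof.
pose J := (i + size v)%N; pose y (z1 : seq nat) := loop_at i (v ++ z1).
pose g (z : seq nat * seq nat) :=
  (z.1 ++ y z.1 ++ z.2, (first_hit J (z.1 ++ y z.1 ++ z.2) - (size z.1).+1)%N).
(* An index below [D], of weight 1 / D, records the offset of the first hit: it makes [g] injective
   and leaves the total weight unchanged. *)
have Sfin : \esum_(t in `I_D) (D%:R^-1 : R)%:E = 1.
  rewrite esum_fset; [|exact: finite_II|by move=> *; rewrite lee_fin].
  rewrite -fsbig_ord sumEFin sumr_const card_ord -[X in X%:E]mulr_natl mulfV //.
  by rewrite pnatr_eq0 -lt0n.
have y_props z : small p K (v ++ z.1) -> avoid J z.1 -> block i (v ++ z.1 ++ z.2) ->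
  [/\ block i (v ++ z.1 ++ y z.1 ++ z.2), ~ avoid J (z.1 ++ y z.1) & (sumn (y z.1) <= D)%N].
  move=> sz az bz; have := @loop_atP i (v ++ z.1) z.2 sz; rewrite -!catA => /(_ bz)[b1 b2 b3].
  split => // a; apply: b2; have := avoid_suffix a; by rewrite size_cat addnA.
have y_size z : block i (v ++ z.1 ++ y z.1 ++ z.2) -> (size (y z.1) <= sumn (y z.1))%N.
  move=> /block_suffix/block_suffix/block_prefix/block_composition; exact: size_le_sumn.
rewrite /Z -[leRHS]mule1 -Sfin -esumM; last 3 first.
- by move=> s; rewrite wt_expr.
- by move=> _; rewrite invr_ge0.
- by rewrite Sfin ltry.
apply: (@esum_le_inj _ _ _ _ _ g).
- move=> [z1 z2] [z1' z2']; rewrite !inE /= => -[/= s1 a1 b1] [/= s2 a2 b2] [e ef].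
  have [c1 c2 c3] := y_props (z1, z2) s1 a1 b1; have [c1' c2' c3'] := y_props (z1', z2') s2 a2 b2.
  have /andP[f1 _] := @first_hitP J z1 (y z1) z2 a1 c2.
  have /andP[f1' _] := @first_hitP J z1' (y z1') z2' a2 c2'.
  have sz : size z1 = size z1' by apply: succn_inj; rewrite -(subKn f1) ef e subKn.
  move: e => /eqP; rewrite eqseq_cat // => /andP[/eqP-> ].
  by rewrite eqseq_cat // eqxx => /eqP->.
- move=> [z1 z2] /= [s1 a1 b1]; have [/= c1 c2 c3] := y_props (z1, z2) s1 a1 b1.
  have szy := y_size (z1, z2) c1.
  split=> /=.
    split=> // a; apply: c2; apply: (@avoid_prefix _ _ _ _ _ z2); by rewrite -catA.
  have aux (F s t : nat) : (s < F <= s + t -> t <= D -> F - s.+1 < D)%N by lia.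
  exact: aux (@first_hitP J z1 (y z1) z2 a1 c2) (leq_trans szy c3).
- move=> [z1 z2] /= [s1 a1 b1]; have [/= c1 c2 c3] := y_props (z1, z2) s1 a1 b1.
  rewrite lee_fin wt_expr !sumn_cat ler_pdivlMr ?ltr0n // !exprD.
  have xz1 := xs0 z1; have xz2 := xs0 z2.
  rewrite [leRHS](_ : _ = x ^+ sumn (y z1) * (x ^+ sumn z1 * x ^+ sumn z2))%R; last by ring.
  rewrite [leLHS](_ : _ = eta * D%:R * (x ^+ sumn z1 * x ^+ sumn z2))%R; last by ring.
  apply: ler_wpM2r; first exact: mulr_ge0.
  apply: (le_trans etaD); apply: ler_wiXn2l => //; by [exact: ltW | case/andP: x01 => _ /ltW].
Qed.

(* (1 + eta)^smalls is a sum over sets of marked small positions.  Inserting a loop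
   through w at the first mark turns a word with marks into one that hits w. *)
Lemma marked_le n i v :
  \esum_(z in [set z | avoiding i v z /\ (size z <= n)%N])
     (x ^+ sumn z * (1 + eta) ^+ smalls p K v z)%:E
  <= Z (fun a => x ^+ a)%R (continuations i v).
Proof.
have eta1 k : (0 <= (1 + eta) ^+ k)%R by rewrite exprn_ge0 // addr_ge0.
elim: n i v => [|n IH] i v.
  apply: (@le_trans _ _ (\esum_(z in [set z | avoiding i v z /\ (size z <= 0)%N])
      (wt (fun a => x ^+ a)%R z)%:E)); last by apply: esum_subset => z [[]].
  apply: le_esum => z [_ z0]; rewrite lee_fin wt_expr.
  by case: z z0 => //= _; rewrite expr0 mulr1.
set Dn := [set z | _ /\ _].
pose Q z := [set q | (q < size z)%N /\ small p K (v ++ take q.+1 z)].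
pose c z q := (eta * x ^+ sumn z *
   (1 + eta) ^+ smalls p K (v ++ take q.+1 z) (drop q.+1 z))%R.
have c0 z q : 0 <= (c z q)%:E by rewrite lee_fin /c !mulr_ge0.
apply: (@le_trans _ _ (\esum_(z in Dn) ((x ^+ sumn z)%:E + \esum_(q in Q z) (c z q)%:E))).
  apply: le_esum => z _; rewrite smalls_expand mulrDr mulr1 EFinD leeD2l //.
  rewrite mulrCA mulrA mulr_sumr -big_filter.
  have uq : uniq [seq q <- index_iota 0 (size z) | small p K (v ++ take q.+1 z)].
    by rewrite filter_uniq // iota_uniq.
  apply: esum_seq_ge => // q; rewrite mem_filter mem_index_iota => /andP[sq /andP[_ qz]].
  by split.
rewrite esumD; last 2 first.
- by move=> z _; rewrite lee_fin.
- by move=> z _; exact: esum_ge0.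
(* The unmarked term is paid for by the words avoiding [w], the marked terms by the words hitting
   it. *)
have -> : Z (fun a => x ^+ a)%R (continuations i v) =
    Z (fun a => x ^+ a)%R (avoiding i v) + Z (fun a => x ^+ a)%R (hitting i v).
  rewrite /Z (esumID (avoid (i + size v))) //.
  by move=> z _; rewrite wt_expr lee_fin.
apply: leeD.
  apply: (@le_trans _ _ (\esum_(z in avoiding i v) (x ^+ sumn z)%:E)).
    by apply: esum_subset => z [].
  by apply: le_esum => z _; rewrite wt_expr.
apply: le_trans (hits_from_small i v).
rewrite esum_esum //.
pose S1 := [set z1 | small p K (v ++ z1) /\ avoid (i + size v) z1].
(* [z] is cut at its first mark; the induction hypothesis then trades the further marks in [z2] for
   arbitrary continuations of [v ++ z1]. *)
apply: (@le_trans _ _ (\esum_(z1 in S1)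
    \esum_(z2 in [set z2 | avoiding i (v ++ z1) z2 /\ (size z2 <= n)%N])
      (eta * x ^+ sumn z1 * (x ^+ sumn z2 * (1 + eta) ^+ smalls p K (v ++ z1) z2))%:E)).
  rewrite esum_esum; last by move=> *; rewrite lee_fin !mulr_ge0.
  apply: (@esum_le_inj _ _ _ _ _ (fun zq => (take zq.2.+1 zq.1, drop zq.2.+1 zq.1))).
  - move=> [z q] [z' q']; rewrite !inE /= => -[_ [/= qz _]] [_ [/= qz' _]] [e1 e2].
    have zz' : z = z' by rewrite -(cat_take_drop q.+1 z) e1 e2 cat_take_drop.
    have := congr1 size e1; rewrite zz' !size_takel //; last by rewrite -zz'.
    by move=> [->].
  - move=> [z q] /= [[[bz az] zn] [qz sq]]; split => /=.
      by split => //; move: az; rewrite -{1}(cat_take_drop q.+1 z) => /avoid_prefix.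
    split; last by rewrite size_drop; lia.
    split; first by rewrite -catA cat_take_drop.
    by rewrite size_cat addnA; apply: avoid_suffix; rewrite cat_take_drop.
  - move=> [z q] _ /=; rewrite lee_fin /c -{1}(cat_take_drop q.+1 z) sumn_cat exprD.
    by rewrite !mulrA.
apply: (@le_trans _ _ (\esum_(z1 in S1) \esum_(z2 in continuations i (v ++ z1))
      (eta * x ^+ sumn z1 * x ^+ sumn z2)%:E)).
  apply: le_esum => z1 _.
  under eq_esum do rewrite EFinM.
  under [leRHS]eq_esum do rewrite EFinM.
  rewrite !esumZ ?mulr_ge0 //; last by move=> z; rewrite lee_fin !mulr_ge0.
  apply: lee_wpmul2l; first by rewrite lee_fin mulr_ge0.
  apply: (le_trans (IH _ _)); apply: le_esum => z _; by rewrite wt_expr.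
rewrite esum_esum; last by move=> *; rewrite lee_fin !mulr_ge0.
by apply: esum_subset => -[z1 z2] /= [[s1 a1] b]; split=> //; move: b; rewrite /continuations /= -catA.
Qed.

End Marked.
End Gap.

(** A word of sum S with n > S / q + p parts, [b] of them at least 2q(p + 1), loses at most (p + 1)
    b <= S / (2q) places to these, so at least S / (2q) small places remain. *)
Lemma many_arith (q p S n b k : nat) : (S + q * p < q * n)%N ->
  (2 * q * p.+1 * b <= S)%N -> (n <= k + p.+1 * b + p)%N -> (S <= 2 * q * k)%N.
Proof.
rewrite -mulnA; move: (p.+1 * b)%N => c h1 h2 h3.
have := leq_mul (leqnn (2 * q)) h3; rewrite !mulnDr -!mulnA.
move: h1 h2; rewrite -!mulnA; move: (q * n)%N (q * c)%N (q * p)%N (q * k)%N; lia.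
Qed.

(** * The radius of the avoiding words exceeds r *)

Section GapMain.
Variables (R : realType) (m p : nat) (phi : restriction m p).
Hypotheses (hm : (0 < m)%N) (hp : (0 < p)%N).
Hypothesis phi_rec : recurrent phi.
Variables (w : seq nat) (i0 : nat).
Hypothesis pw : (p <= size w)%N.
Hypothesis w0 : w != [::].
Hypothesis bw : block phi i0 w.
Local Notation block := (block phi).
Local Notation avoid := (avoid m w i0).

Lemma gap (r : R) : 0 < r < 1 ->
  (forall x i, 0 < x < r -> (Z (fun a => x ^+ a)%R (block i) < +oo)%E) ->
  exists2 x1, r < x1 < 1 & forall i,
    (Z (fun a => x1 ^+ a)%R [set z | block i z /\ avoid i z] < +oo)%E.
Proof.
move=> /andP[r0 r1] Zfin.
have [xt [rxt xt1]] : exists x, r < x /\ x < 1 by exists ((r + 1) / 2); lra.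
have xt0 : 0 < xt by lra.
have [|q q0 few] := @few_parts R xt; first by rewrite xt0.
pose K := (2 * q * p.+1).-1.
have KE : K.+1 = (2 * q * p.+1)%N by rewrite /K prednK // !muln_gt0 q0.
have [loop [D' loopP]] := loops_bounded hm hp phi_rec pw w0 bw K.
pose D := D'.+1.
have {}loopP i s : size s = p -> all (fun a => a <= K)%N s -> block i s ->
  [/\ block i (s ++ loop (i %% m)%N s), suffix s (s ++ loop (i %% m)%N s),
      (m %| size (loop (i %% m)%N s))%N, ~ avoid (i + size s) (loop (i %% m)%N s) &
      (sumn (loop (i %% m)%N s) <= D)%N].
  by move=> a b c; have [? ? ? ? ?] := loopP i s a b c; split=> //; exact: leqW.
(* [eta] does not depend on [x]: eta D <= x^D holds for every x >= r / 2, and [x] can only be chosen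
   after [kappa]. *)
pose eta := (r / 2) ^+ D / D%:R.
have eta0 : 0 < eta by rewrite divr_gt0 ?ltr0n // exprn_gt0 // divr_gt0.
(* Defined so that (1 + eta)^k >= kappa^S for a word of sum S with k >= S / (2q) small places. *)
pose kappa := (1 + eta) `^ ((2 * q)%:R^-1).
have q2 : (2 * q)%:R != 0 :> R by rewrite pnatr_eq0; lia.
have kappaE : kappa ^+ (2 * q) = 1 + eta.
  rewrite -powR_mulrn ?powR_ge0 // -powRrM mulVf // powRr1 //; lra.
have kappa1 : 1 < kappa.
  rewrite ltNge; apply/negP => k1.
  by have := exprn_ile1 (2 * q) (powR_ge0 _ _) k1; rewrite kappaE; lra.
(* [x] lies below [r], where the blocks are summable, yet [x * kappa] lies above [r]. *)
have [x [x_r2 xr rxk]] : exists x, [/\ r / 2 < x, x < r & r < x * kappa].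
  have k0 : 0 < kappa by lra.
  have rk : r / kappa < r by rewrite ltr_pdivrMr //; nra.
  exists (Num.max (r * (3 / 4)) ((r / kappa + r) / 2)).
  split; first by rewrite lt_max; apply/orP; left; lra.
    by rewrite gt_max; apply/andP; split; lra.
  rewrite -ltr_pdivrMr // lt_max; apply/orP; right; lra.
have x01 : 0 < x < 1 by apply/andP; split; lra.
exists (Num.min xt (x * kappa)).
  by rewrite lt_min rxt rxk gt_min xt1.
move=> i; set x1 := Num.min _ _.
have x1xt : x1 <= xt by rewrite ge_min lexx.
have x1xk : x1 <= x * kappa by rewrite ge_min lexx orbT.
have x10 : 0 < x1 by rewrite lt_min xt0 /=; nra.
have x1n n : 0 <= x1 ^+ n by rewrite exprn_ge0 // ltW.
set A := [set z | _].
pose few_set := [set s | composition s /\ (q * size s <= sumn s + q * p)%N].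
pose many_set := [set z | A z /\ (sumn z <= 2 * q * smalls p K [::] z)%N].
apply: (@le_lt_trans _ _ (Z (fun a => x1 ^+ a)%R few_set + Z (fun a => x1 ^+ a)%R many_set)%E).
  apply: (le_trans _ (Z_setU x1n _ _)); apply: Z_subset => z [bz az].
  have [few_z|many_z] := leqP (q * size z) (sumn z + q * p).
    by left; split=> //; exact: block_composition bz.
  right; split=> //; have := size_le_smalls p K [::] z; have := count_big_le K z.
  rewrite KE /run /= subn0; exact: many_arith.
apply: lte_add_pinfty.
  apply: le_lt_trans (few (q * p)%N); apply: le_Z => a.
  by rewrite x1n lerXn2r // nnegrE ltW.
have Zx : (Z (fun a => x ^+ a)%R (block i) < +oo)%E.
  by apply: Zfin; have /andP[-> _] := x01.
apply: le_lt_trans Zx.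
apply: (@le_trans _ _ (\esum_(z in A) (x ^+ sumn z * (1 + eta) ^+ smalls p K [::] z)%:E)%E).
  apply: (@le_trans _ _ (\esum_(z in many_set) (x ^+ sumn z * (1 + eta) ^+ smalls p K [::] z)%:E)%E).
    apply: le_esum => z [_ sz]; rewrite lee_fin wt_expr.
    apply: (@le_trans _ _ ((x * kappa) ^+ sumn z)).
      by rewrite lerXn2r // nnegrE ltW //; nra.
    rewrite exprMn -kappaE -exprM ler_wpM2l //; first by rewrite exprn_ge0 //; lra.
    by rewrite ler_weXn2l // ltW.
  by apply: esum_subset => z [].
apply: esum_size_le => n.
have D0 : (0 < D)%N by [].
have etaD : eta * D%:R <= x ^+ D.
  rewrite /eta divfK ?pnatr_eq0 //; apply: lerXn2r; rewrite ?nnegrE; lra.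
have := marked_le hm hp pw w0 loopP x01 (ltW eta0) D0 etaD n i [::].
by rewrite /= addn0.
Qed.

End GapMain.

(** * The radius of convergence *)

Lemma cat_sumn_inj (t u t' u' : seq nat) : composition t -> composition t' ->
  sumn t = sumn t' -> t ++ u = t' ++ u' -> t = t' /\ u = u'.
Proof.
elim: t t' => [|a t IH] [|a' t'] //=.
- by move=> _ /andP[a0 _]; case: a' a0.
- by move=> /andP[a0 _] _; case: a a0.
- move=> /andP[_ ct] /andP[_ ct'] st [aa' e]; subst a'.
  by have [|-> ->] := IH t' ct ct' _ e; first exact: addnI st.
Qed.

Lemma bernoulli_le (R : realType) (d : R) n : 0 <= d <= 1 -> 1 - n%:R * d <= (1 - d) ^+ n.
Proof.
move=> /andP[d0 d1]; elim: n => [|n IH]; first by rewrite mul0r subr0 expr0.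
have : 0 <= (1 - d) by lra.
rewrite exprS -natr1; have n0 : 0 <= n%:R :> R by [].
have : 0 <= n%:R * d * d by rewrite !mulr_ge0.
by nra.
Qed.

Section Renewal.
Variables (R : realType) (m p : nat) (phi : restriction m p).
Hypothesis hm : (0 < m)%N.
Variables (w : seq nat) (i0 : nat).
Hypothesis pw : (p <= size w)%N.
Hypothesis w0 : w != [::].
Hypothesis bw : block phi i0 w.
Local Notation block := (block phi).
Local Notation avoid := (avoid m w i0).
Local Notation ret := (return_word phi w i0).
Local Notation cyc := (cycle_word phi w i0).
Local Notation avoiding i := [set z | block i z /\ avoid i z].

Section GeneralWeights.
Variable om : nat -> R.
Hypothesis om0 : forall a, 0 <= om a.
Local Open Scope ereal_scope.

Lemma Z_rcons_lty A B a : (forall s, A s -> exists2 t, s = rcons t a & B t) ->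
  Z om B < +oo -> Z om A < +oo.
Proof.
move=> AB Bfin; apply: (@le_lt_trans _ _ (Z om B * Z om [set [:: a]])).
  apply: Z_cat_le => // [s /AB[t -> Bt]|]; last by rewrite Z_set1 // ltry.
  by exists t, [:: a]; rewrite cats1.
by rewrite Z_set1 // muleC lte_mul_pinfty // lee_fin wt_ge0.
Qed.

Lemma Z_cycle_lty : (forall i, Z om (avoiding i) < +oo) -> Z om cyc < +oo.
Proof.
move=> avfin; apply: (Z_rcons_lty (a := last 0%N w) _ (avfin (i0 + size w)%N)).
by move=> y /(cycle_word_rcons hm pw w0)[y' [-> ? ?]]; exists y'.
Qed.

Lemma Z_mul_lty A B : Z om A < +oo -> Z om B < +oo -> Z om A * Z om B < +oo.
Proof.
move=> Afin Bfin; rewrite lte_mul_pinfty ?Z_ge0 //.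
by rewrite ge0_fin_numE // Z_ge0.
Qed.

Lemma Z_block_lty : (forall i, Z om (avoiding i) < +oo) -> Z om ret < +oo ->
  forall i, Z om (block i) < +oo.
Proof.
move=> avfin retfin i; pose av0 := avoiding (i0 + size w)%N.
pose RE := [set s | exists y e, [/\ s = y ++ e, ret y & av0 e]].
pose BI := [set s | exists2 t, s = rcons t (last 0%N w) & avoiding i t].
pose BRE := [set s | exists b t, [/\ s = b ++ t, BI b & RE t]].
have REfin : Z om RE < +oo.
  apply: (@le_lt_trans _ _ (Z om ret * Z om av0)); last exact: (Z_mul_lty retfin (avfin _)).
  apply: Z_cat_le => //; exact: avfin.
have BIfin : Z om BI < +oo.
  apply: (@Z_rcons_lty _ _ (last 0%N w) _ (avfin i)) => s [t -> ?]; by exists t.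
have BREfin : Z om BRE < +oo.
  apply: (@le_lt_trans _ _ (Z om BI * Z om RE)); last exact: (Z_mul_lty BIfin REfin).
  by apply: Z_cat_le => // s [b [t [-> ? ?]]]; exists b, t.
apply: (@le_lt_trans _ _ (Z om (avoiding i) + Z om BRE)); last exact: lte_add_pinfty.
apply: (le_trans _ (Z_setU om0 _ _)); apply: Z_subset => u bu.
have [au|[b [y [e [uE bb ab ry [be ae]]]]]] := block_decomposition hm pw w0 bw bu; first by left.
right; exists (rcons b (last 0%N w)), (y ++ e); split=> //.
  by exists b => //; split.
by exists y, e; split=> //; split.
Qed.

Lemma Z_return_lty : Z om cyc < 1 -> Z om ret < +oo.
Proof.
apply: Z_star => // y ry y0; have [c [y' [-> cc ry']]] := return_word_split hm pw w0 bw ry y0.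
by exists c, y'; split=> //; case: cc.
Qed.

(** Unique factorization gives T >= 1 + F T for the weights T of the returns and F of the cycles; a
    finite T then forces F < 1. *)
Lemma Z_cycle_lt1 : Z om ret < +oo -> Z om cyc < 1.
Proof.
move=> retfin.
have /fineK retE : Z om ret \is a fin_num by rewrite ge0_fin_numE ?Z_ge0.
have cycle_ret : Z om cyc <= Z om ret by apply: Z_subset => y [].
have /fineK cycE : Z om cyc \is a fin_num.
  by rewrite ge0_fin_numE ?Z_ge0 // (le_lt_trans cycle_ret).
have : 1 + Z om cyc * Z om ret <= Z om ret.
  rewrite [leRHS](_ : _ = Z om (ret `&` [set [::]]) + Z om (ret `&` ~` [set [::]])); last first.
    by apply: esumID => s _; rewrite lee_fin wt_ge0.
  rewrite (_ : ret `&` [set [::]] = [set [::]]); last first.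
    apply/seteqP; split=> s /=; first by case.
    by move=> ->; split => //; exact: return_word0.
  rewrite Z_set1 // wt_nil leeD2l //; apply: Z_cat_ge => //.
    move=> t u [t0 rt _] ru; split; first exact: return_word_cat.
    by case: t t0 {rt}.
  by move=> t u t' u' ct ct' /(cycle_word_cat_inj ct ct').
rewrite -retE -cycE; set T := fine _; set f := fine _.
rewrite -EFinM -EFinD lee_fin lte_fin => h.
have T0 : (0 <= T)%R by rewrite fine_ge0 // Z_ge0.
have f0 : (0 <= f)%R by rewrite fine_ge0 // Z_ge0.
by nra.
Qed.

Lemma Z_return_le : (0 < wt om w)%R -> Z om ret <= ((wt om w)^-1)%:E * Z om (block i0).
Proof.
move=> wtw; rewrite -esumZ; last 2 first.
- by rewrite invr_ge0 ltW.
- by move=> s; rewrite lee_fin wt_ge0.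
apply: (@esum_le_inj _ _ _ _ _ (cat w)) => [y y' _ _ /eqP|y [] //|y _].
  by rewrite eqseq_cat // eqxx => /eqP.
by rewrite -EFinM lee_fin wt_cat mulKf // gt_eqF.
Qed.

Lemma Z_return_of_block : (0 < wt om w)%R -> Z om (block i0) < +oo -> Z om ret < +oo.
Proof.
move=> wtw bfin; apply: (le_lt_trans (Z_return_le wtw)).
by rewrite lte_mul_pinfty // lee_fin invr_ge0 ltW.
Qed.

End GeneralWeights.

Section Radius.
Variables y1 y2 : seq nat.
Hypotheses (ry1 : ret y1) (ry2 : ret y2) (y12 : y1 != y2) (sy12 : sumn y1 = sumn y2).

Lemma return_composition y : ret y -> composition y.
Proof. by move=> [/block_suffix/block_composition]. Qed.

Definition finite_at (x : R) : Prop :=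
  0 < x < 1 /\ forall i, (Z (fun a => x ^+ a)%R (block i) < +oo)%E.

Let pow0 (x : R) : 0 < x < 1 -> forall a, 0 <= x ^+ a.
Proof. by move=> /andP[x0 _] a; rewrite exprn_ge0 // ltW. Qed.

Lemma finite_at_le x x' : finite_at x -> 0 < x' <= x -> finite_at x'.
Proof.
move=> [/andP[x0 x1] xfin] /andP[x'0 x'x]; have x'1 : x' < 1 by lra.
split=> [|i]; first by rewrite x'0.
apply: le_lt_trans (xfin i); apply: le_Z => a.
by rewrite exprn_ge0 ?(ltW x'0) // lerXn2r // nnegrE ltW.
Qed.

Lemma finite_at_return x : finite_at x -> (Z (fun a => x ^+ a)%R ret < +oo)%E.
Proof.
move=> [x01 xfin]; apply: (Z_return_of_block (pow0 x01)) (xfin _).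
by rewrite wt_expr exprn_gt0 //; case/andP: x01.
Qed.

(* Returns of equal sum are never proper prefixes of each other, so y1 and y2
   freely generate exponentially many returns. *)
Lemma finite_at_expr x : finite_at x -> x ^+ sumn y1 * 2 <= 1.
Proof.
move=> xfin; have x01 := xfin.1; have om0 := pow0 x01.
have /andP[x0 _] := x01; have retfin := finite_at_return xfin.
have /fineK retE : (Z (fun a => x ^+ a)%R ret \is a fin_num)%E by rewrite ge0_fin_numE ?Z_ge0.
have : (Z (fun a => x ^+ a)%R [set` [fset y1; y2]%fset] * Z (fun a => x ^+ a)%R ret <=
    Z (fun a => x ^+ a)%R ret)%E.
  have in12 t : [set` [fset y1; y2]%fset] t -> ret t /\ sumn t = sumn y1.
    by rewrite /= !inE => /orP[] /eqP->.
  apply: Z_cat_ge => // [t u /in12[rt _] ru|t u t' u' /in12[rt st] /in12[rt' st'] e].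
    exact: return_word_cat.
  by apply: cat_sumn_inj => //; rewrite ?st ?st' //; exact: return_composition.
have geret : (1 <= Z (fun a => x ^+ a)%R ret)%E.
  rewrite -[1%E](_ : Z (fun a => x ^+ a)%R [set [::]] = _)%E; last by rewrite Z_set1 // wt_nil.
  by apply: Z_subset => _ ->; exact: return_word0.
have Z2 : ((x ^+ sumn y1 * 2)%:E <= Z (fun a => x ^+ a)%R [set` [fset y1; y2]%fset])%E.
  rewrite /Z; apply: le_trans (@esum_fset_ge _ _ _ _ [fset y1; y2]%fset _) => //.
  rewrite big_fsetU1 ?inE //= big_seq_fset1 !wt_expr -sy12 lee_fin; lra.
move=> h; have {h} := le_trans (lee_wpmul2r (Z_ge0 om0 ret) Z2) h.
move: geret; rewrite -retE -EFinM !lee_fin; set T := fine _ => T1 h.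
by nra.
Qed.

Lemma exists_finite_at : exists x, finite_at x.
Proof.
have G0 : (0 <= \esum_(n in [set: nat]) ((2^-1 : R) ^+ n)%:E)%E.
  by apply: esum_ge0 => n _; rewrite lee_fin exprn_ge0 // invr_ge0.
have Gfin : (\esum_(n in [set: nat]) ((2^-1 : R) ^+ n)%:E < +oo)%E.
  apply: esum_geometric_lty; lra.
have /fineK Gfine : (\esum_(n in [set: nat]) ((2^-1 : R) ^+ n)%:E \is a fin_num)%E.
  by rewrite ge0_fin_numE.
set G := fine _ in Gfine; have G0' : 0 <= G by apply: fine_ge0.
(* As x <= 1/2, a part a >= 1 weighs x^a <= 2x 2^-a, so all one-part words together weigh at most
   2xG < 1. *)
pose x := ((2 * (G + 1))^-1 : R).
have x0 : 0 < x by rewrite invr_gt0; lra.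
have xG : x * (2 * (G + 1)) = 1 by rewrite mulVf // gt_eqF //; lra.
have x2 : x <= 2^-1 by nra.
exists x; have x01 : 0 < x < 1 by apply/andP; split; lra.
split=> // i; have om0 := pow0 x01.
apply: (@le_lt_trans _ _ (Z (fun a => x ^+ a)%R composition)).
  by apply: Z_subset => // s /block_composition.
apply: (@Z_star _ _ om0 _ letters); first exact: composition_split.
apply: (@le_lt_trans _ _ (Z (fun a => 2 * x * (2^-1) ^+ a) letters)).
  apply: le_esum => _ [a a0 ->]; rewrite lee_fin !wt_seq1.
  case: a a0 => // a _; rewrite !exprS.
  have xa : x ^+ a <= 2^-1 ^+ a.
    by apply: lerXn2r; rewrite ?nnegrE //; lra.
  by have := exprn_ge0 a (ltW x0); move: xa; set u := x ^+ a; set v := _ ^+ a; nra.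
apply: (le_lt_trans (Z_letters_le _)).
  by move=> a; apply: mulr_ge0; [lra | apply: exprn_ge0; lra].
under eq_esum do rewrite EFinM.
rewrite esumZ; last 2 first.
- by lra.
- by move=> a; rewrite lee_fin exprn_ge0 // invr_ge0.
by rewrite -Gfine -EFinM lte_fin; nra.
Qed.

Lemma exists_radius : exists r, [/\ 0 < r < 1, forall x, 0 < x < r -> finite_at x &
  forall x, finite_at x -> x <= r].
Proof.
have [x0 fx0] := exists_finite_at.
pose n := (sumn y1).+1.
(* By Bernoulli's inequality x > 1 - 1/(2n) gives x^n > 1/2, against [finite_at_expr]; this keeps
   the supremum below 1. *)
have ub x : finite_at x -> x <= 1 - (2 * n%:R)^-1.
  move=> fx; have := finite_at_expr fx; have [/andP[x_gt0 x1] _] := fx.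
  rewrite leNgt => h; apply/negP => h'.
  have n0 : 0 < (n%:R : R) by rewrite ltr0n.
  have d0 : 0 < (2 * n%:R)^-1 :> R by rewrite invr_gt0 mulr_gt0.
  have nd : n%:R * (2 * n%:R)^-1 = 2^-1 :> R by field; rewrite gt_eqF.
  have := @bernoulli_le R (1 - x) n; rewrite subKr => /(_ _)/wrap[|b].
    by apply/andP; split; lra.
  have xn : x ^+ n <= x ^+ sumn y1 by rewrite /n exprS ger_pMl ?exprn_gt0 // ltW.
  have : n%:R * (1 - x) < 2^-1 by rewrite -nd ltr_pM2l //; lra.
  by lra.
have hs : has_sup [set x | finite_at x].
  by split; [exists x0|exists (1 - (2 * n%:R)^-1) => x /ub].
exists (sup [set x | finite_at x]); split.
- apply/andP; split.
    have [/andP[x00 _] _] := fx0.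
    by apply: (lt_le_trans x00); exact: (sup_upper_bound hs).
  apply: (@le_lt_trans _ _ (1 - (2 * n%:R)^-1)); first by apply: ge_sup => //; exists x0.
  by rewrite gtrBl invr_gt0 mulr_gt0 // ltr0n.
- move=> x /andP[x00 xs]; have [|x' fx' xx'] := @sup_adherent _ _ (sup [set x | finite_at x] - x) _ hs.
    by rewrite subr_gt0.
  apply: (finite_at_le fx'); rewrite x00 ltW //; move: xx'; lra.
- by move=> x fx; exact: (sup_upper_bound hs).
Qed.

End Radius.
End Renewal.

(** * Large deviations *)

Section ExpBounds.
Variable R : realType.

Lemma expR_le_quadratic (t : R) : expR t <= 1 + t + t ^+ 2 * expR `|t|.
Proof.
have [t0|t0] := leP 0 t.
  rewrite ger0_norm //; have e0 := expR_gt0 t.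
  have le1 : expR t <= 1 + t * expR t.
    have := expR_ge1Dx (- t); rewrite expRN => h.
    have : (1 - t) * expR t <= (expR t)^-1 * expR t by rewrite ler_wpM2r // ltW.
    by rewrite mulVf ?gt_eqF //; lra.
  have : t * expR t <= t * (1 + t * expR t) by rewrite ler_wpM2l.
  by rewrite expr2; lra.
rewrite ltr0_norm //; have e0 := expR_gt0 t.
have e1 : 1 <= expR (- t) by have := expR_ge1Dx (- t); lra.
have h : (1 - t) * expR t <= 1.
  have := expR_ge1Dx (- t); rewrite expRN => h.
  have : (1 - t) * expR t <= (expR t)^-1 * expR t by rewrite ler_wpM2r // ltW.
  by rewrite mulVf ?gt_eqF.
have h2 : (1 + t + t ^+ 2) * (1 - t) >= 1 by rewrite expr2; nra.
have : expR t <= 1 + t + t ^+ 2.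
  rewrite -(ler_pM2r (_ : 0 < 1 - t)); last by lra.
  by rewrite [expR t * _]mulrC; lra.
have : t ^+ 2 <= t ^+ 2 * expR (- t) by rewrite ler_peMr // sqr_ge0.
by lra.
Qed.

Lemma le_expR (t : R) : t <= expR t.
Proof. by have := expR_ge1Dx t; lra. Qed.

End ExpBounds.

Section LargeDeviations.
Variables (R : realType) (m p : nat) (phi : restriction m p).
Hypothesis hm : (0 < m)%N.
Variables (w : seq nat) (i0 : nat).
Hypothesis pw : (p <= size w)%N.
Hypothesis w0 : w != [::].
Hypothesis bw : block phi i0 w.
Local Notation block := (block phi).
Local Notation avoid := (avoid m w i0).
Local Notation ret := (return_word phi w i0).
Local Notation cyc := (cycle_word phi w i0).
Local Notation avoiding i := [set z | block i z /\ avoid i z].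

Variables r x1 : R.
Hypothesis r01 : 0 < r < 1.
Hypothesis r_below : forall x, 0 < x < r -> finite_at phi x.
Hypothesis rx1 : r < x1 < 1.
Hypothesis av_x1 : forall i, (Z (fun a => x1 ^+ a)%R (avoiding i) < +oo)%E.

Let r0 : 0 < r. Proof. by case/andP: r01. Qed.
Let rn0 n : 0 <= r ^+ n. Proof. by rewrite exprn_ge0 // ltW. Qed.
Let x10 : 0 < x1. Proof. by case/andP: rx1 => /(lt_trans r0). Qed.
Let x1n0 n : 0 <= x1 ^+ n. Proof. by rewrite exprn_ge0 // ltW. Qed.

(** [Z_cycle_lt1] is available strictly below [r]. A finite set of cycles of weight S > 1 at [r]
    would still weigh at least 1 at r (1 - d) for small d. *)
Lemma Z_cycle_le1 : (Z (fun a => r ^+ a)%R cyc <= 1)%E.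
Proof.
apply: esum_fset_le => X Xcyc; under eq_bigr do rewrite wt_expr.
rewrite leNgt; apply/negP => lt1.
set S := \sum_(y <- X) _ in lt1.
pose N := (\max_(y <- X) sumn y)%N.
have S0 : 0 < S by rewrite (lt_trans _ lt1).
have Si : S^-1 < 1 by rewrite invf_lt1.
have Si0 : 0 < S^-1 by rewrite invr_gt0.
have N0 : 0 < N.+1%:R :> R by rewrite ltr0n.
have N1 : 1 <= N.+1%:R :> R by rewrite ler1n.
(* [N] bounds the sums, so the weight shrinks by a factor of at least (1 - d)^(N + 1) >= 1 - (N + 1)
   d = (1 + 1/S) / 2. *)
have [d [d0 dN]] : exists d, 0 < d /\ N.+1%:R * d = (1 - S^-1) / 2.
  exists ((1 - S^-1) / (2 * N.+1%:R)); split; last by field; rewrite !gt_eqF.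
  by rewrite divr_gt0 ?mulr_gt0 //; lra.
have d1 : d < 1.
  by have : 1 * d <= N.+1%:R * d; [rewrite ler_wpM2r // ltW | lra].
have rd : 0 < r * (1 - d) < r by rewrite mulr_gt0 ?gtr_pMr //; lra.
have := @Z_cycle_lt1 R m p phi hm w i0 pw w0 bw (fun a => (r * (1 - d)) ^+ a).
move=> /(_ _ _)/wrap[||].
- by move=> a; rewrite exprn_ge0 //; case/andP: rd => /ltW.
- by apply: finite_at_return => //; exact: r_below.
apply/negP; rewrite -leNgt; apply: (le_trans _ (esum_fset_ge _ Xcyc)); rewrite lee_fin.
apply: (@le_trans _ _ (S * (1 - d) ^+ N.+1)).
  have : 1 - N.+1%:R * d <= (1 - d) ^+ N.+1 by apply: bernoulli_le; lra.
  have SS : S * S^-1 = 1 by rewrite mulfV // gt_eqF.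
  rewrite dN => h; have : S * (1 - (1 - S^-1) / 2) <= S * (1 - d) ^+ N.+1 by rewrite ler_wpM2l // ltW.
  by lra.
rewrite /S mulr_suml !big_seq; apply: ler_sum => y yX; rewrite wt_expr exprMn.
apply: ler_wpM2l => //; apply: ler_wiXn2l; [lra|lra|].
by apply: leqW; exact: (@leq_bigmax_seq _ (enum_fset X) xpredT sumn y yX isT).
Qed.

Definition part_sum (f : nat -> R) (s : seq nat) : R := \sum_(a <- s) f a.

(** Chernoff weight: for theta > 0, a composition of n whose [f]-sum exceeds its [g]-sum by d n
    weighs r^n exp(theta d n). *)
Definition tilt (theta : R) (f g : nat -> R) (a : nat) : R :=
  r ^+ a * expR (theta * (f a - g a)).

(** The mean of [f] over a cycle, left unnormalized since only ratios and comparisons of such means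
    occur. *)
Definition cycle_sum (f : nat -> R) : \bar R :=
  (\esum_(y in cyc) (r ^+ sumn y * part_sum f y)%:E)%E.

Lemma wt_tilt theta f g s : wt (tilt theta f g) s =
  r ^+ sumn s * expR (theta * (part_sum f s - part_sum g s)).
Proof.
rewrite /wt /part_sum; elim: s => [|a s IH].
  by rewrite !big_nil subrr mulr0 expR0 mulr1 expr0.
rewrite !big_cons IH /tilt /= exprD.
have -> : theta * (f a + \sum_(j <- s) f j - (g a + \sum_(j <- s) g j)) =
  theta * (f a - g a) + theta * (\sum_(j <- s) f j - \sum_(j <- s) g j) by ring.
by rewrite expRD; ring.
Qed.

Lemma part_sum_bounds f C s : (forall a, 0 <= f a <= C * a%:R) ->
  0 <= part_sum f s <= C * (sumn s)%:R.
Proof.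
move=> fC; rewrite /part_sum; elim: s => [|a s IH]; first by rewrite big_nil mulr0 lexx.
by rewrite big_cons /= natrD; have := fC a; lra.
Qed.

(** Thus x1 = r exp(3 delta): in [tilt_pointwise] two of the three factors absorb a square and the
    third an exponential. *)
Let delta := ln (x1 / r) / 3.
Let delta0 : 0 < delta.
Proof. by rewrite divr_gt0 // ln_gt0 // ltr_pdivlMr // mul1r; case/andP: rx1. Qed.

Let x1E n : x1 ^+ n = r ^+ n * expR (3 * (delta * n%:R)).
Proof.
have -> : 3 * (delta * n%:R) = n%:R * ln (x1 / r) by rewrite /delta; field.
rewrite expRM_natl lnK ?posrE ?divr_gt0 // -exprMn mulrC divfK // gt_eqF //.
Qed.

Lemma cycle_sum_lty f C : (forall a, 0 <= f a <= C * a%:R) -> (cycle_sum f < +oo)%E.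
Proof.
move=> fC; have C0 : 0 <= C by have /andP[a b] := fC 1%N; lra.
apply: (@le_lt_trans _ _ ((C / delta)%:E * Z (fun a => x1 ^+ a)%R cyc)%E).
  rewrite -esumZ; last 2 first.
  - by rewrite divr_ge0 // ltW.
  - by move=> s; rewrite lee_fin wt_ge0.
  apply: le_esum => y _; rewrite -EFinM lee_fin wt_expr x1E mulrCA; apply: ler_wpM2l => //.
  have /andP[_ h] := part_sum_bounds y fC; apply: (le_trans h).
  rewrite -mulrA ler_wpM2l // ler_pdivlMl //.
  apply: (le_trans (le_expR _)); rewrite ler_expR.
  have : 0 <= delta * (sumn y)%:R by rewrite mulr_ge0 // ltW.
  lra.
rewrite lte_mul_pinfty //; first by rewrite lee_fin divr_ge0 // ltW.
exact: (Z_cycle_lty hm pw w0 x1n0 av_x1).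
Qed.

Lemma cycle_sum_ge0 f C : (forall a, 0 <= f a <= C * a%:R) -> (0 <= cycle_sum f)%E.
Proof.
move=> fC; apply: esum_ge0 => y _; rewrite lee_fin mulr_ge0 //.
by have /andP[] := part_sum_bounds y fC.
Qed.

(** Second-order expansion of the tilt, with the remainder absorbed by the weight at [x1]. The [g]
    term stands on the left so that only nonnegative terms are summed. *)
Lemma tilt_pointwise theta f g C (s : seq nat) :
  (forall a, 0 <= f a <= C * a%:R) -> (forall a, 0 <= g a <= C * a%:R) ->
  0 < C -> 0 < theta -> theta * C <= delta ->
  r ^+ sumn s * expR (theta * (part_sum f s - part_sum g s))
    + theta * (r ^+ sumn s * part_sum g s) <=
  r ^+ sumn s + theta * (r ^+ sumn s * part_sum f s)
    + (theta * C / delta) ^+ 2 * x1 ^+ sumn s.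
Proof.
move=> fC gC C0 theta0 thetaC; set n := sumn s; set A := part_sum f s; set B := part_sum g s.
have /andP[A0 An] : 0 <= A <= C * n%:R := part_sum_bounds s fC.
have /andP[B0 Bn] : 0 <= B <= C * n%:R := part_sum_bounds s gC.
set T := theta * (A - B); set N := delta * n%:R.
have N0 : 0 <= N by rewrite mulr_ge0 // ltW.
have n0 : 0 <= n%:R :> R by [].
have AB : `|A - B| <= C * n%:R by rewrite ler_norml; lra.
have TnC : `|T| <= theta * C * n%:R.
  by rewrite normrM (gtr0_norm theta0) -mulrA ler_wpM2l // ltW.
have TN : `|T| <= N by apply: (le_trans TnC); rewrite ler_wpM2r.
have T2 : T ^+ 2 <= (theta * C / delta) ^+ 2 * N ^+ 2.
  have -> : (theta * C / delta) ^+ 2 * N ^+ 2 = (theta * C * n%:R) ^+ 2.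
    by rewrite -exprMn /N mulrA divfK // gt_eqF.
  rewrite -real_normK ?num_real //; apply: lerXn2r; rewrite ?nnegrE //.
  by apply: le_trans TnC.
have N2 : N ^+ 2 <= expR (2 * N).
  have -> : 2 * N = N + N by ring.
  rewrite expRD expr2; apply: ler_pM => //; exact: le_expR.
have eT : expR `|T| <= expR N by rewrite ler_expR.
have := expR_le_quadratic T; set k := (theta * C / delta) ^+ 2 => eT'.
have k0 : 0 <= k by exact: sqr_ge0.
have h : T ^+ 2 * expR `|T| <= k * expR (3 * N).
  have -> : 3 * N = 2 * N + N by ring.
  rewrite expRD mulrA; apply: ler_pM => //; rewrite ?sqr_ge0 ?expR_ge0 //.
  by apply: (le_trans T2); rewrite ler_wpM2l.
rewrite x1E -/N.
have := rn0 n; set rn := r ^+ n => rn0'.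
have : rn * expR T <= rn * (1 + T + k * expR (3 * N)) by rewrite ler_wpM2l //; lra.
by rewrite /T; lra.
Qed.

(** Summed over cycles, the tilt gives at most 1 + theta (F - G) + theta^2 Q, which is below 1 for
    small theta; the returns, and with them all blocks, are then summable. *)
Lemma large_deviations f g C :
  (forall a, 0 <= f a <= C * a%:R) -> (forall a, 0 <= g a <= C * a%:R) ->
  0 < C -> (cycle_sum f < cycle_sum g)%E ->
  exists theta, [/\ 0 < theta, forall a, tilt theta f g a <= x1 ^+ a &
    forall i, (Z (tilt theta f g) (block i) < +oo)%E].
Proof.
move=> fC gC C0 fg.
have cyc_x1 := Z_cycle_lty hm pw w0 x1n0 av_x1.
have /fineK x1E' : (Z (fun a => x1 ^+ a)%R cyc \is a fin_num)%E by rewrite ge0_fin_numE ?Z_ge0.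
have /fineK fE : (cycle_sum f \is a fin_num)%E.
  by rewrite ge0_fin_numE ?(cycle_sum_lty fC) // (cycle_sum_ge0 fC).
have /fineK gE : (cycle_sum g \is a fin_num)%E.
  by rewrite ge0_fin_numE ?(cycle_sum_lty gC) // (cycle_sum_ge0 gC).
set F := fine (cycle_sum f) in fE; set G := fine (cycle_sum g) in gE.
set Q0 := fine (Z _ _) in x1E'.
have FG : F < G by move: fg; rewrite -fE -gE lte_fin.
have Q00 : 0 <= Q0 by rewrite fine_ge0 // Z_ge0.
have [Q QE Qge0] : exists2 Q, Q = (C / delta) ^+ 2 * Q0 & 0 <= Q.
  by exists ((C / delta) ^+ 2 * Q0); rewrite // mulr_ge0 // sqr_ge0.
have GF : 0 < G - F by lra.
have Q1 : 0 < Q + 1 by lra.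
(* The first bound on theta keeps the tilt below x1^a, the second makes theta Q < G - F. *)
have [theta [theta0 thetaC thetaQ]] : exists theta,
    [/\ 0 < theta, theta * C <= delta & theta * (Q + 1) <= G - F].
  exists (Num.min (delta / C) ((G - F) / (Q + 1))); split.
  - by rewrite lt_min; apply/andP; split; exact: divr_gt0.
  - by rewrite -ler_pdivlMr // ge_min lexx.
  - by rewrite -ler_pdivlMr // ge_min lexx orbT.
have om0 a : 0 <= tilt theta f g a by rewrite /tilt mulr_ge0 // expR_ge0.
have om_x1 a : tilt theta f g a <= x1 ^+ a.
  rewrite x1E; apply: ler_wpM2l => //; rewrite ler_expR.
  have a0 : 0 <= a%:R :> R by [].
  have /andP[f0 fa] := fC a; have /andP[g0 ga] := gC a.
  have h1 : theta * (f a - g a) <= theta * (C * a%:R) by rewrite ler_wpM2l ?(ltW theta0) //; lra.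
  have h2 : theta * (C * a%:R) <= delta * a%:R by rewrite mulrA ler_wpM2r.
  have h3 : 0 <= delta * a%:R by rewrite mulr_ge0 // ltW.
  by apply: (le_trans h1); apply: (le_trans h2); rewrite ler_peMl //; lra.
exists theta; split => //.
have av i : (Z (tilt theta f g) (avoiding i) < +oo)%E.
  by apply: le_lt_trans (av_x1 i); apply: le_Z => a; rewrite om0 om_x1.
apply: (Z_block_lty hm pw w0 bw om0 av); apply: (Z_return_lty hm pw w0 bw om0).
have key : (Z (tilt theta f g) cyc + theta%:E * cycle_sum g <=
   Z (fun a => r ^+ a)%R cyc + theta%:E * cycle_sum f
     + ((theta * C / delta) ^+ 2)%:E * Z (fun a => x1 ^+ a)%R cyc)%E.
  have t0 := ltW theta0; have k0 : 0 <= (theta * C / delta) ^+ 2 by exact: sqr_ge0.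
  have A0 h (s : seq nat) : (forall a, 0 <= h a <= C * a%:R) -> 0 <= part_sum h s.
    by move=> hC; have /andP[] := part_sum_bounds s hC.
  have rf s : (0 <= (r ^+ sumn s * part_sum f s)%:E)%E by rewrite lee_fin mulr_ge0 // A0.
  have rg s : (0 <= (r ^+ sumn s * part_sum g s)%:E)%E by rewrite lee_fin mulr_ge0 // A0.
  have rw s : (0 <= (wt (fun a => r ^+ a)%R s)%:E)%E by rewrite lee_fin wt_ge0.
  have xw s : (0 <= (wt (fun a => x1 ^+ a)%R s)%:E)%E by rewrite lee_fin wt_ge0.
  have tw s : (0 <= (wt (tilt theta f g) s)%:E)%E by rewrite lee_fin wt_ge0.
  rewrite -!esumZ // -!esumD //; try by move=> s _; rewrite ?adde_ge0 // mule_ge0 // lee_fin.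
  apply: le_esum => s _; rewrite -!EFinM -!EFinD lee_fin wt_tilt !wt_expr.
  exact: tilt_pointwise.
have tfin : (Z (tilt theta f g) cyc < +oo)%E by exact: (Z_cycle_lty hm pw w0 om0 av).
have /fineK tE : (Z (tilt theta f g) cyc \is a fin_num)%E by rewrite ge0_fin_numE ?Z_ge0.
have rfin : (Z (fun a => r ^+ a)%R cyc < +oo)%E by apply: (le_lt_trans Z_cycle_le1); rewrite ltry.
have /fineK rE : (Z (fun a => r ^+ a)%R cyc \is a fin_num)%E by rewrite ge0_fin_numE ?Z_ge0.
have := Z_cycle_le1; move: key; rewrite -tE -rE -gE -fE -x1E' -!EFinM -!EFinD !lee_fin lte_fin.
have -> : (theta * C / delta) ^+ 2 * Q0 = theta * (theta * Q).
  by rewrite QE !exprMn !expr2; ring.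
by nra.
Qed.

End LargeDeviations.

(** * Counting returns *)

Lemma finite_compositions n : finite_set [set c : seq nat | composition c /\ sumn c = n].
Proof.
pose free := @Restriction 1 0 (fun _ _ => true) (fun=> erefl).
apply: sub_finite_set (finite_compositions_of_n [set free] n).
by move=> c [cc cn]; split=> //; exists free.
Qed.

Section Counting.
Variables (R : realType) (m p : nat) (phi : restriction m p).
Hypothesis hm : (0 < m)%N.
Variables (w : seq nat) (i0 : nat).
Hypothesis pw : (p <= size w)%N.
Hypothesis w0 : w != [::].
Hypothesis bw : block phi i0 w.
Local Notation block := (block phi).
Local Notation avoid := (avoid m w i0).
Local Notation ret := (return_word phi w i0).

Definition returns (n : nat) : {fset seq nat} := fset_set [set y | ret y /\ sumn y = n].

Lemma returnsP n y : y \in returns n <-> ret y /\ sumn y = n.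
Proof.
rewrite in_fset_set ?inE //; apply: sub_finite_set (finite_compositions n).
by move=> s [/return_composition].
Qed.

Lemma returns_mul n k : (#|` returns n| * #|` returns k| <= #|` returns (n + k)|)%N.
Proof.
rewrite -(size_allpairs cat); apply: uniq_leq_size.
  apply: allpairs_uniq; [exact: fset_uniq|exact: fset_uniq|] => yz yz' /allpairsP[[y z] /= [/returnsP[ry sy] _ ->]].
  move=> /allpairsP[[y' z'] /= [/returnsP[ry' sy'] _ ->]] e.
  have [|||-> ->] // := cat_sumn_inj _ _ _ e.
  - exact: return_composition ry.
  - exact: return_composition ry'.
  - by rewrite sy sy'.
move=> _ /allpairsP[[y z] /= [/returnsP[ry sy] /returnsP[rz sz] ->]].
by apply/returnsP; split; [exact: return_word_cat | rewrite sumn_cat sy sz].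
Qed.

Lemma returns_expr n q k :
  (#|` returns n| ^ q * #|` returns k| <= #|` returns (q * n + k)|)%N.
Proof.
elim: q => [|q IH]; first by rewrite mul0n add0n expn0 mul1n.
rewrite expnS -mulnA mulSn -addnA; apply: leq_trans (returns_mul _ _).
by rewrite leq_mul.
Qed.

Variables r x1 : R.
Hypothesis r01 : 0 < r < 1.
Hypothesis r_above : forall x, finite_at phi x -> x <= r.
Hypothesis rx1 : r < x1 < 1.
Hypothesis av_x1 : forall i, (Z (fun a => x1 ^+ a)%R [set z | block i z /\ avoid i z] < +oo)%E.
Variable n0 : nat.
Hypothesis large_returns : forall n, (n0 <= n)%N -> exists2 y, ret y & sumn y = n.

Lemma Z_return_infty x : r < x < x1 -> ~ (Z (fun a => x ^+ a)%R ret < +oo)%E.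
Proof.
move=> /andP[rx xx1] retfin; have /andP[r0 r1] := r01; have /andP[_ x11] := rx1.
have x0 : 0 < x by lra.
have om0 a : 0 <= x ^+ a by rewrite exprn_ge0 // ltW.
have : finite_at phi x.
  split; first by rewrite x0; lra.
  apply: (Z_block_lty hm pw w0 bw om0) => // i; apply: le_lt_trans (av_x1 i).
  apply: le_Z => a; rewrite om0 /=; apply: lerXn2r; rewrite ?nnegrE; lra.
by move/r_above; lra.
Qed.

(** Otherwise at most x^-n returns have sum n, and their series converges at some x' between [r] and
    the minimum of [x] and [x1], against [Z_return_infty]. *)
Lemma exists_dense_returns x : r < x -> exists2 n, (0 < n)%N & 1 <= #|` returns n|%:R * x ^+ n.
Proof.
move=> rx; apply: contrapT => H; have /andP[r0 r1] := r01; have /andP[rx1' x11] := rx1.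
have [x' [rx' x'x x'x1]] : exists x', [/\ r < x', x' < x & x' < x1].
  exists ((r + Num.min x x1) / 2); have : Num.min x x1 <= x by rewrite ge_min lexx.
  have : Num.min x x1 <= x1 by rewrite ge_min lexx orbT.
  have : r < Num.min x x1 by rewrite lt_min rx.
  by split; lra.
have x0 : 0 < x by lra.
have few n : #|` returns n|%:R * x ^+ n <= 1.
  case: n => [|n]; last first.
    by rewrite leNgt; apply/negP => h; apply: H; exists n.+1 => //; rewrite ltW.
  rewrite expr0 mulr1 lern1; apply: leq_trans (_ : #|` [fset [::] : seq nat]%fset| <= 1)%N.
    apply: fsubset_leq_card; apply/fsubsetP => y /returnsP[/return_composition cy sy].
    by rewrite inE; case: y cy sy => //= a y /andP[a0 _]; case: a a0.
  by rewrite cardfs1.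
apply: (@Z_return_infty x'); first by rewrite rx'.
have x'n n : 0 <= x' ^+ n by rewrite exprn_ge0 //; lra.
have q01 : 0 <= x' / x < 1.
  by rewrite divr_ge0 ?ltr_pdivrMr ?mul1r //; lra.
apply: (@le_lt_trans _ _ (\esum_(n in [set: nat]) \esum_(y in [set` returns n]) (x' ^+ n)%:E)%E).
  rewrite esum_esum; last by move=> *; rewrite lee_fin.
  apply: (@esum_le_inj _ _ _ _ _ (fun y => (sumn y, y))).
  - by move=> y y' _ _ [].
  - by move=> y ry; split=> //=; apply/returnsP.
  - by move=> y _; rewrite wt_expr.
apply: le_lt_trans (esum_geometric_lty q01); apply: le_esum => n _.
apply: esum_fset_le => X Xn; rewrite big_const_seq count_predT iter_addr_0 -mulr_natl.
have -> : x' ^+ n = (x' / x) ^+ n * x ^+ n by rewrite -exprMn divfK // gt_eqF.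
have q0 : 0 <= (x' / x) ^+ n by rewrite exprn_ge0 //; case/andP: q01.
have Xcard : (size X)%:R <= #|` returns n|%:R :> R by rewrite ler_nat fsubset_leq_card //; apply/fsubsetP.
have := few n; have xn : 0 <= x ^+ n by rewrite exprn_ge0 // ltW.
move=> fn; have h : (size X)%:R * x ^+ n <= 1 by apply: le_trans fn; rewrite ler_wpM2r.
by rewrite mulrCA -[leRHS]mulr1 ler_wpM2l.
Qed.

Lemma returns_lower x : r < x -> exists2 c, 0 < c &
  forall n, (n0 <= n)%N -> c <= #|` returns n|%:R * x ^+ n.
Proof.
move=> rx; have [n1 n10 dense] := exists_dense_returns rx.
have x0 : 0 < x by case/andP: r01 => r0 _; lra.
(* Powers of [mu] bound x^k from below for all k <= n0 + n1, whether [x] is below 1 or not. *)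
pose mu := Num.min 1 x; have mu0 : 0 < mu by rewrite lt_min ltr01.
have mu1 : mu <= 1 by rewrite ge_min lexx.
have mux : mu <= x by rewrite ge_min lexx orbT.
exists (mu ^+ (n0 + n1)) => [|n n0n]; first exact: exprn_gt0.
(* n = q n1 + k with n0 <= k < n0 + n1: q returns of the dense sum [n1] are followed by one of sum
   k, which exists as k >= n0. *)
pose k := (n0 + (n - n0) %% n1)%N; pose q := ((n - n0) %/ n1)%N.
have nE : n = (q * n1 + k)%N by rewrite /q /k addnCA -divn_eq subnKC.
have [|y ry sy] := @large_returns k; first exact: leq_addr.
have ck : (0 < #|` returns k|)%N by rewrite cardfs_gt0; apply/fset0Pn; exists y; apply/returnsP.
apply: (@le_trans _ _ (x ^+ k)).
  apply: (@le_trans _ _ (mu ^+ k)).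
    apply: ler_wiXn2l => //; first exact: ltW.
    by rewrite leq_add2l ltnW // ltn_mod.
  by apply: lerXn2r => //; rewrite nnegrE ltW.
have := returns_expr n1 q k; rewrite -nE -(ler_nat R) natrM natrX => le_n.
have -> : x ^+ n = (x ^+ n1) ^+ q * x ^+ k by rewrite -exprM -exprD mulnC -nE.
have xn j : 0 <= x ^+ j by rewrite exprn_ge0 // ltW.
apply: (@le_trans _ _ ((#|` returns n1|%:R ^+ q * #|` returns k|%:R) * ((x ^+ n1) ^+ q * x ^+ k))); last first.
  by rewrite ler_wpM2r // mulr_ge0 // exprn_ge0.
rewrite mulrACA -exprMn -[leLHS]mul1r -[X in X * _ <= _]mul1r -mulrA; apply: ler_pM => //.
- by rewrite mul1r.
- exact: exprn_ege1.
- by rewrite ler_wpM2r // ler1n.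
Qed.

End Counting.

(** * Free patterns as marked words *)

Section Marker.
Variables (m p : nat) (phi : restriction m p).
Hypotheses (hm : (0 < m)%N) (hp : (0 < p)%N).
Hypothesis phi_free : asymptotically_free phi.
Local Notation block := (block phi).

Let phi_rec : recurrent phi. Proof. by case: phi_free. Qed.

Lemma exists_marker : exists (r1 r2 : p.-tuple nat) (x0 i0 M : nat),
  block i0 (r1 ++ x0 :: r2) /\ forall i u1 u2 x x', block i (u1 ++ (r1 ++ x :: r2) ++ u2) ->
    (i + size u1 = i0 %[mod m])%N -> (0 < x')%N -> (M <= x')%N ->
    block i (u1 ++ (r1 ++ x' :: r2) ++ u2).
Proof.
have [_ _ [j [r1 [r2 free]]]] := phi_free.
have [M replM] := block_replace phi_free free.
have [_ _ infS] := free.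
have [x0 /= recx0] : [set x | recurrent_at phi j (r1 ++ x :: r2)] !=set0.
  by apply/set0P/eqP => S0; apply: infS; rewrite S0.
(* [j + m.-1] stands for j - 1, in passing from positions counted from 1 to positions counted from
   0. *)
have jE : ((j + m.-1).+1 = j %[mod m])%N by rewrite -addnS prednK // modnDr.
exists r1, r2, x0, (j + m.-1)%N, M; split.
  have [_ [u [v Cuv]] _] := recx0.
  apply: (recurrent_at_block hm Cuv); last exact: recurrent_at_mod (esym jE) recx0.
  by rewrite !size_cat /= !size_tuple; lia.
move=> i u1 u2 x x' bx ij; apply: (replM _ _ _ x) => //.
by rewrite -jE -!(addn1 (_ + _)) -modnDml ij modnDml.
Qed.

End Marker.

Lemma suffix_after (w s t : seq nat) (z : nat) :
  z \notin w -> suffix w (w ++ s ++ z :: t) -> suffix w t.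
Proof.
move=> zw /suffix_natP[q e].
have [tw|wt] := leqP (size w) (size t).
  apply/suffix_natP; exists (drop (size (w ++ s ++ [:: z])) q).
  have e' : (w ++ s ++ [:: z]) ++ t = q ++ w by rewrite -!catA.
  have szq : (size (w ++ s ++ [:: z]) <= size q)%N.
    by have := congr1 size e'; rewrite !(size_cat _ t) !(size_cat q); lia.
  rewrite -[LHS](drop_size_cat _ (erefl (size (w ++ s ++ [:: z])))) e' drop_cat.
  by case: ltngtP szq => // -> _; rewrite subnn drop0 drop_size.
have : z \in w; last by rewrite (negbTE zw).
have wE : w = drop (size q) (w ++ s ++ z :: t) by rewrite e drop_size_cat.
have szq : (size q <= size (w ++ s))%N.
  by have := congr1 size e; rewrite !(size_cat _ w) !catA !(size_cat _ (z :: t)) /=; lia.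
rewrite wE catA drop_cat; case: ltngtP szq => // [_|->] _.
  by rewrite mem_cat mem_head orbT.
by rewrite subnn drop0 mem_head.
Qed.

(** * Exchanging a part inside a cycle *)

Section CycleSurgery.
Variables (m p : nat) (phi : restriction m p).
Hypotheses (hm : (0 < m)%N) (hp : (0 < p)%N).
Local Notation block := (block phi).
Variables (w : seq nat) (i0 : nat).
Hypothesis pw : (p <= size w)%N.
Hypothesis w0 : w != [::].
Hypothesis bw : block i0 w.
Local Notation ret := (return_word phi w i0).
Local Notation cyc := (cycle_word phi w i0).

Lemma return_word_split_at y a x b : ret y -> y = a ++ x :: b ->
  exists a1 a2 b1 b2, [/\ a = a1 ++ a2, b = b1 ++ b2, ret a1 & cyc (a2 ++ x :: b1)].
Proof.
have [n] := ubnP (size y); elim: n => // n IH in y a *; rewrite ltnS => yn ry yE.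
have y0 : y != [::] by rewrite yE; case: a {yE}.
have [c [y' [ycE cc ry']]] := return_word_split hm pw w0 bw ry y0.
have [c0 rc _] := cc.
have [ac|ca] := ltnP (size a) (size c).
  pose b1 := take (size c - (size a).+1) b.
  have cE : c = a ++ x :: b1.
    have := congr1 (take (size c)) yE; rewrite {1}ycE take_size_cat // => cE.
    by rewrite {1}cE take_cat ltnNge (ltnW ac) /= -(subnSK ac).
  exists [::], a, b1, y'; split=> //; last by rewrite -cE.
    by move: yE; rewrite ycE cE -catA => /eqP; rewrite eqseq_cat // eqxx => /eqP[].
  exact: return_word0 bw.
have aE : a = c ++ drop (size c) a.
  have := congr1 (take (size c)) yE; rewrite ycE take_size_cat // takel_cat // => {1}->.
  by rewrite cat_take_drop.
have y'E : y' = drop (size c) a ++ x :: b.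
  by have := congr1 (drop (size c)) yE; rewrite ycE drop_size_cat // {1}aE -catA drop_size_cat.
have [|a1 [a2 [b1 [b2 [a'E bE ra1 cb]]]]] := IH y' (drop (size c) a) _ ry' y'E.
  by move: yn; rewrite ycE size_cat; case: c c0 {cc rc ca aE y'E ycE yE} => //= *; lia.
exists (c ++ a1), a2, b1, b2; split=> //; first by rewrite -catA -a'E.
exact: (return_word_cat hm pw w0).
Qed.

(** A part outside [w] lies in no occurrence of [w], so the exchange affects neither the final
    occurrence nor minimality; only admissibility has to be assumed afresh. *)
Lemma cycle_word_replace y1 y2 k k' : k \notin w -> k' \notin w ->
  cyc (y1 ++ k :: y2) -> block i0 (w ++ y1 ++ k' :: y2) -> cyc (y1 ++ k' :: y2).
Proof.
move=> kw k'w [_ [bk sk mk] mink] bk'.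
have suffix_before (s t : seq nat) (z : nat) : suffix w t -> suffix w (s ++ z :: t).
  by move=> /suffix_natP[q ->]; apply/suffix_natP; exists (s ++ z :: q); rewrite -catA.
split; first by case: (y1).
- split=> //; last by move: mk; rewrite !size_cat.
  by rewrite catA; apply: suffix_before; exact: suffix_after sk.
move=> a b abE ra; have [ay1|y1a] := leqP (size a) (size y1).
  have y1E : y1 = a ++ drop (size a) y1.
    have := congr1 (take (size a)) abE; rewrite take_size_cat // takel_cat // => aE.
    by rewrite -{1}aE cat_take_drop.
  have [||] := mink a (drop (size a) y1 ++ k :: y2) _ ra; [|by left|].
    by rewrite catA -y1E.
  by case: (drop _ _).
right; have [b1 [aE y2E]] : exists b1, a = y1 ++ k' :: b1 /\ y2 = b1 ++ b.
  exists (drop (size y1).+1 a).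
  have : take (size a) (y1 ++ k' :: y2) = a by rewrite abE take_size_cat.
  rewrite take_cat ltnNge (ltnW y1a) /= -(subnSK y1a) /= => aE.
  have aE' : a = y1 ++ k' :: drop (size y1).+1 a.
    by rewrite -{1}aE -[in RHS]aE -cat_rcons drop_size_cat ?size_rcons // cat_rcons.
  split => //; move: abE; rewrite {1}aE' -catA => /eqP; rewrite eqseq_cat // eqxx => /eqP[].
  by [].
have [|||//] := mink (y1 ++ k :: b1) b.
- by rewrite y2E -catA.
- have [_ sa ma] := ra; split.
  + by move: bk; rewrite y2E -cat_cons !catA => /block_prefix; rewrite -!catA.
  + by rewrite catA; apply: suffix_before; apply: (@suffix_after w y1 b1 k' k'w); rewrite -aE.
  + by move: ma; rewrite aE !size_cat.
- by case: (y1).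
Qed.

End CycleSurgery.

Section FreeMarker.
Variables (m p : nat) (phi : restriction m p).
Hypotheses (hm : (0 < m)%N) (hp : (0 < p)%N).
Hypothesis phi_free : asymptotically_free phi.
Local Notation block := (block phi).
Variables (r1 r2 : p.-tuple nat) (x0 i0 M : nat).
Local Notation w := (tval r1 ++ x0 :: tval r2).
Hypothesis bw : block i0 w.
Hypothesis replace : forall i u1 u2 x x', block i (u1 ++ (r1 ++ x :: r2) ++ u2) ->
    (i + size u1 = i0 %[mod m])%N -> (0 < x')%N -> (M <= x')%N ->
    block i (u1 ++ (r1 ++ x' :: r2) ++ u2).
Local Notation ret := (return_word phi w i0).
Local Notation cyc := (cycle_word phi w i0).

Let phi_rec : recurrent phi. Proof. by case: phi_free. Qed.

Lemma marker_neq0 : w != [::].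
Proof. by rewrite -size_eq0 size_cat addnS. Qed.

Lemma marker_size : (p <= size w)%N.
Proof. by rewrite size_cat size_tuple leq_addr. Qed.

(** The return y w y w has an inner copy of [w], that is r1 x0 r2; its middle part is replaced by
    [x], while the final [w] stays. *)
Lemma free_return : exists y, forall x, (0 < x)%N -> (M <= x)%N ->
  ret ((y ++ r1) ++ x :: (r2 ++ y ++ w)).
Proof.
have [y [by1 iy]] := block_connect hm phi_rec bw bw marker_neq0.
have my : (m %| size (y ++ w))%N.
  rewrite /dvdn -(mod0n m) -(eqn_modDl i0) addn0; apply/eqP.
  by rewrite -iy size_cat; congr modn; lia.
have ry : ret (y ++ w) by split=> //; rewrite catA suffix_suffix.
have ryy := return_word_cat hm marker_size marker_neq0 ry ry.
exists y => x x_gt0 Mx; have [byy _ myy] := ryy.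
have catE t : w ++ (y ++ r1) ++ t :: (r2 ++ y ++ w) = (w ++ y) ++ (r1 ++ t :: r2) ++ (y ++ w).
  by rewrite -!catA.
split.
- rewrite catE; apply: (@replace _ _ _ x0 _ _ _ x_gt0 Mx).
    by move: byy; rewrite -!catA.
  by rewrite (size_cat w y) addnA iy.
- have -> : w ++ (y ++ r1) ++ x :: (r2 ++ y ++ w) = (w ++ (y ++ r1) ++ x :: (r2 ++ y)) ++ w.
    by rewrite -!catA /= -!catA.
  exact: suffix_suffix.
- move: myy; congr (_ %| _)%N; rewrite !size_cat /= !size_cat /= !size_tuple; lia.
Qed.

Lemma large_returns : exists n0, forall n, (n0 <= n)%N -> exists2 y, ret y & sumn y = n.
Proof.
have [y rety] := free_return.
exists (sumn (y ++ r1) + sumn (r2 ++ y ++ w) + M.+1)%N => n n0n.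
pose x := (n - (sumn (y ++ r1) + sumn (r2 ++ y ++ w)))%N.
exists ((y ++ r1) ++ x :: (r2 ++ y ++ w)); first by apply: rety; rewrite /x; lia.
by rewrite sumn_cat /= /x; lia.
Qed.

Lemma distinct_returns : exists y1 y2, [/\ ret y1, ret y2, y1 != y2 & sumn y1 = sumn y2].
Proof.
have [y rety] := free_return; pose g x := (y ++ r1) ++ x :: (r2 ++ y ++ w).
have gM : ret (g M.+1) by exact: rety.
have gM1 : ret (g M.+2) by apply: rety => //; lia.
exists (g M.+1 ++ g M.+2), (g M.+2 ++ g M.+1); split.
- exact: (return_word_cat hm marker_size marker_neq0).
- exact: (return_word_cat hm marker_size marker_neq0).
- rewrite eqseq_cat ?size_cat //= negb_and; apply/orP; left; apply/eqP => /(congr1 sumn).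
  by rewrite /g !sumn_cat /=; lia.
- by rewrite !sumn_cat addnC.
Qed.

End FreeMarker.

(** * Cycles through a large part *)

Section EventualSums.
Variable R : realType.

(** Outside a finite set [X] the weight is at most e for every [k]; on [X] membership in [P k] is
    constant for large [k]. *)
Lemma esum_eventually (T : choiceType) (D : set T) (g : T -> R) (P : nat -> set T) :
  (forall z, 0 <= g z) -> (\esum_(z in D) (g z)%:E < +oo)%E ->
  (forall z, D z -> (exists K, forall k, (K <= k)%N -> P k z) \/
                    (exists K, forall k, (K <= k)%N -> ~ P k z)) ->
  fine (\esum_(z in D `&` P k) (g z)%:E)%E @[k --> \oo] -->
  fine (\esum_(z in D `&` [set z | exists K, forall k, (K <= k)%N -> P k z]) (g z)%:E)%E.
Proof.
move=> g0 Dfin ev; set Pinf := [set z | _].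
have gE0 z : (0 <= (g z)%:E)%E by rewrite lee_fin.
have fin A : A `<=` D -> (\esum_(z in A) (g z)%:E \is a fin_num)%E.
  move=> AD; rewrite ge0_fin_numE ?esum_ge0 //.
  by apply: le_lt_trans Dfin; exact: esum_subset.
apply/cvgrPdist_le => e e0.
have [X XD Xe] : exists2 X : {fset T}, [set` X] `<=` D &
    (\esum_(z in D `\` [set` X]) (g z)%:E <= e%:E)%E.
  have DE := fineK (fin D (fun z => id)).
  have : ((fine (\esum_(z in D) (g z)%:E) - e)%:E < \esum_(z in D) (g z)%:E)%E.
    by rewrite -[ltRHS]DE lte_fin ltrBlDr ltrDl.
  move=> /ereal_sup_gt[_ [Y [finY YD] <-]] Ye.
  exists (fset_set Y); first by move=> z /=; rewrite in_fset_set // inE => /YD.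
  rewrite fset_setK // setDE.
  have YE := fineK (fin Y YD); have NE := fineK (fin (D `&` ~` Y) (@subIsetl _ _ _)).
  have := @esumID _ _ Y D (fun z => (g z)%:E) (fun z _ => gE0 z).
  rewrite (setIidr YD) -DE -YE -NE -EFinD => -[DYe]; rewrite lee_fin.
  have : (\sum_(z \in Y) (g z)%:E <= \esum_(z in Y) (g z)%:E)%E by apply: esum_ge; exists Y => //; exact: fsets_self.
  by move=> /(lt_le_trans Ye); rewrite -YE lte_fin; lra.
have [K XK] : exists K, forall z, z \in X -> forall k, (K <= k)%N -> (P k z <-> Pinf z).
  have evX : forall z, z \in X -> exists K, forall k, (K <= k)%N -> (P k z <-> Pinf z).
    move=> z /XD/ev[[K PK]|[K PK]]; exists K => k Kk; split.
    - by move=> _; exists K.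
    - by move=> _; exact: PK.
    - by move/(PK k Kk).
    - by move=> [K' PK']; case: (PK (maxn K K') (leq_maxl _ _)); apply: PK'; exact: leq_maxr.
  have : forall s : seq T, {subset s <= X} -> exists K, forall z, z \in s ->
      forall k, (K <= k)%N -> (P k z <-> Pinf z).
    elim=> [|z s IH] sX; first by exists 0%N.
    have [K1 HK1] := evX z (sX z (mem_head _ _)).
    have [|K2 HK2] := IH; first by move=> z' z's; apply: sX; rewrite inE z's orbT.
    exists (maxn K1 K2) => z'; rewrite inE => z's k; rewrite geq_max => /andP[k1 k2].
    by case/predU1P: z's => [->|z's]; [exact: HK1 | exact: HK2].
  by move=> /(_ (enum_fset X)); apply.
near=> k; have Kk : (K <= k)%N by near: k; exact: nbhs_infty_ge.
have split_X Q : (\esum_(z in D `&` Q) (g z)%:E =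
    \esum_(z in [set` X] `&` Q) (g z)%:E + \esum_(z in (D `\` [set` X]) `&` Q) (g z)%:E)%E.
  rewrite (esumID [set` X]) //; congr (_ + _)%E; congr (esum _ _).
    by rewrite -setIA setIC -setIA (setIidl XD) setIC.
  by rewrite setDE setIAC.
have XQ : [set` X] `&` P k = [set` X] `&` Pinf.
  by apply/seteqP; split=> z [zX Pz]; split=> //; apply/(XK z zX k Kk).
have tail Q : (0 <= \esum_(z in (D `\` [set` X]) `&` Q) (g z)%:E <= e%:E)%E.
  rewrite esum_ge0 //=; apply: le_trans Xe; apply: esum_subset; exact: subIsetl.
have tailD Q : (D `\` [set` X]) `&` Q `<=` D by move=> z [[]].
have XD' Q : [set` X] `&` Q `<=` D by move=> z [/XD].
rewrite !split_X XQ.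
have /andP := tail (P k); have /andP := tail Pinf.
rewrite -(fineK (fin _ (tailD (P k)))) -(fineK (fin _ (tailD Pinf))) -(fineK (fin _ (XD' Pinf))).
rewrite -!EFinD /= !lee_fin => -[a1 a2] [b1 b2]; rewrite ler_norml; lra.
Unshelve. all: by end_near.
Qed.

End EventualSums.

Lemma notin_sumn (w : seq nat) k : (sumn w < k)%N -> k \notin w.
Proof.
move=> wk; apply/negP => kw; move: wk; rewrite ltnNge => /negP; apply.
by elim: w kw => //= a s IH; rewrite inE => /predU1P[->|/IH]; lia.
Qed.

(** * Cycles with a distinguished part and their contexts *)

Section PartSums.
Variables (R : realType) (m p : nat) (phi : restriction m p).
Hypotheses (hm : (0 < m)%N) (hp : (0 < p)%N).
Hypothesis phi_free : asymptotically_free phi.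
Variables (w : seq nat) (i0 : nat).
Hypothesis pw : (p <= size w)%N.
Hypothesis w0 : w != [::].
Hypothesis bw : block phi i0 w.
Local Notation block := (block phi).
Local Notation avoid := (avoid m w i0).
Local Notation ret := (return_word phi w i0).
Local Notation cyc := (cycle_word phi w i0).
Local Notation avoiding i := [set z | block i z /\ avoid i z].

Let phi_rec : recurrent phi. Proof. by case: phi_free. Qed.

(** If [y2] is shorter than [w], a large [k] would lie inside the final [w]. Otherwise
    [block_middle] settles admissibility, and one cycle with a large part gives all of them by
    [cycle_word_replace]. *)
Lemma cycle_eventually y1 y2 :
  (exists K, forall k, (K <= k)%N -> cyc (y1 ++ k :: y2)) \/
  (exists K, forall k, (K <= k)%N -> ~ cyc (y1 ++ k :: y2)).
Proof.
have [wy2|y2w] := leqP (size w) (size y2); last first.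
  right; exists (sumn w).+1 => k /notin_sumn kw [_ [_ sk _] _].
  by have /size_suffix := suffix_after kw sk; rewrite leqNgt y2w.
have pwy1 : (p <= size (w ++ y1))%N by rewrite size_cat (leq_trans pw) // leq_addr.
have [[K bK]|[K bK]] := block_middle hm phi_rec phi_free i0 pwy1 (leq_trans pw wy2); last first.
  by right; exists K => k Kk [_ [+ _ _] _]; rewrite catA; exact: bK.
have [[k [Kk wk ck]]|H] := pselect (exists k, [/\ (K <= k)%N, (sumn w < k)%N & cyc (y1 ++ k :: y2)]).
  left; exists (maxn K (sumn w).+1) => k'; rewrite geq_max => /andP[Kk' wk'].
  apply: (cycle_word_replace _ _ ck); rewrite ?notin_sumn //.
  by rewrite catA; exact: bK.
right; exists (maxn K (sumn w).+1) => k'; rewrite geq_max => /andP[Kk' wk'] ck'.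
by apply: H; exists k'.
Qed.

Variables r x1 : R.
Hypothesis r01 : 0 < r < 1.
Hypothesis rx1 : r < x1 < 1.
Hypothesis av_x1 : forall i, (Z (fun a => x1 ^+ a)%R (avoiding i) < +oo)%E.

Let r0 : 0 < r. Proof. by case/andP: r01. Qed.
Let rn0 n : 0 <= r ^+ n. Proof. by rewrite exprn_ge0 // ltW. Qed.

Lemma Z_bigcup_ord (om : nat -> R) (A : nat -> set (seq nat)) n : (forall a, 0 <= om a) ->
  (forall i, (Z om (A i) < +oo)%E) -> (Z om [set s | exists2 i, (i < n)%N & A i s] < +oo)%E.
Proof.
move=> om0 Afin; elim: n => [|n IH].
  by rewrite /Z esum1 ?ltry // => s [].
apply: (@le_lt_trans _ _ (Z om (A n) + Z om [set s | exists2 i, (i < n)%N & A i s])%E).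
  apply: (le_trans _ (Z_setU om0 _ _)); apply: Z_subset => s [i].
  by rewrite ltnS leq_eqVlt => /predU1P[->|ltin] As; [left|right; exists i].
exact: lte_add_pinfty.
Qed.

(** [before] and [after] contain the contexts of a part in a cycle whatever that part is; [after]
    collects all residues because the starting position of the right context varies with the length
    of the left one. *)
Let before := avoiding (i0 + size w)%N.
Let after := [set s | exists2 i, (i < m)%N & exists2 t, s = rcons t (last 0%N w) & avoiding i t].
Let g (z : seq nat * seq nat) : R := r ^+ sumn z.1 * r ^+ sumn z.2.

Lemma contexts_lty : (\esum_(z in before `*` after) (g z)%:E < +oo)%E.
Proof.
have av_r i : (Z (fun a => r ^+ a)%R (avoiding i) < +oo)%E.
  apply: le_lt_trans (av_x1 i); apply: le_Z => a; rewrite rn0 /=.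
  have /andP[rx _] := rx1; have r00 := r0.
  by apply: lerXn2r; rewrite ?nnegrE; lra.
have -> : (\esum_(z in before `*` after) (g z)%:E =
    \esum_(z in before `*` after) (wt (fun a => r ^+ a)%R z.1 * wt (fun a => r ^+ a)%R z.2)%:E)%E.
  by apply: eq_esum => z _; rewrite !wt_expr.
have fin_after : (Z (fun a => r ^+ a)%R after < +oo)%E.
  apply: Z_bigcup_ord => // i; apply: (@Z_rcons_lty _ _ rn0 _ _ (last 0%N w) _ (av_r i)).
  by move=> s [t -> ?]; exists t.
rewrite esumM //; try by move=> ?; rewrite wt_ge0.
apply: Z_mul_lty => //; exact: av_r.
Qed.

Lemma cycle_contexts y1 y2 k : k \notin w -> cyc (y1 ++ k :: y2) -> (before `*` after) (y1, y2).
Proof.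
move=> kw ck; have [y' [yE by' ay']] := cycle_word_rcons hm pw w0 ck.
case/lastP: y2 yE {ck} => [|t a].
  rewrite cats1 => /rcons_inj[_ kE]; rewrite kE in kw.
  by case: (w) w0 kw => //= a s _; rewrite mem_last.
rewrite -rcons_cons -rcons_cat => /rcons_inj[y'E ->].
rewrite -y'E in by' ay' *; split => /=.
  split; first exact: block_prefix by'.
  exact: avoid_prefix ay'.
rewrite -cat_rcons in by' ay'.
have im i : (i %% m = i %[mod m])%N by rewrite modn_mod.
exists ((i0 + size w + size (rcons y1 k)) %% m)%N; first by rewrite ltn_mod.
exists t => //; split; first exact: (block_mod (esym (im _)) (block_suffix by')).
exact: (avoid_mod (esym (im _)) (avoid_suffix ay')).
Qed.

Lemma cycle_sum_part (k : nat) : k \notin w ->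
  cycle_sum phi w i0 r (fun a : nat => (a == k)%:R) =
  ((r ^+ k)%:E * \esum_(z in (before `*` after) `&` [set z | cyc (z.1 ++ k :: z.2)]) (g z)%:E)%E.
Proof.
(* Each occurrence of [k] in [y] is a mark, so the number of parts [k] becomes a sum over [Q y]. *)
move=> kw; pose Q (y : seq nat) := [set q | (q < size y)%N /\ nth 0%N y q = k].
have countE y : (part_sum (fun a : nat => (a == k)%:R) y : R) = (count_mem k y)%:R.
  by rewrite /part_sum; elim: y => [|a y IH]; rewrite ?big_nil ?big_cons //= IH natrD.
have sizeE y : count_mem k y = size [seq q <- iota 0 (size y) | nth 0%N y q == k].
  by rewrite size_filter -[in LHS](mkseq_nth 0%N y) /mkseq count_map.
have inQ y q : (q \in [seq q <- iota 0 (size y) | nth 0%N y q == k]) -> Q y q.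
  by rewrite mem_filter mem_iota => /andP[/eqP yq /andP[_ qy]]; split.
have splitQ y q : Q y q -> y = take q y ++ k :: drop q.+1 y.
  by move=> [qy <-]; rewrite -drop_nth // cat_take_drop.
have sumE y : (\esum_(q in Q y) (r ^+ sumn y)%:E = (r ^+ sumn y * part_sum (fun a : nat => (a == k)%:R) y)%:E)%E.
  apply/eqP; rewrite eq_le; apply/andP; split.
    apply: esum_fset_le => X XQ; rewrite big_const_seq count_predT iter_addr_0 -mulr_natr countE.
    rewrite ler_wpM2l // ler_nat sizeE; apply: uniq_leq_size => // q /XQ[qy yq].
    by rewrite mem_filter yq eqxx mem_iota.
  have -> : r ^+ sumn y * part_sum (fun a : nat => (a == k)%:R) y =
      \sum_(q <- [seq q <- iota 0 (size y) | nth 0%N y q == k]) r ^+ sumn y.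
    by rewrite big_const_seq count_predT iter_addr_0 -mulr_natr countE sizeE.
  by apply: esum_seq_ge; [rewrite filter_uniq // iota_uniq | exact: inQ].
have gk y1 y2 : r ^+ sumn (y1 ++ k :: y2) = r ^+ k * g (y1, y2).
  by rewrite /g sumn_cat /= !exprD; ring.
rewrite /cycle_sum; under eq_esum do rewrite -sumE.
rewrite esum_esum; last by move=> *; rewrite lee_fin.
rewrite -esumZ; [|exact: rn0|by move=> z; rewrite lee_fin mulr_ge0].
apply/eqP; rewrite eq_le; apply/andP; split.
- apply: (@esum_le_inj _ _ _ _ _ (fun yq => (take yq.2 yq.1, drop yq.2.+1 yq.1))).
  + move=> [y q] [y' q']; rewrite !inE /= => -[_ Qq] [_ Qq'] [e1 e2].
    have yy' : y = y' by rewrite (splitQ _ _ Qq) e1 e2 -splitQ.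
    have [qy _] := Qq; have [qy' _] := Qq'.
    subst y'.
    by have := congr1 size e1; rewrite (size_takel (ltnW qy)) (size_takel (ltnW qy')) => ->.
  + move=> [y q] /= [cy Qq]; have yE := splitQ _ _ Qq; rewrite yE in cy.
    by split => //; exact: cycle_contexts cy.
  + move=> [y q] /= [cy Qq]; rewrite {1}(splitQ _ _ Qq) gk EFinM.
    exact: lexx.
- apply: (@esum_le_inj _ _ _ _ _ (fun z => (z.1 ++ k :: z.2, size z.1))).
  + move=> [y1 y2] [y1' y2'] _ _ [/eqP e sz]; move: e.
    by rewrite eqseq_cat // => /andP[/eqP-> /eqP[->]].
  + move=> [y1 y2] /= [_ cy]; split=> //; split.
      by rewrite size_cat /= -addSnnS leq_addr.
    by rewrite nth_cat ltnn subnn.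
  + by move=> [y1 y2] /= _; rewrite -EFinM gk.
Qed.

End PartSums.

(** Splicing at the opening [w] installs the fixed [u], splicing at the closing [w] the fixed [v];
    with one context for all returns the embedding is injective and shifts sums by a constant. *)
Lemma return_in_composition (m p : nat) (phi : restriction m p) (w : seq nat) (i0 : nat) :
  (p <= size w)%N -> block phi i0 w ->
  exists u v, forall y, return_word phi w i0 y -> compositions_of phi (u ++ w ++ y ++ v).
Proof.
move=> pw [u [v [Cuv pu pv ui]]].
exists u, v => y [[u' [v' [Cuv' pu' pv' ui']]] /suffix_natP[t wt] my].
have ty : size t = size y by have := congr1 size wt; rewrite !size_cat; lia.
have C1 : compositions_of phi (u ++ w ++ (y ++ v')).
  apply: (compositions_of_splice (a := u) (b := v) (a' := u')) => //; first by rewrite ui ui'.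
  by move: Cuv'; rewrite -catA.
have C2 : compositions_of phi ((u ++ t) ++ w ++ v).
  apply: (compositions_of_splice (b := v') (a' := u)) => //.
    by rewrite size_cat ty -modnDmr (eqP my) addn0.
  by move: C1; rewrite (catA w y) wt -!catA.
by move: C2; rewrite -catA (catA t) -wt -!catA.
Qed.

Section Asymptotics.
Variables (R : realType) (m p : nat) (phi : restriction m p).
Hypotheses (hm : (0 < m)%N) (hp : (0 < p)%N).
Hypothesis phi_free : asymptotically_free phi.
Variables (w : seq nat) (i0 : nat).
Hypothesis pw : (p <= size w)%N.
Hypothesis w0 : w != [::].
Hypothesis bw : block phi i0 w.
Local Notation block := (block phi).
Local Notation avoid := (avoid m w i0).
Local Notation ret := (return_word phi w i0).
Local Notation cyc := (cycle_word phi w i0).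
Local Notation avoiding i := [set z | block i z /\ avoid i z].

Variables (a b : seq nat) (K : nat).
Hypothesis free_ret : forall x, (K <= x)%N -> ret (a ++ x :: b).

(** Makes the limit in [cycle_sum_asymptotics] positive: the pair of contexts is cut from the cycle
    around the free part of the returns [a ++ x :: b]. *)
Lemma cycle_all_large : exists y1 y2 K', forall k, (K' <= k)%N -> cyc (y1 ++ k :: y2).
Proof.
pose x := maxn K (sumn w).+1.
have xK : (K <= x)%N by exact: leq_maxl.
have xw : (sumn w < x)%N by exact: leq_maxr.
have [a1 [a2 [b1 [b2 [aE bE ra1 cx]]]]] :=
  return_word_split_at hm hp pw w0 bw (free_ret xK) erefl.
exists a2, b1, x => k xk.
apply: (cycle_word_replace (notin_sumn xw) (notin_sumn (leq_trans xw xk)) cx).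
have [brk _ _] := free_ret (leq_trans xK xk).
have [_ /suffix_natP[t wt] ma1] := ra1.
have ta1 : size t = size a1 by have := congr1 size wt; rewrite !size_cat; lia.
have wE : w ++ a ++ k :: b = t ++ (w ++ a2 ++ k :: b1) ++ b2.
  by rewrite aE bE -cat_cons -!catA !catA wt -!catA.
rewrite wE in brk; apply: (block_mod _ (block_factor brk)).
by rewrite ta1 -modnDmr (eqP ma1) addn0.
Qed.

Variables r x1 : R.
Hypothesis r01 : 0 < r < 1.
Hypothesis rx1 : r < x1 < 1.
Hypothesis av_x1 : forall i, (Z (fun a => x1 ^+ a)%R (avoiding i) < +oo)%E.

Lemma cycle_sum_asymptotics : exists2 B : R, 0 < B &
  (fine (cycle_sum phi w i0 r (fun a : nat => (a == k)%:R)) / r ^+ k) @[k --> \oo] --> B.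
Proof.
have /andP[r0 r1] := r01.
have cfin := contexts_lty r01 rx1 av_x1.
set D := (X in (\esum_(z in X) _)%E) in cfin; pose P k := [set z | cyc (z.1 ++ k :: z.2)].
pose g (z : seq nat * seq nat) := r ^+ sumn z.1 * r ^+ sumn z.2.
have g0 z : 0 < g z by rewrite mulr_gt0 // exprn_gt0.
have ev z : D z -> (exists K, forall k, (K <= k)%N -> P k z) \/
    (exists K, forall k, (K <= k)%N -> ~ P k z).
  by move=> _; exact: cycle_eventually.
have lim := esum_eventually (fun z => ltW (g0 z)) cfin ev.
set Pinf := [set z | exists K, _] in lim.
have [y1 [y2 [K' cycK']]] := cycle_all_large.
exists (fine (\esum_(z in D `&` Pinf) (g z)%:E)%E).
  have DPfin : (\esum_(z in D `&` Pinf) (g z)%:E \is a fin_num)%E.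
    rewrite ge0_fin_numE; last by apply: esum_ge0 => z _; rewrite lee_fin ltW.
    by apply: le_lt_trans cfin; apply: esum_subset; exact: subIsetl.
  apply: (lt_le_trans (g0 (y1, y2))); rewrite -lee_fin fineK //.
  have -> : ((g (y1, y2))%:E = \esum_(z in [set (y1, y2)]) (g z)%:E)%E.
    by rewrite esum_set1 // lee_fin ltW.
  apply: esum_subset => _ ->; split; last by exists K'.
  pose k := maxn K' (sumn w).+1; apply: (@cycle_contexts _ _ _ hm _ _ pw w0 _ _ k).
    by apply: notin_sumn; exact: leq_maxr.
  by apply: cycK'; exact: leq_maxl.
apply: cvg_trans lim; apply: near_eq_cvg; near=> k.
have wk : (sumn w < k)%N by near: k; exact: nbhs_infty_gt.
have DPkfin : (\esum_(z in D `&` P k) (g z)%:E \is a fin_num)%E.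
  rewrite ge0_fin_numE; last by apply: esum_ge0 => z _; rewrite lee_fin ltW.
  by apply: le_lt_trans cfin; apply: esum_subset; exact: subIsetl.
rewrite (cycle_sum_part phi hm i0 pw w0 r01 (notin_sumn wk)) fineM // mulrAC.
by rewrite /= mulfV ?mul1r // expf_neq0 // gt_eqF.
Unshelve. all: by end_near.
Qed.

Lemma cycle_sum_linear (f g : nat -> R) C alpha beta :
  (forall a, 0 <= f a <= C * a%:R) -> (forall a, 0 <= g a <= C * a%:R) ->
  0 <= alpha -> 0 <= beta ->
  cycle_sum phi w i0 r (fun a => alpha * f a + beta * g a) =
  (alpha%:E * cycle_sum phi w i0 r f + beta%:E * cycle_sum phi w i0 r g)%E.
Proof.
move=> fC gC alpha0 beta0; have /andP[r0 _] := r01.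
have pos h s : (forall a, 0 <= h a <= C * a%:R) -> (0 <= (r ^+ sumn s * part_sum h s)%:E)%E.
  move=> hC; rewrite lee_fin mulr_ge0 ?exprn_ge0 ?(ltW r0) //.
  by have /andP[] := part_sum_bounds s hC.
rewrite /cycle_sum -!esumZ //; try by move=> s; exact: pos.
rewrite -esumD; try by move=> s _; rewrite mule_ge0 ?lee_fin // -lee_fin; exact: pos.
apply: eq_esum => s _; rewrite -!EFinM -EFinD; congr EFin.
by rewrite /part_sum big_split /= -!mulr_sumr; ring.
Qed.

End Asymptotics.

(** * Compositions of the whole class *)

Section Union.
Variables (R : realType) (m p : nat) (Phi : set (restriction m p)).
Hypotheses (hm : (0 < m)%N) (hp : (0 < p)%N).
Hypothesis Phi_sim : forall phi phi', Phi phi -> Phi phi' -> Defs.similar phi phi'.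
Variable phi0 : restriction m p.
Hypothesis Phi0 : Phi phi0.
Variable c0 : seq nat.
Hypothesis c0P : compositions_of phi0 c0 /\ (p + p <= size c0)%N.
Variables (om : nat -> R) (x : R).
Hypotheses (om0 : forall a, 0 <= om a) (x01 : 0 < x < 1) (omx : forall a, om a <= x ^+ a).
Hypothesis block_fin : forall i, (Z om (block phi0 i) < +oo)%E.

Lemma Z_short_lty n : (Z om [set s | composition s /\ (size s <= n)%N] < +oo)%E.
Proof.
have letters_fin : (Z om letters < +oo)%E.
  apply: (@le_lt_trans _ _ (Z (fun a => x ^+ a)%R letters)); first by apply: le_Z => a; rewrite om0 omx.
  by apply: Z_letters_lty; have /andP[? ->] := x01; rewrite andbT ltW.
elim: n => [|n IH].
  apply: (@le_lt_trans _ _ (Z om [set [::]])); last by rewrite Z_set1 // ltry.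
  by apply: Z_subset => s [_]; rewrite leqn0 => /nilP.
apply: (@le_lt_trans _ _ (Z om [set [::]] +
    Z om letters * Z om [set s | composition s /\ (size s <= n)%N])%E); last first.
  by apply: lte_add_pinfty; [rewrite Z_set1 // ltry | exact: Z_mul_lty].
apply: (@le_trans _ _ (Z om [set [::]] +
    Z om [set s | [/\ composition s, (size s <= n.+1)%N & s != [::]]])%E).
  apply: (le_trans _ (Z_setU om0 _ _)); apply: Z_subset => s [cs sn].
  by have [->|s0] := eqVneq s [::]; [left|right].
rewrite leeD2l //; apply: Z_cat_le => // s [cs sn s0].
by case: s cs sn s0 => // a s /= /andP[a0 cs] sn _; exists [:: a], s; split=> //; exists a.
Qed.

(** Similarity carries recurrence of the interior word from [phi] to [phi0]; the residue is shifted
    by -k, written as (m - 1) k. *)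
Lemma interior_block phi c : Phi phi -> compositions_of phi c -> (p + p < size c)%N ->
  exists2 i, (i < m)%N & block phi0 i (take (size c - (p + p)) (drop p c)).
Proof.
move=> Pphi Cc pc; set s := take _ _.
have cE : c = take p c ++ s ++ drop (size c - (p + p)) (drop p c) by rewrite /s !cat_take_drop.
have [_ phi_rec _] := Phi_sim Phi0 Pphi.
have szs : size s = (size c - (p + p))%N by rewrite size_takel // size_drop; lia.
have s0 : s != [::] by rewrite -size_eq0 szs; lia.
have szp : size (take p c) = p by rewrite size_takel //; lia.
have bs : block phi p s.
  exists (take p c), (drop (size c - (p + p)) (drop p c)); split; rewrite -?cE ?szp //.
  by rewrite !size_drop; lia.
have recs := block_recurrent_at hm phi_rec bs s0.
have [_ _ [k simk]] := Phi_sim Phi0 Pphi.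
exists ((p + (m.-1 * k)) %% m)%N; first by rewrite ltn_mod.
have [C0 pc0] := c0P.
have im : (p + m.-1 * k = (p + m.-1 * k) %% m %[mod m])%N by rewrite modn_mod.
apply: (block_mod im); apply: (recurrent_at_block hm C0 pc0); apply/simk.
apply: (recurrent_at_mod _ recs).
have -> : ((p + m.-1 * k).+1 + k = k * m + p.+1)%N by rewrite -[in RHS](prednK hm) mulnS; lia.
by rewrite modnMDl.
Qed.

Lemma Z_union_lty : (Z om (union_compositions_of Phi) < +oo)%E.
Proof.
pose short := [set s | composition s /\ (size s <= p + p)%N].
pose mid := [set s | exists2 i, (i < m)%N & block phi0 i s].
pose tl := [set s | exists t u, [/\ s = t ++ u, mid t & short u]].
pose long := [set s | exists t u, [/\ s = t ++ u, short t & tl u]].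
have mid_fin : (Z om mid < +oo)%E by exact: Z_bigcup_ord.
have short_fin : (Z om short < +oo)%E by exact: Z_short_lty.
have tl_fin : (Z om tl < +oo)%E.
  by apply: le_lt_trans (Z_mul_lty om0 mid_fin short_fin); apply: Z_cat_le.
have long_fin : (Z om long < +oo)%E.
  by apply: le_lt_trans (Z_mul_lty om0 short_fin tl_fin); apply: Z_cat_le.
apply: (@le_lt_trans _ _ (Z om short + Z om long)%E); last exact: lte_add_pinfty.
apply: (le_trans _ (Z_setU om0 _ _)); apply: Z_subset => c [phi Pphi Cc].
have [cc _] := Cc.
have [pc|cp] := ltnP (p + p)%N (size c); last by left.
have [i im bi] := interior_block Pphi Cc pc.
right; exists (take p c), (drop p c); rewrite cat_take_drop; split => //.
  split; first by move: cc; rewrite -{1}(cat_take_drop p c) /composition all_cat => /andP[].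
  by rewrite size_takel; lia.
exists (take (size c - (p + p)) (drop p c)), (drop (size c - (p + p)) (drop p c)).
rewrite cat_take_drop; split => //; first by exists i.
split; last by rewrite !size_drop; lia.
by apply/allP => z /mem_drop/mem_drop; exact: (allP cc).
Qed.

End Union.

(** * Concentration from tilted upper bounds and a lower bound on the counts *)

Section Concentration.
Variables (R : realType) (m p : nat) (Phi : set (restriction m p)).
Local Notation N n := (#|` Comp Phi n|%:R : R).

Lemma CompP n c : c \in Comp Phi n <-> union_compositions_of Phi c /\ sumn c = n.
Proof. by rewrite in_fset_set ?inE //; exact: finite_compositions_of_n. Qed.

Lemma union_composition c : union_compositions_of Phi c -> composition c.
Proof. by move=> [phi _ []]. Qed.

Variable r : R.
Hypothesis r01 : 0 < r < 1.
Hypothesis lower : forall x, r < x ->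
  exists2 c, 0 < c & exists n0, forall n, (n0 <= n)%N -> c <= N n * x ^+ n.

Variable mean : (nat -> R) -> R.
Local Notation adm C f := (forall a, 0 <= f a <= C * a%:R).
Hypothesis mean_ge0 : forall f C, adm C f -> 0 <= mean f.
Hypothesis mean_linear : forall f g C alpha beta, adm C f -> adm C g -> 0 <= alpha -> 0 <= beta ->
  mean (fun a => alpha * f a + beta * g a) = alpha * mean f + beta * mean g.
Hypothesis mean_tilt : forall f g C, adm C f -> adm C g -> 0 < C -> mean f < mean g ->
  exists2 theta, 0 < theta & (Z (tilt r theta f g) (union_compositions_of Phi) < +oo)%E.

Let r0 : 0 < r. Proof. by case/andP: r01. Qed.

Lemma Comp_eventually : exists n0, forall n, (n0 <= n)%N -> 0 < N n.
Proof.
have [|c c0 [n0 low]] := @lower 1; first by case/andP: r01.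
by exists n0 => n /low; rewrite expr1n mulr1; exact: lt_le_trans.
Qed.

Lemma unif_prob_ge0 n P : 0 <= unif_prob R (Comp Phi n) P.
Proof. by rewrite /unif_prob divr_ge0. Qed.

Lemma unif_prob_le n (P Q : pred (seq nat)) : (forall c, c \in Comp Phi n -> P c -> Q c) ->
  unif_prob R (Comp Phi n) P <= unif_prob R (Comp Phi n) Q.
Proof.
move=> PQ; rewrite /unif_prob ler_wpM2r ?invr_ge0 // ler_nat fsubset_leq_card //.
by apply/fsubsetP => c; rewrite !inE => /andP[cn /(PQ _ cn)->]; rewrite cn.
Qed.

Lemma unif_prob_or n (P Q : pred (seq nat)) :
  unif_prob R (Comp Phi n) (fun c => P c || Q c) <=
  unif_prob R (Comp Phi n) P + unif_prob R (Comp Phi n) Q.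
Proof.
rewrite /unif_prob -mulrDl ler_wpM2r ?invr_ge0 // -natrD ler_nat.
rewrite -cardfsUI; apply: (leq_trans _ (leq_addr _ _)).
apply: fsubset_leq_card; apply/fsubsetP => c; rewrite !inE.
by case: (c \in _) (P c) (Q c) => [] [] [].
Qed.

(** Markov's inequality for the tilted weight: at most W r^-n exp(-theta delta n) compositions
    deviate. Taking [lower] at x = r exp(theta delta / 2) spends half of that exponent, and W / c
    times q^n remains. *)
Lemma rare_event (f g : nat -> R) (C delta : R) (E : nat -> pred (seq nat)) :
  adm C f -> adm C g -> 0 < C -> 0 < delta -> mean f < mean g ->
  (forall n c, c \in Comp Phi n -> E n c -> delta * n%:R <= part_sum f c - part_sum g c) ->
  unif_prob R (Comp Phi n) (E n) @[n --> \oo] --> 0.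
Proof.
move=> fC gC C0 delta0 fg Edev; have [theta theta0 Zfin] := mean_tilt fC gC C0 fg.
have om0 a : 0 <= tilt r theta f g a by rewrite mulr_ge0 ?exprn_ge0 ?expR_ge0 // ltW.
have /fineK ZE : (Z (tilt r theta f g) (union_compositions_of Phi) \is a fin_num)%E.
  by rewrite ge0_fin_numE // Z_ge0.
set W := fine _ in ZE; have W0 : 0 <= W by rewrite fine_ge0 // Z_ge0.
pose q := expR (- (theta * delta / 2)); pose x := r * expR (theta * delta / 2).
have td0 : 0 < theta * delta / 2 by rewrite divr_gt0 // mulr_gt0.
have q01 : 0 <= q < 1 by rewrite expR_ge0 expR_lt1 oppr_lt0.
have rx : r < x by rewrite ltr_pMr // expR_gt1.
have [c c0 [n0 low]] := lower rx.
apply: (@squeeze_cvgr _ _ _ _ (fun=> 0) (fun n => W / c * q ^+ n)).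
- near=> n; rewrite unif_prob_ge0 /=.
  have n0n : (n0 <= n)%N by near: n; exact: nbhs_infty_ge.
  have cN := low n n0n; have x0 : 0 < x by rewrite mulr_gt0 // expR_gt0.
  have xn0 : 0 < x ^+ n by rewrite exprn_gt0.
  have N0 : 0 < N n by rewrite -(pmulr_lgt0 _ xn0) (lt_le_trans c0 cN).
  set F := [fset s in Comp Phi n | E n s]%fset.
  have FW : #|` F|%:R * (r ^+ n * expR (theta * (delta * n%:R))) <= W.
    rewrite -lee_fin ZE; apply: le_trans (@esum_fset_ge _ _ _ _ F _); last first.
      by move=> s /=; rewrite !inE => /andP[/CompP[]].
    rewrite lee_fin -[#|` F|]count_predT mulr_natl -iter_addr_0 -big_const_seq.
    rewrite big_seq [leRHS]big_seq; apply: ler_sum => s; rewrite !inE => /andP[sn Es].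
    have [_ sumE] := (CompP n s).1 sn.
    rewrite wt_tilt sumE ler_wpM2l ?exprn_ge0 ?(ltW r0) // ler_expR ler_wpM2l ?(ltW theta0) //.
    exact: Edev.
  rewrite /unif_prob ler_pdivrMr // -/F.
  have xq : x ^+ n = r ^+ n * expR (theta * (delta * n%:R)) * q ^+ n.
    by rewrite /x /q exprMn -!expRM_natl -[RHS]mulrA -expRD; congr (_ * expR _); field.
  rewrite -(ler_pM2r (_ : 0 < r ^+ n * expR (theta * (delta * n%:R)))); last first.
    by rewrite mulr_gt0 ?exprn_gt0 ?expR_gt0.
  apply: (le_trans FW).
  have -> : W / c * q ^+ n * N n * (r ^+ n * expR (theta * (delta * n%:R))) =
    W / c * (N n * x ^+ n) by rewrite xq; ring.
  by rewrite -mulrA ler_peMr // ler_pdivlMl // mulr1.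
- exact: cvg_cst.
- rewrite -(mulr0 (W / c)); apply: cvgMr; apply: cvg_expr.
  by case/andP: q01 => q0 q1; rewrite ger0_norm.
Unshelve. all: by end_near.
Qed.

(** The condition 0 < a makes the counting functions vanish at 0, as the bound C a demands;
    compositions have no part 0. *)
Definition one_part (a : nat) : R := (0 < a)%N%:R.
Definition part_eq (k a : nat) : R := ((a == k) && (0 < a))%N%:R.
Definition part_size (a : nat) : R := a%:R.

Lemma part_sum_one c : composition c -> part_sum one_part c = (size c)%:R.
Proof.
rewrite /part_sum; elim: c => [|a c IH] /=; first by rewrite big_nil.
by move=> /andP[a0 /IH e]; rewrite big_cons e /one_part a0 -natrD.
Qed.

Lemma part_sum_eq k c : composition c -> part_sum (part_eq k) c = (count_mem k c)%:R.
Proof.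
rewrite /part_sum; elim: c => [|a c IH] /=; first by rewrite big_nil.
by move=> /andP[a0 /IH e]; rewrite big_cons e /part_eq a0 andbT -natrD.
Qed.

Lemma part_sum_size c : part_sum part_size c = (sumn c)%:R.
Proof. by rewrite /part_sum; elim: c => [|a c IH] /=; rewrite ?big_nil ?big_cons // IH natrD. Qed.

Lemma one_part_adm : adm 1 one_part.
Proof. by case=> [|a]; rewrite /one_part mul1r ?lexx //= ler01 ler1n. Qed.

Lemma part_eq_adm k : adm 1 (part_eq k).
Proof.
move=> a; rewrite /part_eq mul1r; case: a => [|a]; first by rewrite andbF lexx.
by rewrite andbT; case: (_ == k); rewrite ?lexx ?ler01 ?ler1n ?ler0n.
Qed.

Lemma part_size_adm : adm 1 part_size.
Proof. by move=> a; rewrite /part_size mul1r lexx ler0n. Qed.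

Lemma part_sum_linear (f g : nat -> R) alpha beta c :
  part_sum (fun a => alpha * f a + beta * g a) c = alpha * part_sum f c + beta * part_sum g c.
Proof. by rewrite /part_sum big_split /= -!mulr_sumr. Qed.

Lemma adm_linear (f g : nat -> R) (alpha beta C : R) : adm 1 f -> adm 1 g -> 0 <= alpha -> 0 <= beta ->
  alpha + beta <= C -> adm C (fun a => alpha * f a + beta * g a).
Proof.
move=> f1 g1 alpha0 beta0 abC a; have a0 : 0 <= a%:R :> R by [].
have /andP[f0 fa] := f1 a; have /andP[g0 ga] := g1 a; rewrite mul1r in fa ga.
rewrite addr_ge0 ?mulr_ge0 //=.
have h1 : alpha * f a <= alpha * a%:R by rewrite ler_wpM2l.
have h2 : beta * g a <= beta * a%:R by rewrite ler_wpM2l.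
have h3 : (alpha + beta) * a%:R <= C * a%:R by rewrite ler_wpM2r.
lra.
Qed.

Hypothesis mean_one : 0 < mean one_part.
Definition part_density k := mean (part_eq k) / mean one_part.

Lemma part_density_ge0 k : 0 <= part_density k.
Proof. by rewrite divr_ge0 ?(mean_ge0 (part_eq_adm k)) // ltW. Qed.

Let densityE k : part_density k * mean one_part = mean (part_eq k).
Proof. by rewrite divfK // gt_eqF. Qed.

(** Makes E(X_0) grow linearly, so that rare compositions cannot affect the ratio of means. If a
    composition of n has fewer than eta n parts, 2 eta n exceeds their number by more than eta n. *)
Lemma few_parts_rare : exists2 eta : R, 0 < eta &
  unif_prob R (Comp Phi n) (fun c => (size c)%:R < eta * n%:R :> R) @[n --> \oo] --> 0.
Proof.
have [M1 M1E M1_ge0] : exists2 M1, M1 = mean part_size & 0 <= M1.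
  by exists (mean part_size) => //; exact: mean_ge0 part_size_adm.
have [M0 M0E M0_gt0] : exists2 M0, M0 = mean one_part & 0 < M0 by exists (mean one_part).
have M11 : 0 < M1 + 1 by lra.
(* Gives 2 eta M1 < M0, the order of means that [rare_event] asks for. *)
have [eta eta0 etaM] : exists2 eta, 0 < eta & 4 * eta * (M1 + 1) = M0.
  exists (M0 / (4 * (M1 + 1))); last by field; rewrite gt_eqF.
  by rewrite divr_gt0 // mulr_gt0.
exists eta => //.
(* The summands with coefficient 0 bring both functions to the form of [mean_linear]. *)
apply: (@rare_event (fun a => (2 * eta) * part_size a + 0 * part_size a)
  (fun a => 1 * one_part a + 0 * one_part a) (2 * eta + 1) eta) => //.
- apply: adm_linear; [exact: part_size_adm|exact: part_size_adm|lra|lra|lra].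
- apply: adm_linear; [exact: one_part_adm|exact: one_part_adm|lra|lra|lra].
- lra.
- rewrite !(@mean_linear _ _ 1) ?mulr_ge0 ?(ltW eta0) //; try exact: part_size_adm; try exact: one_part_adm.
  by rewrite -M0E -M1E; nra.
- move=> n c /CompP[/union_composition cc cn] small_c.
  rewrite !part_sum_linear part_sum_one // part_sum_size cn; lra.
Qed.

Lemma density_concentration k eps : 0 < eps ->
  unif_prob R (Comp Phi n) (fun c =>
    eps * (size c)%:R < `|(count_mem k c)%:R - part_density k * (size c)%:R|)
  @[n --> \oo] --> 0.
Proof.
move=> eps0; set u := part_density k; have u0 : 0 <= u by exact: part_density_ge0.
have [M1 M1E M1_ge0] : exists2 M1, M1 = mean part_size & 0 <= M1.
  by exists (mean part_size) => //; exact: mean_ge0 part_size_adm.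
have [M0 M0E M0_gt0] : exists2 M0, M0 = mean one_part & 0 < M0 by exists (mean one_part).
have M11 : 0 < M1 + 1 by lra.
(* Adding [delta] times the part size raises the sum over any composition of n by delta n, the
   linear excess that [rare_event] requires; [delta] is small enough to keep the means in order. *)
have [delta delta0 deltaM] : exists2 delta, 0 < delta & delta * (M1 + 1) = eps * M0 / 2.
  exists (eps * M0 / (2 * (M1 + 1))); last by field; rewrite gt_eqF.
  by rewrite divr_gt0 ?mulr_gt0.
have dM1 : delta * M1 < eps * M0.
  have : 0 < eps * M0 by rewrite mulr_gt0.
  lra.
pose C := 1 + delta + u + eps + 1.
have above : unif_prob R (Comp Phi n) (fun c =>
    eps * (size c)%:R < (count_mem k c)%:R - u * (size c)%:R) @[n --> \oo] --> 0.
  apply: (@rare_event (fun a => 1 * part_eq k a + delta * part_size a)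
    (fun a => (u + eps) * one_part a + 0 * one_part a) C delta) => //.
  - apply: adm_linear; [exact: part_eq_adm|exact: part_size_adm|lra|lra|rewrite /C; lra].
  - apply: adm_linear; [exact: one_part_adm|exact: one_part_adm|lra|lra|rewrite /C; lra].
  - rewrite /C; lra.
  - rewrite (@mean_linear _ _ 1 1 delta (part_eq_adm k) part_size_adm) ?(ltW delta0) //.
    rewrite (@mean_linear _ _ 1 (u + eps) 0 one_part_adm one_part_adm) //; last by lra.
    by rewrite -densityE -M0E -M1E -/u; lra.
  - move=> n c /CompP[/union_composition cc cn] dev.
    rewrite !part_sum_linear part_sum_one // part_sum_eq // part_sum_size cn; lra.
have below : unif_prob R (Comp Phi n) (fun c =>
    eps * (size c)%:R < u * (size c)%:R - (count_mem k c)%:R) @[n --> \oo] --> 0.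
  apply: (@rare_event (fun a => u * one_part a + delta * part_size a)
    (fun a => 1 * part_eq k a + eps * one_part a) C delta) => //.
  - apply: adm_linear; [exact: one_part_adm|exact: part_size_adm|lra|lra|rewrite /C; lra].
  - apply: adm_linear; [exact: part_eq_adm|exact: one_part_adm|lra|lra|rewrite /C; lra].
  - rewrite /C; lra.
  - rewrite (@mean_linear _ _ 1 u delta one_part_adm part_size_adm) ?(ltW delta0) //.
    rewrite (@mean_linear _ _ 1 1 eps (part_eq_adm k) one_part_adm) ?(ltW eps0) //.
    by rewrite -densityE -M0E -M1E -/u; lra.
  - move=> n c /CompP[/union_composition cc cn] dev.
    rewrite !part_sum_linear part_sum_one // part_sum_eq // part_sum_size cn; lra.
have sum0 := cvgD above below; rewrite addr0 in sum0.
apply: (@squeeze_cvgr _ _ _ _ (fun=> 0) (fun n =>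
  unif_prob R (Comp Phi n) (fun c => eps * (size c)%:R < (count_mem k c)%:R - u * (size c)%:R) +
  unif_prob R (Comp Phi n) (fun c => eps * (size c)%:R < u * (size c)%:R - (count_mem k c)%:R)));
  [|exact: cvg_cst|exact: sum0].
near=> n; rewrite unif_prob_ge0 /=; apply: (le_trans _ (unif_prob_or _ _ _)).
by apply: unif_prob_le => c _; rewrite lter_normr opprB.
Unshelve. all: by end_near.
Qed.

Lemma mean_ratio_cvg k : mean_ratio R Phi k n @[n --> \oo] --> part_density k.
Proof.
set u := part_density k; have u0 : 0 <= u by exact: part_density_ge0.
have [eta eta0 few] := few_parts_rare.
apply/cvgrPdist_le => e e0; pose eps := e / 2.
have eps0 : 0 < eps by rewrite divr_gt0.
have bad := density_concentration k eps0.
have [n0 Npos] := Comp_eventually.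
(* The bad compositions deviate in total by at most beta N (1 + u) n, which equals eps times the
   lower bound eta n N / 2 for the total number of parts. *)
pose beta := eps * eta / (2 * (1 + u)).
have beta0 : 0 < beta by rewrite divr_gt0 ?mulr_gt0 //; lra.
have half0 : 0 < 2^-1 :> R by rewrite invr_gt0.
have few_half : \forall n \near \oo, unif_prob R (Comp Phi n)
    (fun c => (size c)%:R < eta * n%:R) <= 2^-1.
  have /cvgrPdist_le/(_ _ half0) := few.
  by apply: filterS => n; rewrite sub0r normrN ger0_norm // unif_prob_ge0.
have bad_beta : \forall n \near \oo, unif_prob R (Comp Phi n) (fun c =>
    eps * (size c)%:R < `|(count_mem k c)%:R - u * (size c)%:R|) <= beta.
  have /cvgrPdist_le/(_ _ beta0) := bad.
  by apply: filterS => n; rewrite sub0r normrN ger0_norm // unif_prob_ge0.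
near=> n.
have n1 : (0 < n)%N by near: n; exact: nbhs_infty_gt.
have N0 : 0 < N n by apply: Npos; near: n; exact: nbhs_infty_ge.
have few_n : unif_prob R (Comp Phi n) (fun c => (size c)%:R < eta * n%:R) <= 2^-1 by near: n.
have bad_n : unif_prob R (Comp Phi n) (fun c =>
    eps * (size c)%:R < `|(count_mem k c)%:R - u * (size c)%:R|) <= beta by near: n.
set F := Comp Phi n in N0 few_n bad_n *.
pose B := [fset c in F | eps * (size c)%:R < `|(count_mem k c)%:R - u * (size c)%:R|]%fset.
pose S := [fset c in F | (size c)%:R < eta * n%:R]%fset.
have pS : #|` S|%:R <= 2^-1 * N n by rewrite -ler_pdivrMr.
have pB : #|` B|%:R <= beta * N n by rewrite -ler_pdivrMr.
pose X (c : seq nat) : R := (count_mem k c)%:R; pose Y (c : seq nat) : R := (size c)%:R.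
have Fcomp c : c \in F -> composition c /\ sumn c = n.
  by move=> /CompP[/union_composition].
have sum_card (G : {fset seq nat}) (x : R) : {subset G <= F} ->
    \sum_(c <- F) (c \in G)%:R * x = #|` G|%:R * x.
  move=> GF; rewrite -mulr_suml -natr_sum -big_mkcond /= sum1_count; congr (_%:R * _).
  rewrite -size_filter; apply/perm_size/uniq_perm; [exact/filter_uniq/fset_uniq|exact: fset_uniq|].
  by move=> c; rewrite mem_filter; case: (boolP (c \in G)) => //= /GF.
have SF : {subset S <= F} by move=> c; rewrite !inE => /andP[].
have BF : {subset B <= F} by move=> c; rewrite !inE => /andP[].
have nR : 0 < n%:R :> R by rewrite ltr0n.
have en0 : 0 < eta * n%:R by rewrite mulr_gt0.
have sumY : eta * n%:R * (N n / 2) <= \sum_(c <- F) Y c.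
  apply: (@le_trans _ _ (\sum_(c <- F) (eta * n%:R - (c \in S)%:R * (eta * n%:R)))).
    rewrite big_split /= big_const_seq count_predT iter_addr_0 sumrN sum_card // -mulr_natl.
    have : #|` S|%:R * (eta * n%:R) <= 2^-1 * N n * (eta * n%:R) by rewrite ler_wpM2r // ltW.
    rewrite -/F; lra.
  rewrite big_seq [leRHS]big_seq; apply: ler_sum => c cF.
  rewrite /S !inE cF /=; case: ltP => h; rewrite ?mul1r ?subrr ?mul0r ?subr0 //.
have dev : `|\sum_(c <- F) X c - u * \sum_(c <- F) Y c| <=
    eps * (\sum_(c <- F) Y c) + #|` B|%:R * ((1 + u) * n%:R).
  rewrite -sum_card // !mulr_sumr -sumrB -big_split /=.
  apply: (le_trans (ler_norm_sum _ _ _)); rewrite big_seq [leRHS]big_seq; apply: ler_sum => c cF.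
  have [cc cn] := Fcomp c cF.
  have Y0 : 0 <= Y c by []. have X0 : 0 <= X c by [].
  have XY : X c <= Y c by rewrite ler_nat count_size.
  have Yn : Y c <= n%:R by rewrite ler_nat -cn size_le_sumn.
  have uY : u * Y c <= u * n%:R by rewrite ler_wpM2l.
  have uY0 : 0 <= u * Y c by rewrite mulr_ge0.
  have epsY : 0 <= eps * Y c by rewrite mulr_ge0 // ltW.
  rewrite /B !inE cF /=; case: ltP => h; rewrite ?mul1r ?mul0r ?addr0 //.
  by rewrite ler_norml; lra.
have sumY0 : 0 < \sum_(c <- F) Y c by apply: lt_le_trans sumY; rewrite !mulr_gt0.
have -> : mean_ratio R Phi k n = (\sum_(c <- F) X c) / (\sum_(c <- F) Y c).
  by rewrite /mean_ratio /unif_mean -/F invf_div mulrA divfK // gt_eqF.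
rewrite -normrN opprB.
have -> : (\sum_(c <- F) X c) / (\sum_(c <- F) Y c) - u =
    (\sum_(c <- F) X c - u * \sum_(c <- F) Y c) / (\sum_(c <- F) Y c).
  by rewrite mulrBl mulfK // gt_eqF.
rewrite normrM normfV (gtr0_norm sumY0) ler_pdivrMr //; apply: (le_trans dev).
have h1 : #|` B|%:R * ((1 + u) * n%:R) <= beta * N n * ((1 + u) * n%:R).
  by rewrite ler_wpM2r // mulr_ge0 // addr_ge0.
have h2 : beta * N n * ((1 + u) * n%:R) = eps * (eta * n%:R * (N n / 2)).
  by rewrite /beta; field; rewrite gt_eqF //; lra.
have h3 : eps * (eta * n%:R * (N n / 2)) <= eps * (\sum_(c <- F) Y c) by rewrite ler_wpM2l // ltW.
have -> : e = eps + eps by rewrite /eps; field.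
by rewrite mulrDl; lra.
Unshelve. all: by end_near.
Qed.

Lemma ratio_concentration k eps : 0 < eps ->
  unif_prob R (Comp Phi n) (fun c =>
    eps < `| nparts_eq R k c / nparts R c - mean_ratio R Phi k n |) @[n --> \oo] --> 0.
Proof.
move=> eps0; have eps2 : 0 < eps / 2 by rewrite divr_gt0.
have /cvgrPdist_le cvgu := @mean_ratio_cvg k; have close := cvgu _ eps2.
apply: (@squeeze_cvgr _ _ _ _ (fun=> 0) (fun n => unif_prob R (Comp Phi n) (fun c =>
    eps / 2 * (size c)%:R < `|(count_mem k c)%:R - part_density k * (size c)%:R|)));
  [|exact: cvg_cst|exact: density_concentration].
near=> n; rewrite unif_prob_ge0 /=; apply: unif_prob_le => c /CompP[/union_composition cc cn].
have n1 : (0 < n)%N by near: n; exact: nbhs_infty_gt.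
have close_n : `|part_density k - mean_ratio R Phi k n| <= eps / 2 by near: n.
have c0 : 0 < (size c)%:R :> R.
  by rewrite ltr0n lt0n size_eq0; apply: contraTneq n1 => c0; rewrite -cn c0.
rewrite /nparts_eq /nparts => far.
have -> : (count_mem k c)%:R - part_density k * (size c)%:R =
    ((count_mem k c)%:R / (size c)%:R - part_density k) * (size c)%:R.
  by rewrite mulrBl divfK // gt_eqF.
rewrite normrM (gtr0_norm c0) ltr_pM2r //.
have := ler_distD (part_density k) ((count_mem k c)%:R / (size c)%:R) (mean_ratio R Phi k n).
lra.
Unshelve. all: by end_near.
Qed.

End Concentration.

(** * Identification of r with the radius of the generating function *)

Section RadiusOfConvergence.
Variables (R : realType) (m p : nat) (Phi : set (restriction m p)).
Local Notation N n := (#|` Comp Phi n|%:R : R).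
Variable r : R.
Hypothesis r01 : 0 < r < 1.
Hypothesis lower : forall x, r < x ->
  exists2 c, 0 < c & exists n0, forall n, (n0 <= n)%N -> c <= N n * x ^+ n.
Hypothesis below : forall x, 0 < x < r ->
  (Z (fun a => x ^+ a)%R (union_compositions_of Phi) < +oo)%E.

Lemma partial_sum_le (x : R) n : 0 < x ->
  ((\sum_(0 <= k < n) N k * x ^+ k)%:E <=
   Z (fun a => x ^+ a)%R [set c | union_compositions_of Phi c /\ (sumn c < n)%N])%E.
Proof.
move=> x0; have om0 a : 0 <= x ^+ a by rewrite exprn_ge0 // ltW.
have wt0 s : (0 <= (wt (fun a => x ^+ a) s)%:E)%E by rewrite lee_fin wt_ge0.
elim: n => [|n IH]; first by rewrite big_geq // Z_ge0.
rewrite big_nat_recr //= EFinD /Z.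
rewrite (esumID [set c | (sumn c < n)%N]) //; apply: leeD.
  apply: (le_trans IH); apply: esum_subset => c [uc cn].
  by split=> //; split=> //; exact: ltnW.
have -> : N n * x ^+ n = \sum_(c <- Comp Phi n) wt (fun a => x ^+ a) c.
  rewrite mulr_natl -iter_addr_0 -[#|` _|]count_predT -big_const_seq.
  by rewrite !big_seq; apply: eq_bigr => c /CompP[_ cn]; rewrite wt_expr cn.
apply: esum_fset_ge => c /CompP[uc cn]; split; first by split=> //; rewrite cn.
by rewrite /= cn ltnn.
Qed.

(** Above [r] the terms are eventually bounded away from 0; below [r] the partial sums are bounded
    by the weight of the whole class. *)
Lemma radius_eq : radius_of_convergence (fun n => N n) = r%:E.
Proof.
have /andP[r0 r1] := r01.
apply/eqP; rewrite eq_le; apply/andP; split.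
  apply: ge_ereal_sup => _ [x /= xcvg <-]; rewrite lee_fin leNgt; apply/negP => rx.
  have [c c0 [n0 low]] := lower rx.
  have /cvgrPdist_lt/(_ _ c0)[n1 _ H] := cvg_series_cvg_0 xcvg.
  have := H (maxn n0 n1) (leq_maxr _ _); rewrite sub0r normrN normrM normrX ger0_norm //.
  by rewrite ltNge low // leq_maxl.
have in_sup x : 0 < x < r -> (x%:E <= radius_of_convergence (fun n => N n))%E.
  move=> /andP[x0 xr]; apply: ereal_sup_ubound => /=; exists x; last by rewrite gtr0_norm.
  have om0 a : 0 <= x ^+ a by rewrite exprn_ge0 // ltW.
  have Zfin : (Z (fun a => x ^+ a)%R (union_compositions_of Phi) < +oo)%E by apply: below; rewrite x0.
  have /fineK ZE : (Z (fun a => x ^+ a)%R (union_compositions_of Phi) \is a fin_num)%E.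
    by rewrite ge0_fin_numE ?Z_ge0.
  apply: nondecreasing_is_cvgn.
    apply/nondecreasing_seqP => n; rewrite /pseries /series /= big_nat_recr //= lerDl.
    by rewrite mulr_ge0.
  exists (fine (Z (fun a => x ^+ a)%R (union_compositions_of Phi))) => _ [n _ <-].
  rewrite -lee_fin ZE; apply: (le_trans (partial_sum_le n x0)).
  by apply: Z_subset => c [].
rewrite leNgt; apply/negP => lt_r; have half : ((r / 2)%:E <= radius_of_convergence (fun n => N n))%E.
  by apply: in_sup; lra.
case: (radius_of_convergence _) in_sup lt_r half => [s| |] // in_sup.
rewrite lte_fin lee_fin => sr rs.
by have := in_sup ((s + r) / 2); rewrite lee_fin; lra.
Qed.

End RadiusOfConvergence.

Theorem theorem1 (R : realType) (m p : nat) (hm : (0 < m)%N) (hp : (0 < p)%N)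
    (Phi : set (restriction m p)) (hPhi : asymptotically_free_set Phi) :
  let r : R := fine (radius_of_convergence (fun n => #|` Comp Phi n|%:R)) in
  (forall k : nat, recurrent_part Phi k ->
     forall eps : R, 0 < eps ->
       (unif_prob R (Comp Phi n) (fun c =>
          eps < `| nparts_eq R k c / nparts R c - mean_ratio R Phi k n |)
          @[n --> \oo] --> 0)) /\
  (forall k : nat, recurrent_part Phi k -> cvgn (mean_ratio R Phi k)) /\
  (exists2 B : R, 0 < B &
     (fun k : nat => limn (mean_ratio R Phi k)) ~_\oo (fun k => B * r ^+ k)).
Proof.
have [_ Phi_sim [phi Pphi phi_free]] := hPhi.
have [phi_rec _ _] := phi_free.
have [r1 [r2 [x0 [i0 [M [bw repl]]]]]] := exists_marker hm hp phi_free.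
set w := tval r1 ++ x0 :: tval r2 in bw.
have w0 : w != [::] by exact: marker_neq0.
have pw : (p <= size w)%N by exact: marker_size.
have [y yret] := free_return hm hp phi_free bw repl.
have [n0 n0ret] := large_returns hm hp phi_free bw repl.
have [y1 [y2 [ry1 ry2 y12 sy12]]] := distinct_returns hm hp phi_free bw repl.
have [r [r01 r_below r_above]] := exists_radius R hm pw w0 bw ry1 ry2 y12 sy12.
have /andP[r_gt0 r_lt1] := r01.
have [|x1 rx1 av_x1] := gap hm hp phi_rec pw w0 bw r01.
  by move=> x i /r_below[_]; exact.
have /andP[rx1' x1_lt1] := rx1.
have x1_01 : 0 < x1 < 1 by apply/andP; split; lra.
have free_ret x : (M.+1 <= x)%N -> return_word phi w i0 ((y ++ r1) ++ x :: (r2 ++ y ++ w)).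
  by move=> Mx; apply: yret; lia.
have long_c : exists c0, compositions_of phi c0 /\ (p + p <= size c0)%N.
  have [u [v [Cuv pu pv _]]] := bw; exists (u ++ w ++ v); split=> //.
  by rewrite !size_cat; lia.
have [c0 c0P] := long_c.
(* Cycle sums of the free member alone serve as means for the whole class. *)
pose mean (f : nat -> R) := fine (cycle_sum phi w i0 r f).
have mean_fin f C : (forall a, 0 <= f a <= C * a%:R) -> ((mean f)%:E = cycle_sum phi w i0 r f)%E.
  move=> fC; rewrite fineK // ge0_fin_numE.
    exact: (cycle_sum_lty hm pw w0 r01 rx1 av_x1 fC).
  exact: (cycle_sum_ge0 _ _ _ r01 fC).
have mean_ge0 f C : (forall a, 0 <= f a <= C * a%:R) -> 0 <= mean f.
  by move=> fC; rewrite fine_ge0 // (cycle_sum_ge0 _ _ _ r01 fC).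
have mean_linear f g C alpha beta : (forall a, 0 <= f a <= C * a%:R) ->
    (forall a, 0 <= g a <= C * a%:R) -> 0 <= alpha -> 0 <= beta ->
    mean (fun a => alpha * f a + beta * g a) = alpha * mean f + beta * mean g.
  move=> fC gC alpha0 beta0; rewrite {1}/mean (cycle_sum_linear _ _ _ r01 fC gC) //.
  by rewrite -(mean_fin _ _ fC) -(mean_fin _ _ gC).
have mean_tilt f g C : (forall a, 0 <= f a <= C * a%:R) -> (forall a, 0 <= g a <= C * a%:R) ->
    0 < C -> mean f < mean g -> exists2 theta, 0 < theta &
      (Z (tilt r theta f g) (union_compositions_of Phi) < +oo)%E.
  move=> fC gC C0 fg.
  have [|theta [theta0 thx1 Zfin]] := large_deviations hm pw w0 bw r01 r_below rx1 av_x1 fC gC C0.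
    by rewrite -(mean_fin _ _ fC) -(mean_fin _ _ gC) lte_fin.
  exists theta => //; apply: (Z_union_lty hm hp Phi_sim Pphi c0P _ x1_01 thx1 Zfin).
  by move=> a; rewrite mulr_ge0 ?exprn_ge0 ?expR_ge0 // ltW.
have lower x : r < x -> exists2 c, 0 < c & exists n1, forall n, (n1 <= n)%N ->
    c <= #|` Comp Phi n|%:R * x ^+ n.
  move=> rx; have x_gt0 : 0 < x by lra.
  have [c c_gt0 low] := returns_lower hm pw w0 bw r01 r_above rx1 av_x1 n0ret rx.
  have [u [v Cuv]] := return_in_composition pw bw.
  (* The sum of the fixed context around a return, by which the indices of the two counts differ. *)
  pose s := (sumn u + sumn w + sumn v)%N.
  exists (c * x ^+ s); first by rewrite mulr_gt0 // exprn_gt0.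
  exists (n0 + s)%N => n n0n; have sn : (s <= n)%N by rewrite (leq_trans _ n0n) // leq_addl.
  rewrite -(subnK sn).
  rewrite exprD mulrA ler_pM2r ?exprn_gt0 //; apply: (le_trans (low (n - s)%N _)); first by rewrite leq_subRL // addnC.
  rewrite ler_wpM2r ?exprn_ge0 ?(ltW x_gt0) // ler_nat.
  rewrite -(size_map (fun y => u ++ w ++ y ++ v)); apply: uniq_leq_size.
    rewrite map_inj_in_uniq ?fset_uniq // => z z' _ _ /eqP.
    rewrite eqseq_cat // eqxx /= eqseq_cat // eqxx /= => /eqP e.
    by have := congr1 (rev) e; rewrite !rev_cat => /eqP; rewrite eqseq_cat // eqxx /= => /eqP/(can_inj revK).
  move=> _ /mapP[z /returnsP[rz sz] ->]; apply/CompP; split; first by exists phi => //; exact: Cuv.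
  by rewrite (sumn_cat u) (sumn_cat w) (sumn_cat z) sz /s (addnCA (sumn w)) addnCA !addnA.
have mean_one : 0 < mean (@one_part R).
  have [z1 [z2 [K cycK]]] := cycle_all_large hm hp pw w0 bw free_ret.
  have cy := cycK K (leqnn K).
  have cc : composition (z1 ++ K :: z2) by case: cy => _ /return_composition.
  rewrite -lte_fin (mean_fin _ _ (@one_part_adm R)).
  apply: (@lt_le_trans _ _ ((r ^+ sumn (z1 ++ K :: z2) * part_sum (@one_part R) (z1 ++ K :: z2))%:E)).
    by rewrite lte_fin mulr_gt0 ?exprn_gt0 // part_sum_one // size_cat addnS ltr0n.
  rewrite -[leLHS](@esum_set1 _ _ (z1 ++ K :: z2)
    (fun z => (r ^+ sumn z * part_sum (@one_part R) z)%:E)).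
    by apply: esum_subset => _ ->.
  by rewrite lee_fin mulr_ge0 ?exprn_ge0 ?(ltW r_gt0) // part_sum_one.
have below x : 0 < x < r -> (Z (fun a => x ^+ a)%R (union_compositions_of Phi) < +oo)%E.
  move=> /r_below[x01 xfin].
  apply: (Z_union_lty hm hp Phi_sim Pphi c0P _ x01 _ xfin) => // a.
  by rewrite exprn_ge0 // ltW //; case/andP: x01.
have ratio_cvg := mean_ratio_cvg r01 lower mean_ge0 mean_linear mean_tilt mean_one.
rewrite /= (radius_eq r01 lower below) /=; split; [|split].
- move=> k _ eps eps0.
  exact: (ratio_concentration r01 lower mean_ge0 mean_linear mean_tilt mean_one).
- by move=> k _; apply/cvg_ex; exists (part_density mean k); exact: ratio_cvg.
have [B B0 Bcvg] := cycle_sum_asymptotics hm hp phi_free pw w0 bw free_ret r01 rx1 av_x1.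
(* [B] is the limit of the mean number of parts k per cycle divided by r^k; it remains to divide by
   the mean number of parts per cycle. *)
exists (B / mean (@one_part R)); first exact: divr_gt0.
apply/eqaddoP => eps eps0; have epsB : 0 < eps * B by rewrite mulr_gt0.
have /cvgrPdist_le/(_ _ epsB) closeB := Bcvg.
near=> k; have k0 : (0 < k)%N by near: k; exact: nbhs_infty_gt.
have : `|B - mean (fun a : nat => (a == k)%:R) / r ^+ k| <= eps * B by near: k.
have -> : (fun a : nat => (a == k)%:R) = part_eq R k.
  apply/funext => a; rewrite /part_eq; case: eqP => [->|] //=; by rewrite k0.
move=> close.
rewrite fctE (cvg_lim _ (ratio_cvg k)) // /part_density -/mean.
have rk : 0 < r ^+ k by rewrite exprn_gt0.
have -> : mean (part_eq R k) / mean (@one_part R) - B / mean (@one_part R) * r ^+ k =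
    - (B - mean (part_eq R k) / r ^+ k) * (r ^+ k / mean (@one_part R)).
  by field; rewrite !gt_eqF.
have q0 : 0 < r ^+ k / mean (@one_part R) by rewrite divr_gt0.
rewrite normrM normrN (gtr0_norm q0).
have -> : B / mean (@one_part R) * r ^+ k = B * (r ^+ k / mean (@one_part R)) by ring.
rewrite normrM (gtr0_norm q0) (gtr0_norm B0) [leRHS]mulrA.
by rewrite ler_pM2r.
Unshelve. all: by end_near.
Qed.
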